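(* For every integer $d \ge 1$ there exist positive constants $c_d$ and $C_d$ depending only on $d$ such that for every integer $n \ge 2$, $$c_d\,\frac{(\log n)^{d/2}}{n} \;\le\; R_n(\mathcal{F}_d, L^2) \;\le\; C_d\,\frac{(\log n)^{d/2}}{n},$$ where $R_n(\mathcal{F}_d, L^2)$ is the minimax risk, under squared $L^2$ loss and based on $n$ i.i.d. observations, over the class $\mathcal{F}_d$ of all Gaussian location mixture densities on $\mathbb{R}^d$.
   Context: Let $\phi(x) = (2\pi)^{-1/2} e^{-x^2/2}$ be the standard univariate normal density. For $d \ge 1$, $\mathcal{F}_d$ denotes the class of all densities on $\mathbb{R}^d$ of the form $$(x_1,\ldots,x_d) \mapsto \int \phi(x_1-u_1)\phi(x_2-u_2)\cdots\phi(x_d-u_d)\, dG(u_1,\ldots,u_d),$$ where $G$ is an arbitrary (Borel) probability measure on $\mathbb{R}^d$. The squared $L^2$ loss is $L^2(f,g) := \int_{\mathbb{R}^d} (f(x)-g(x))^2\,dx$ (note that $L^2(f,g)$ denotes the squared distance). One observes i.i.d. random vectors $X_1,\ldots,X_n$ with unknown density $f^* \in \mathcal{F}_d$. The minimax risk is $$R_n(\mathcal{F}_d, L^2) := \inf_{\hat f_n}\ \sup_{f^*\in\mathcal{F}_d} \mathbb{E}_{f^*} L^2(\hat f_n, f^* ),$$ where the infimum is over all estimators $\hat f_n$, i.e. measurable functions of the data $X_1,\ldots,X_n$ taking values in real-valued functions on $\mathbb{R}^d$ (the estimate need not itself be a density), and $\mathbb{E}_{f^*}$ is expectation when $X_1,\ldots,X_n$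 are i.i.d. with density $f^*$. *)

(* Defs.v *)
From HB Require Import structures.
From mathcomp Require Import all_boot all_order all_algebra.
From mathcomp Require Import all_classical all_reals all_analysis.

Set Implicit Arguments.
Unset Strict Implicit.
Unset Printing Implicit Defensive.

Import Order.TTheory GRing.Theory Num.Theory.
Import numFieldNormedType.Exports.

Local Open Scope classical_set_scope.
Local Open Scope ring_scope.

(* The n-fold product of a sigma-finite measure, on the product sigma-algebra
   that the library puts on tuples; see [tuple_measure_box]. *)
Section tuple_measure.
Context d (T : measurableType d) (R : realType).

Definition cons_pair n (p : T * n.-tuple T) : n.+1.-tuple T :=
  [the n.+1.-tuple T of p.1 :: p.2].

Lemma measurable_cons_pair n :
  measurable_fun [set: T * n.-tuple T] (@cons_pair n).
Proof. exact: measurable_cons. Qed.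

Section cons_measure.
Variables (n : nat) (m1 : {sigma_finite_measure set T -> \bar R}).
Variable m2 : {sigma_finite_measure set (n.-tuple T) -> \bar R}.

Definition cons_measure : set (n.+1.-tuple T) -> \bar R :=
  pushforward (m1 \x m2)%E (@cons_pair n).

Let cons_measure0 : cons_measure set0 = 0%E.
Proof. by rewrite /cons_measure /pushforward preimage_set0 measure0. Qed.

Let cons_measure_ge0 A : (0 <= cons_measure A)%E.
Proof. by rewrite /cons_measure /pushforward; exact: measure_ge0. Qed.

Let cons_measure_sigma_additive : semi_sigma_additive cons_measure.
Proof.
move=> F mF tF mUF; have mcons A : measurable A ->
    measurable (@cons_pair n @^-1` A).
  by move=> mA; rewrite -[X in measurable X]setTI; exact: measurable_cons_pair.
rewrite /cons_measure /pushforward preimage_bigcup.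
apply: measure_semi_sigma_additive => [i||]; first exact: mcons.
  apply/trivIsetP => i j _ _ ij; rewrite -preimage_setI.
  by move/trivIsetP : tF => /(_ _ _ _ _ ij) ->//; rewrite preimage_set0.
by rewrite -preimage_bigcup; exact: mcons.
Qed.

HB.instance Definition _ := isMeasure.Build _ _ _ cons_measure
  cons_measure0 cons_measure_ge0 cons_measure_sigma_additive.

Let cons_measure_sigma_finite : sigma_finite setT cons_measure.
Proof.
have /sigma_finiteP[F [FT Fnd Foo]] := sigma_finiteT m1.
have /sigma_finiteP[G [GT Gnd Goo]] := sigma_finiteT m2.
pose uncons (t : n.+1.-tuple T) := (thead t, [tuple of behead t]).
have unconsK p : uncons (cons_pair p) = p.
  by case: p => x t; rewrite /uncons /=; congr pair; apply/val_inj.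
have consK t : cons_pair (uncons t) = t by rewrite [RHS]tuple_eta; apply/val_inj.
have muncons : measurable_fun setT uncons.
  by apply/measurable_fun_pairP; split;
    [exact: measurable_tnth|exact: measurable_behead].
exists (fun i => uncons @^-1` (F i `*` G i)).
  rewrite -preimage_bigcup (_ : \bigcup_i _ = setT) ?preimage_setT//.
  apply/seteqP; split => // -[x t] _.
  have [i _ Fx] : (\bigcup_i F i) x by rewrite -FT.
  have [j _ Gt] : (\bigcup_i G i) t by rewrite -GT.
  exists (maxn i j) => //; split.
    by move: x Fx; exact/subsetPset/Fnd/leq_maxl.
  by move: t Gt; exact/subsetPset/Gnd/leq_maxr.
move=> i; have [mF Fi] := Foo i; have [mG Gi] := Goo i; split.
  by rewrite -[X in measurable X]setTI; apply: muncons => //; exact: measurableX.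
rewrite /cons_measure /pushforward (_ : _ @^-1` _ = F i `*` G i).
  by rewrite product_measure1E// lte_mul_pinfty// ge0_fin_numE.
by rewrite -comp_preimage (_ : uncons \o _ = id)//; exact/funext.
Qed.

HB.instance Definition _ := Measure_isSigmaFinite.Build _ _ _ cons_measure
  cons_measure_sigma_finite.

End cons_measure.

Fixpoint tuple_measure (m : {sigma_finite_measure set T -> \bar R}) n :
    {sigma_finite_measure set (n.-tuple T) -> \bar R} :=
  match n with
  | 0 => \d_([tuple] : 0.-tuple T)
  | n'.+1 => cons_measure m (tuple_measure m n')
  end.

Lemma tuple_measure_box (m : {sigma_finite_measure set T -> \bar R}) n
    (A : 'I_n -> set T) : (forall i, measurable (A i)) ->
  tuple_measure m n [set t | forall i, A i (tnth t i)] = (\prod_(i < n) m (A i))%E.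
Proof.
elim: n A => [|n IH] A mA /=.
  by rewrite big_ord0 diracE mem_set// => -[].
rewrite big_ord_recl -IH// /cons_measure /pushforward -product_measure1E//.
  congr ((_ \x _)%E _); apply/seteqP; split => -[x t] /=.
    move=> At; split=> [|i]; first exact: (At ord0).
    by have := At (lift ord0 i); rewrite /cons_pair tnthS.
  move=> [Ax At] i; case: (unliftP ord0 i) => [j ->|->//].
  by rewrite /cons_pair tnthS.
rewrite (_ : [set _ | _] = \bigcap_(i in setT) ((fun t => tnth t i) @^-1` A (lift ord0 i))).
  apply: fin_bigcap_measurable => // i _; rewrite -[X in measurable X]setTI.
  exact: measurable_tnth.
by apply/seteqP; split => [t At i _|t At i]; exact: At.
Qed.

End tuple_measure.

(* R^d with its Borel sigma-algebra *)
Notation euclid R d := (d.-tuple (measurableTypeR R)).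

Section minimax.
Context (R : realType) (d : nat).
Implicit Types (f g : euclid R d -> R) (P : probability (euclid R d) R).

Definition lebesgue_measure_d :
    {sigma_finite_measure set (euclid R d) -> \bar R} :=
  tuple_measure (@lebesgue_measure R) d.

Definition has_density P f :=
  forall A, measurable A -> P A = (\int[lebesgue_measure_d]_(x in A) (f x)%:E)%E.

Definition gaussian_mixture (G : probability (euclid R d) R)
    (x : euclid R d) : R :=
  \int[G]_u \prod_(i < d) normal_pdf 0 1 (tnth x i - tnth u i).

Definition gaussian_mixtures : set (euclid R d -> R) := range gaussian_mixture.

Definition L2_loss f g : \bar R :=
  (\int[lebesgue_measure_d]_x ((f x - g x) ^+ 2)%:E)%E.

(* Joint measurability in (data, argument) makes the loss a measurable function
   of the data. *)
Definition estimators n : set (n.-tuple (euclid R d) -> euclid R d -> R) :=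
  [set fhat | measurable_fun [set: n.-tuple (euclid R d) * euclid R d]
                (fun z => fhat z.1 z.2)].

Definition risk (loss : (euclid R d -> R) -> (euclid R d -> R) -> \bar R) n
    (fhat : n.-tuple (euclid R d) -> euclid R d -> R) P f : \bar R :=
  (\int[tuple_measure P n]_X loss (fhat X) f)%E.

(* The density f determines the law P of one observation, so the supremum over
   pairs (P, f) is a supremum over f in F. *)
Definition minimax_risk (F : set (euclid R d -> R))
    (loss : (euclid R d -> R) -> (euclid R d -> R) -> \bar R) n : \bar R :=
  ereal_inf [set ereal_sup [set r | exists P f,
                              [/\ F f, has_density P f & r = risk loss fhat P f]]
            | fhat in @estimators n].

End minimax.

Arguments gaussian_mixtures : clear implicits.
Arguments L2_loss {R d}.

(* Main.v *)
From HB Require Import structures.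
Require Import Defs.
From mathcomp Require Import all_boot all_order all_algebra.
From mathcomp Require Import all_classical all_reals all_analysis.
From mathcomp Require Import measurable_realfun ring lra.

(** Write phi for the standard normal density and T for the square root of
    ln n.

    Upper bound. The estimator is the average over the observations X_k of the
    product kernels that send x to the product of the k_T (x_i - X_(k,i)), where
    k_T (z) = sin (T z) / (pi z) is the ideal low-pass filter with cut-off T. Its
    integrated variance is at most the squared norm of the kernel divided by n,
    hence at most (2 T / pi)^d / n ([integral_sinc_kernel_sqr]). For the bias,
    smoothing commutes with mixing ([sinc_kernel_mixture]), and Jensen's
    inequality bounds the integrated squared bias for a mixture by the one for a
    single Gaussian. There it is a matter of one coordinate
    ([integral_prod_diff_sqr]): phi minus its convolution with k_T is the
    high-frequency tail
      1 / pi * integral over t >= T of exp (- t^2 / 2) cos (t z) dt,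
    and both this tail and z times this tail, by an integration by parts, are
    O(exp (- T^2 / 2)) ([normal_sub_sinc_gauss_le]); the squared norm is thus
    O(exp (- T^2)) = O(1 / n).

    Lower bound. Let w be the density of N(0, 2 I) and let S_j be the product of
    the sin ((j_i + 1) x_i), for j in {0, ..., m - 1}^d. The hard instances are
    the densities w (1 + b sum_j +-S_j), over all choices of signs. They are
    Gaussian mixtures: convolution with phi sends phi (u) sin (2 k u) to
    exp (- k^2) times the N(0, 2) density times sin (k x) ([normal_sin_conv]), so
    that it suffices to multiply the coefficient of S_j in the mixing density by
    the inverse attenuation, and the mixing density stays nonnegative while b
    times the sum of these gains is at most 1/2 ([mod_density_mixture]). The sum
    of the gains is at most exp (2 d m^2). With m of the order of T, suitably
    scaled, an amplitude b of order n^(-1/2) is thus allowed.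

    The S_j are orthogonal on the cube [-pi, pi]^d, where w is bounded below;
    hence each of the m^d signs that is not recovered from the data costs a
    constant times b^2 = O(1 / n), and with this amplitude n observations do not
    determine any of the signs. Duality makes this precise. For weights
    p_e > 0, functions z_e with sum zero and any real y, the weighted sum of the
    squared errors of y has a lower bound in which y does not occur
    ([sum_sqr_certificate]). The choice of z_e made in
    [weighted_loss_lower_bound] sums to zero because the likelihood of the density
    whose j-th coefficient is set to zero does not depend on the j-th sign. What
    remains is a chi-square computation ([integrable_density_ratio]): each
    factor is at most 1 + 2 b^2, and (1 + 2 b^2)^n is at most 2. The average of
    the risks over the signs is then at least a constant times m^d b^2, which is
    of the order of (ln n)^(d/2) / n. *)

Set Implicit Arguments.
Unset Strict Implicit.
Unset Printing Implicit Defensive.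
Import Order.TTheory GRing.Theory Num.Theory.
Import numFieldNormedType.Exports.
Local Open Scope classical_set_scope.
Local Open Scope ring_scope.

(** * Integrals of bounded functions under a probability *)

Section probability_integrals.
Context {R : realType}.

Lemma probability_integrable_bounded d0 (T : measurableType d0) (P : probability T R)
    (g : T -> R) (K : R) : measurable_fun setT g -> (forall x, `|g x| <= K) ->
  P.-integrable setT (EFin \o g).
Proof.
move=> mg gK; apply: measurable_bounded_integrable => //.
  by apply: (le_lt_trans (probability_le1 P measurableT)); rewrite ltry.
exists K; split; first exact: num_real.
by move=> x Kx y _; exact: le_trans (gK y) (ltW Kx).
Qed.

Lemma probability_integral_cst d0 (T : measurableType d0) (P : probability T R) (k : R) :
  (\int[P]_x k%:E = k%:E)%E.
Proof.
by rewrite integral_cst// -[RHS]mule1; congr (_ * _)%E; exact: probability_setT.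
Qed.

(** Jensen's inequality for the square: integrate [(g - c) ^+ 2 >= 0] with [c]
    the mean of [g]. *)
Lemma sqr_Rintegral_le d0 (T : measurableType d0) (P : probability T R)
    (g : T -> R) (K : R) : measurable_fun setT g -> (forall x, `|g x| <= K) ->
  (((\int[P]_x g x) ^+ 2)%:E <= \int[P]_x (g x ^+ 2)%:E)%E.
Proof.
move=> mg gK; have ig := probability_integrable_bounded P mg gK.
have ig2 : P.-integrable setT (EFin \o (fun x => g x ^+ 2)).
  apply: (probability_integrable_bounded P (K := K ^+ 2)) => [|x]; first exact: measurable_funX.
  by rewrite normrX lerXn2r ?nnegrE// (le_trans _ (gK x)).
set c := Rintegral _ _ _.
have ic : P.-integrable setT (EFin \o cst (c ^+ 2)).
  exact: (probability_integrable_bounded P (K := `|c ^+ 2|)).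
have i2 := integrableZl measurableT (2 * c) ig.
have intg : (\int[P]_x (g x)%:E = c%:E)%E by rewrite fineK// integrable_fin_num.
have <- : (\int[P]_x ((2 * c)%:E * (g x)%:E - (c ^+ 2)%:E) = (c ^+ 2)%:E)%E.
  rewrite (integralB measurableT i2 ic) integralZl//= intg probability_integral_cst.
  by rewrite -EFinM -EFinB; congr EFin; ring.
apply: le_integral => //; first exact: (integrableB measurableT i2 ic).
by move=> x _; rewrite lee_fin; have := sqr_ge0 (g x - c); lra.
Qed.

End probability_integrals.

(** * Integration against product measures on tuples *)

Section tuple_integrals.
Context d (T : measurableType d) (R : realType).
Implicit Types m P : {sigma_finite_measure set T -> \bar R}.

Lemma ge0_integral_tuple_cons m n (F : n.+1.-tuple T -> \bar R) :
  measurable_fun [set: n.+1.-tuple T] F -> (forall t, 0 <= F t)%E ->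
  (\int[tuple_measure m n.+1]_t F t =
   \int[m]_x \int[tuple_measure m n]_t F [tuple of x :: t])%E.
Proof.
move=> mF F0.
rewrite [LHS](@ge0_integral_pushforward _ _ _ _ R _
  (measurable_cons_pair (n:=n)) (m \x tuple_measure m n)%E setT)//=.
rewrite preimage_setT fubini_tonelli1//=.
  by apply: (measurableT_comp mF); exact: measurable_cons_pair.
Qed.

Lemma measurable_prod_tnth n (f : 'I_n -> T -> R) :
  (forall i, measurable_fun setT (f i)) ->
  measurable_fun [set: n.-tuple T] (fun t : n.-tuple T => \prod_i f i (tnth t i)).
Proof.
move=> mf; apply: measurable_prod => i _.
exact: (measurableT_comp (mf i) (measurable_tnth i)).
Qed.

Lemma ge0_integral_tuple_prod m n (f : 'I_n -> T -> R) :
  (forall i, measurable_fun setT (f i)) -> (forall i x, 0 <= f i x) ->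
  (\int[tuple_measure m n]_t (\prod_i f i (tnth t i))%:E =
   \prod_i \int[m]_x (f i x)%:E)%E.
Proof.
elim: n f => [|n IH] f mf f0.
  rewrite big_ord0 (eq_integral (cst 1%E)) => [|x _]; last by rewrite big_ord0.
  by rewrite /= integral_dirac// diracT mul1e.
rewrite ge0_integral_tuple_cons; first last.
- by move=> t; rewrite lee_fin prodr_ge0.
- by apply/measurable_EFinP; exact: measurable_prod_tnth.
rewrite big_ord_recl -(IH (fun i => f (lift ord0 i)))//.
rewrite -ge0_integralZr//; first last.
- by apply: integral_ge0 => t _; rewrite lee_fin prodr_ge0.
- by move=> x _; rewrite lee_fin.
- by apply/measurable_EFinP.
apply: eq_integral => x _; rewrite -ge0_integralZl//; first last.
- by rewrite lee_fin.
- by move=> t _; rewrite lee_fin prodr_ge0.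
- apply/measurable_EFinP.
  exact: (measurable_prod_tnth (f := fun i => f (lift ord0 i))).

apply: eq_integral => t _; rewrite -EFinM big_ord_recl; congr (_ * _)%:E.
by apply: eq_bigr => i _; rewrite tnthS.
Qed.

Lemma integrable_tuple_prod m n (f : 'I_n -> T -> R) :
  (forall i, m.-integrable setT (EFin \o f i)) ->
  (tuple_measure m n).-integrable setT
    (fun t => (\prod_i f i (tnth t i))%:E).
Proof.
move=> fi; have mf i : measurable_fun setT (f i).
  by apply/measurable_EFinP; exact: measurable_int (fi i).
apply/integrableP; split.
  by apply/measurable_EFinP; exact: measurable_prod_tnth.
under eq_integral do rewrite abse_EFin normr_prod.
rewrite (ge0_integral_tuple_prod m (f := fun i x => `|f i x|))//.
  rewrite -ge0_fin_numE; last by apply: prode_ge0 => i _; exact: integral_ge0.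
  apply: (big_ind (fun x => x \is a fin_num)) => // [x y|i _]; first exact: fin_numM.
  rewrite ge0_fin_numE; last exact: integral_ge0.
  by have /integrableP[_] := fi i.
by move=> i; apply: measurableT_comp => //.
Qed.

Lemma integral_tuple_cons m n (F : n.+1.-tuple T -> \bar R) :
  (tuple_measure m n.+1).-integrable setT F ->
  (\int[tuple_measure m n.+1]_t F t =
   \int[m]_x \int[tuple_measure m n]_t F [tuple of x :: t])%E.
Proof.
move=> iF; have mF := measurable_int _ iF.
have mcons := measurable_cons_pair (n:=n) (T:=T).
have iFc : (m \x tuple_measure m n)%E.-integrable setT (F \o @cons_pair _ T n).
  apply/integrableP; split; first exact: measurableT_comp.
  have /integrableP[_] := iF.
  rewrite [X in (X < _)%E -> _](@ge0_integral_pushforward _ _ _ _ R _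
    mcons (m \x tuple_measure m n)%E setT)//=.
  exact: measurableT_comp.
rewrite [LHS](@integral_pushforward _ _ _ _ R _ mcons
  (m \x tuple_measure m n)%E setT F mF)//=.
by rewrite preimage_setT -integral12_prod_meas1.
Qed.

Lemma Rintegral_tuple_prod m n (f : 'I_n -> T -> R) :
  (forall i, m.-integrable setT (EFin \o f i)) ->
  \int[tuple_measure m n]_t (\prod_i f i (tnth t i)) =
  \prod_i \int[m]_x f i x.
Proof.
move=> fi; suff : (\int[tuple_measure m n]_t (\prod_i f i (tnth t i))%:E =
  (\prod_i \int[m]_x f i x)%R%:E)%E by rewrite /Rintegral => ->.
elim: n f fi => [|n IH] f fi.
  rewrite big_ord0 (eq_integral (cst 1%E)) => [|x _]; last by rewrite big_ord0.
  by rewrite /= integral_dirac// diracT mul1e.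
rewrite integral_tuple_cons; last exact: integrable_tuple_prod.
rewrite big_ord_recl EFinM.
have fin0 : (\int[m]_x (f ord0 x)%:E)%E \is a fin_num.
  exact: (integrable_fin_num measurableT (fi ord0)).
rewrite [X in (X%:E * _)%E]/Rintegral fineK//.
rewrite -(integralZr measurableT (fi ord0)); apply: eq_integral => x _.
rewrite -IH//= -(integralZl measurableT (integrable_tuple_prod (fun i => fi (lift ord0 i)))).
apply: eq_integral => t _; rewrite -EFinM big_ord_recl; congr (_ * _)%:E.
by apply: eq_bigr => i _; rewrite tnthS.
Qed.

(** By uniqueness of the Radon-Nikodym derivative, [f] agrees almost everywhere
    with the derivative of [P], and the change of variables passes to [f]. *)
Lemma integral_density (m : {sigma_finite_measure set T -> \bar R})
    (P : probability T R) (f : T -> R) (F : T -> \bar R) :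
  measurable_fun setT f -> (forall x, 0 <= f x) ->
  (forall A, measurable A -> P A = \int[m]_(x in A) (f x)%:E)%E ->
  measurable_fun setT F -> (forall x, 0 <= F x)%E ->
  (\int[P]_x F x = \int[m]_x (F x * (f x)%:E))%E.
Proof.
move=> mf f0 Pf mF F0.
have Pm : P `<< m.
  apply/null_content_dominatesP => A mA mA0; apply: (etrans (Pf A mA)).
  by apply: null_set_integral => //; apply/measurable_EFinP; exact: measurable_funTS.
rewrite -(Radon_Nikodym_SigmaFinite.change_of_variables Pm)//.
have mRN := measurable_int _ (Radon_Nikodym_SigmaFinite.f_integrable Pm).
have ae : ae_eq m setT (Radon_Nikodym_SigmaFinite.f P m) (EFin \o f).
  apply: integral_ae_eq => //.
  - exact: Radon_Nikodym_SigmaFinite.f_integrable.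
  - exact/measurable_EFinP.
  - move=> A _ mA.
    exact: etrans (esym (Radon_Nikodym_SigmaFinite.f_integral Pm mA)) (Pf A mA).
apply: ge0_ae_eq_integral => //.
- exact: emeasurable_funM.
- by apply: emeasurable_funM => //; exact/measurable_EFinP.
- by move=> x _; rewrite mule_ge0// Radon_Nikodym_SigmaFinite.f_ge0.
- by move=> x _; rewrite mule_ge0// lee_fin.
- exact: ae_eqe_mul2l.
Qed.

(** One coordinate at a time. The formula for a single observation is a
    hypothesis on all nonnegative functions because the induction applies it to
    partial integrals of [F]. *)
Lemma integral_tuple_density m P (f : T -> R) n (F : n.-tuple T -> \bar R) :
  measurable_fun setT f -> (forall x, 0 <= f x) ->
  (forall H : T -> \bar R, measurable_fun setT H -> (forall x, 0 <= H x)%E ->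
    \int[P]_x H x = \int[m]_x (H x * (f x)%:E))%E ->
  measurable_fun [set: n.-tuple T] F -> (forall x, 0 <= F x)%E ->
  (\int[tuple_measure P n]_t F t =
   \int[tuple_measure m n]_t (F t * (\prod_i f (tnth t i))%:E))%E.
Proof.
move=> mf f0 Pf; elim: n F => [|n IH] F mF F0.
  by apply: eq_integral => t _; rewrite big_ord0 mule1.
have mcons x : measurable_fun [set: n.-tuple T] (fun t => [tuple of x :: t]).
  exact: measurable_cons.
have mFp : measurable_fun [set: T * n.-tuple T]
    (fun z => F [tuple of z.1 :: z.2] * (\prod_i f (tnth z.2 i))%:E)%E.
  apply: emeasurable_funM.
    by apply: (measurableT_comp mF); exact: measurable_cons_pair.
  apply/measurable_EFinP.
  apply: (measurableT_comp (measurable_prod_tnth (fun=> mf)) measurable_snd).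
have prod_ge0 k (t : k.-tuple T) : (0 <= (\prod_i f (tnth t i))%:E)%E.
  by rewrite lee_fin prodr_ge0.
rewrite !ge0_integral_tuple_cons//; first last.
- by move=> t; rewrite mule_ge0.
- apply: emeasurable_funM => //; apply/measurable_EFinP.
  exact: (measurable_prod_tnth (f := fun=> f)).
under eq_integral => x _.
  rewrite IH//; last exact: (measurableT_comp mF).
  over.
rewrite Pf; first last.
- by move=> x; apply: integral_ge0 => t _; rewrite mule_ge0.
- by apply: (measurable_fun_fubini_tonelli_F (fun z : T * n.-tuple T =>
    F [tuple of z.1 :: z.2] * (\prod_i f (tnth z.2 i))%:E)%E) => // z; rewrite mule_ge0.
apply: eq_integral => x _; rewrite -ge0_integralZr//; first last.
- by rewrite lee_fin.
- by move=> t _; rewrite mule_ge0.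
- exact: (measurableT_comp mFp (measurable_pair1 x)).
apply: eq_integral => t _; rewrite -muleA -EFinM big_ord_recl mulrC; congr (_ * (_ * _)%:E)%E.
by apply: eq_bigr => i _; rewrite tnthS.
Qed.

(** Independence kills the cross terms. Integrating out the first coordinate [x]
    replaces [b] by [W x + b], hence the arbitrary shift [b] in the induction.
    For an estimator that is an average of independent terms, [b] is the bias
    and the other term the variance. *)
Lemma integral_tuple_sum_sqr (P : probability T R) (W : T -> R) (M : R) n (b : R) :
  measurable_fun setT W -> (forall x, `|W x| <= M) -> \int[P]_x W x = 0 ->
  (\int[tuple_measure P n]_t ((\sum_i W (tnth t i) + b) ^+ 2)%:E =
   (n%:R * (\int[P]_x (W x ^+ 2)) + b ^+ 2)%:E)%E.
Proof.
move=> mW WM W0; set v := Rintegral _ _ _.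
elim: n b => [|n IH] b.
  rewrite (eq_integral (cst (b ^+ 2)%:E)) => [|x _]; last by rewrite big_ord0 add0r.
  by rewrite /= integral_dirac// diracT mul1e mul0r add0r.
rewrite ge0_integral_tuple_cons; first last.
- by move=> t; rewrite lee_fin sqr_ge0.
- apply/measurable_EFinP; apply: measurable_funX; apply: measurable_funD => //.
  apply: measurable_sum => i; exact: (measurableT_comp mW (measurable_tnth i)).
have iC k : P.-integrable setT (fun=> k%:E).
  exact: (probability_integrable_bounded P (g := cst k) (K := `|k|)).
have iW := probability_integrable_bounded P mW WM.
have iW2 : P.-integrable setT (EFin \o (fun x => W x ^+ 2)).
  apply: (probability_integrable_bounded P (K := M ^+ 2)) => [|x]; first exact: measurable_funX.
  by rewrite normrX lerXn2r ?nnegrE// (le_trans _ (WM x)).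
transitivity (\int[P]_x ((n%:R * v + b ^+ 2)%:E + (W x ^+ 2)%:E + (2 * b)%:E * (W x)%:E))%E.
  apply: eq_integral => x _; transitivity ((n%:R * v + (W x + b) ^+ 2)%:E); last first.
    by rewrite -EFinM -!EFinD; congr EFin; ring.
  rewrite -IH; apply: eq_integral => t _; congr (_ ^+ 2)%:E.
  rewrite big_ord_recl -addrA [RHS]addrCA; congr (_ + (_ + _)).
  by apply: eq_bigr => i _; rewrite tnthS.
rewrite integralD//; last 2 first.
- by apply: integrableD => //; exact: iC.
- exact: integrableZl.
rewrite integralD; [|by []|exact: iC|exact: iW2].
rewrite integralZl//= probability_integral_cst.
have -> : (\int[P]_x (W x)%:E = 0)%E.
  by rewrite -[LHS]fineK ?integrable_fin_num//; congr EFin; exact: W0.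
rewrite mule0 adde0.
have -> : (\int[P]_x (W x ^+ 2)%:E = v%:E)%E.
  by rewrite -[LHS]fineK// integrable_fin_num.
by rewrite -EFinD; congr EFin; rewrite -[n.+1]addn1 natrD; ring.
Qed.

End tuple_integrals.

Lemma Rintegral_Fubini d1 d2 (T1 : measurableType d1) (T2 : measurableType d2)
    (R : realType) (m1 : {sigma_finite_measure set T1 -> \bar R})
    (m2 : {sigma_finite_measure set T2 -> \bar R}) (f : T1 -> T2 -> R) :
  (m1 \x m2)%E.-integrable setT (fun z => (f z.1 z.2)%:E) ->
  (forall x, m2.-integrable setT (fun y => (f x y)%:E)) ->
  (forall y, m1.-integrable setT (fun x => (f x y)%:E)) ->
  \int[m1]_x \int[m2]_y f x y = \int[m2]_y \int[m1]_x f x y.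
Proof.
move=> fi f1 f2; congr fine.
transitivity (\int[m1]_x \int[m2]_y (f x y)%:E)%E.
  by apply: eq_integral => x _; rewrite fineK// integrable_fin_num.
rewrite (@Fubini _ _ _ _ _ m1 m2 (fun z => (f z.1 z.2)%:E) fi)/=.
by apply: eq_integral => y _; rewrite fineK// integrable_fin_num.
Qed.

Lemma integrable_Rintegral d1 d2 (T1 : measurableType d1) (T2 : measurableType d2)
    (R : realType) (m1 : {sigma_finite_measure set T1 -> \bar R})
    (m2 : {sigma_finite_measure set T2 -> \bar R}) (f : T1 -> T2 -> R) :
  (m1 \x m2)%E.-integrable setT (fun z => (f z.1 z.2)%:E) ->
  (forall x, m2.-integrable setT (fun y => (f x y)%:E)) ->
  m1.-integrable setT (EFin \o (fun x => \int[m2]_y f x y)).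
Proof.
move=> fi f1; apply: eq_integrable (integrable_fubini_F fi) => // x _.
by rewrite /fubini_F/= fineK// integrable_fin_num.
Qed.

(** * Symmetries of Lebesgue measure and improper integrals *)

Section lebesgue_invariance.
Context {R : realType}.
Notation mu := (@lebesgue_measure R).

Lemma lebesgue_measure_shift (c : R) (A : set R) : measurable A ->
  pushforward mu ((fun x => x + c) : _ -> measurableTypeR R) A = mu A.
Proof.
have mshift : measurable_fun setT ((fun x => x + c) : R -> measurableTypeR R).
  exact: measurable_funD.
move=> mA; apply/esym/lebesgue_measure_unique => //= _ [[a b]] _ <-.
rewrite /pushforward (_ : _ @^-1` _ = `]a - c, b - c]%classic); last first.
  by apply/seteqP; split => x /=; rewrite !in_itv/= ltrBlDr lerBrDr.
rewrite !lebesgue_measure_itv/= !lte_fin ltrD2r; case: ifP => // _.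
by rewrite -!EFinB; congr EFin; ring.
Qed.

Lemma ge0_integral_shift (c : R) (f : R -> \bar R) :
  measurable_fun setT f -> (forall x, 0 <= f x)%E ->
  (\int[mu]_x f (x - c)%R = \int[mu]_x f x)%E.
Proof.
move=> mf f0.
have mshift : measurable_fun setT ((fun x => x - c) : R -> measurableTypeR R).
  exact: measurable_funB.
transitivity (\int[pushforward mu ((fun x => (x - c)%R) : R -> measurableTypeR R)]_x f x)%E.
  by rewrite ge0_integral_pushforward.
by apply: eq_measure_integral => A mA _; exact: lebesgue_measure_shift.
Qed.

Lemma integrable_shift (c : R) (f : R -> R) :
  mu.-integrable setT (EFin \o f) ->
  mu.-integrable setT (EFin \o (fun x => f (x - c))).
Proof.
move=> /integrableP[/measurable_EFinP mf fi]; apply/integrableP; split.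
  by apply/measurable_EFinP; apply: (measurableT_comp mf); exact: measurable_funB.
rewrite /= (ge0_integral_shift c (f := fun x => `|(f x)%:E|%E))//.
by apply: measurableT_comp => //; exact/measurable_EFinP.
Qed.

Lemma Rintegral_shift (c : R) (f : R -> R) :
  mu.-integrable setT (EFin \o f) ->
  \int[mu]_x f (x - c) = \int[mu]_x f x.
Proof.
move=> fi; have fci := integrable_shift c fi.
have mshift : measurable_fun setT ((fun x => x - c) : R -> measurableTypeR R).
  exact: measurable_funB.
congr fine.
transitivity (\int[pushforward mu ((fun x => (x - c)%R) : R -> measurableTypeR R)]_x (f x)%:E)%E.
  by rewrite integral_pushforward//; exact: measurable_int fi.
by apply: eq_measure_integral => A mA _; exact: lebesgue_measure_shift.
Qed.

Lemma integrable_opp (f : R -> R) : mu.-integrable setT (EFin \o f) ->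
  mu.-integrable setT (EFin \o (fun x => f (- x))).
Proof.
move=> /integrableP[/measurable_EFinP mf fi]; apply/integrableP; split.
  by apply/measurable_EFinP; exact: (measurableT_comp mf).
rewrite (_ : integral _ _ _ = \int[mu]_x `|(f x)%:E|)%E//.
transitivity (\int[pushforward mu (-%R : R -> measurableTypeR R)]_x `|(f x)%:E|)%E.
  rewrite ge0_integral_pushforward//.
  by apply: measurableT_comp => //; exact/measurable_EFinP.
by apply: eq_measure_integral => A mA _; exact: lebesgue_measureN.
Qed.

Lemma Rintegral_opp (f : R -> R) : mu.-integrable setT (EFin \o f) ->
  \int[mu]_x f (- x) = \int[mu]_x f x.
Proof.
move=> fi; have fNi := integrable_opp fi.
congr fine; transitivity (\int[pushforward mu (-%R : R -> measurableTypeR R)]_x (f x)%:E)%E.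
  by rewrite integral_pushforward//; exact: measurable_int fi.
by apply: eq_measure_integral => A mA _; exact: lebesgue_measureN.
Qed.

Lemma Rintegral_odd (f : R -> R) : mu.-integrable setT (EFin \o f) ->
  (forall x, f (- x) = - f x) -> \int[mu]_x f x = 0.
Proof.
move=> fi fN; have := Rintegral_opp fi.
have -> : \int[mu]_x f (- x) = - \int[mu]_x f x.
  rewrite -mulN1r -RintegralZl//; apply: eq_Rintegral => x _.
  by rewrite fN mulN1r.
by move: (Rintegral _ _ _) => v {fi fN} vN; lra.
Qed.

Lemma Rintegral_even (f : R -> R) : mu.-integrable setT (EFin \o f) ->
  (forall x, f (- x) = f x) -> \int[mu]_x f x = 2 * \int[mu]_(x in `[0, +oo[) f x.
Proof.
move=> fi fN; have mf : measurable_fun setT f.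
  by apply/measurable_EFinP; exact: measurable_int fi.
have E : [set: R] = `]-oo, 0[ `|` `[0, +oo[.
  by apply/seteqP; split => x //= _; rewrite !in_itv/= andbT; case: ltP; [left|right].
rewrite [in LHS]E Rintegral_setU//; first last.
- apply/disj_setPS => x [] /=; rewrite !in_itv/= andbT => x0 x1.
  by move: (lt_le_trans x0 x1); rewrite ltxx.
- by rewrite -E.
rewrite mulr_natl mulr2n; congr (_ + _).
have fi0 : mu.-integrable setT (EFin \o (f \_ `]-oo, 0[)).
  rewrite -restrict_EFin -integrable_mkcond//.
  exact: integrableS fi.
rewrite Rintegral_mkcond -(Rintegral_opp fi0).
transitivity (\int[mu]_(x in `]0, +oo[) f x).
  rewrite [RHS]Rintegral_mkcond; apply: eq_Rintegral => x _.
  rewrite !patchE fN; congr (if _ then _ else _).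
  by apply/idP/idP; rewrite !inE/= !in_itv/= oppr_lt0 andbT.
by rewrite Rintegral_itv_obnd_cbnd//; exact: integrableS fi.
Qed.

(** Fundamental theorem of calculus on a possibly unbounded domain [D], exhausted
    by segments through dominated convergence. It is used on segments (constant
    [a] and [b]), on half-lines and on the whole line. *)
Lemma Rintegral_derive_limit (g F : R -> R) (D : set R) (a b : nat -> R) (l : R) :
  measurable D -> mu.-integrable D (EFin \o g) -> continuous g ->
  (forall x : R, is_derive x 1 F (g x)) -> (forall n, a n < b n) ->
  (forall n, `[a n, b n] `<=` D) ->
  (forall x, D x -> \forall n \near \oo, x \in `[a n, b n]) ->
  F (b n) - F (a n) @[n --> \oo] --> l ->
  \int[mu]_(x in D) g x = l.
Proof.
move=> mD gi cg dF ab abD Dab Fl.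
have mg := measurable_int _ gi.
have cF : continuous F.
  by move=> x; apply: differentiable_continuous; apply/derivable1_diffP.
pose f n := (EFin \o g) \_ `[a n, b n]%classic.
have intf n : (\int[mu]_(x in D) f n x = (F (b n) - F (a n))%:E)%E.
  rewrite -integral_mkcondr (_ : D `&` _ = `[a n, b n]%classic); last first.
    by rewrite setIidr//; exact: abD.
  rewrite EFinB (@continuous_FTC2 _ g F)//.
  - exact: continuous_subspaceT.
  - split => [x _||]; first exact: ex_derive.
    + exact/cvg_at_right_filter/cF.
    + exact/cvg_at_left_filter/cF.
  - by move=> x _; rewrite derive1E derive_val.
have : (\int[mu]_(x in D) f n x @[n --> \oo] --> \int[mu]_(x in D) (g x)%:E)%E.
  apply: (@dominated_cvg _ _ _ mu D mD f _ (fun x => `|(g x)%:E|%E)).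
  - move=> n; apply: (@measurable_funS _ _ _ _ D) => //.
    apply/(measurable_restrict _ _ _) => //.
    by apply: measurable_funS mg => //; exact: subIsetr.
  - move=> x Dx; apply: cvg_near_cst; apply: filterS (Dab x Dx) => n xn.
    by rewrite /f patchE ifT// inE.
  - by [].
  - exact: integrable_abse.
  - move=> n x Dx; rewrite /f patchE; case: ifP => //.
    by rewrite abse0.
under eq_cvg do rewrite intf.
have : (F (b n) - F (a n))%:E @[n --> \oo] --> l%:E by apply: cvg_EFin => //; exact: nearW.
move=> /cvg_unique /[apply] H; rewrite /Rintegral -H//.
Qed.

End lebesgue_invariance.

(** * The Fourier transform of a Gaussian *)

Section gaussian_fourier.
Context {R : realType}.
Notation mu := (@lebesgue_measure R).
Implicit Types (c s t x m : R).

Definition gauss c x := expR (- (c * x ^+ 2)).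

Lemma gauss_ge0 c x : 0 <= gauss c x. Proof. exact: expR_ge0. Qed.

Lemma normal_pdf_gauss m s x : s != 0 ->
  normal_pdf m s x = normal_peak s * gauss (s ^+ 2 *+ 2)^-1 (x - m).
Proof.
move=> s0; rewrite normal_pdfE//= /normal_fun /gauss mulNr.
by congr (_ * expR (- _)); rewrite mulrC.
Qed.

Lemma continuous_gauss c : continuous (gauss c).
Proof.
move=> x; apply: (@continuous_comp _ _ _ (fun x => - (c * x ^+ 2)) expR).
  apply: cvgN; apply: cvgM; first exact: cvg_cst.
  exact: exprn_continuous.
exact: continuous_expR.
Qed.

Lemma measurable_gauss c : measurable_fun setT (gauss c).
Proof. by apply: continuous_measurable_fun; exact: continuous_gauss. Qed.

Lemma is_derive_gauss c x : is_derive x 1 (gauss c) (- (2 * c * x) * gauss c x).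
Proof.
have H : is_derive x 1 (fun x => - (c * x ^+ 2)) (- (2 * c * x)).
  by apply: is_derive_eq; rewrite /GRing.scale/=; ring.
have := @is_derive1_comp _ expR (fun x => - (c * x ^+ 2)) x _ _ (is_derive_expR _) H.
by rewrite mulrC.
Qed.

Lemma integrable_gauss c : 0 < c -> mu.-integrable setT (EFin \o gauss c).
Proof.
(* The standard deviation of the normal law with exponent [c]. *)
move=> c0; pose s := Num.sqrt ((2 * c)^-1).
have s0 : s != 0 by rewrite sqrtr_eq0 -ltNge invr_gt0 mulr_gt0.
have s2 : (s ^+ 2 *+ 2)^-1 = c.
  by rewrite sqr_sqrtr ?invr_ge0 ?mulr_ge0 ?ltW// -mulr_natl invfM invrK mulrA mulVf ?mul1r.
have := integrableZl measurableT (normal_peak s)^-1 (integrable_normal_pdf 0 s).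
apply: eq_integrable => // x _ /=; rewrite -EFinM normal_pdf_gauss// s2 subr0.
by rewrite mulrA mulVf ?mul1r// gt_eqF// normal_peak_gt0.
Qed.

Lemma integrable_id_gauss c : 0 < c ->
  mu.-integrable setT (EFin \o (fun x => x * gauss c x)).
Proof.
move=> c0; have c20 : 0 < c / 2 by rewrite divr_gt0.
have := integrableZl measurableT (1 + c^-1) (integrable_gauss c20).
apply: le_integrable => //.
  apply/measurable_EFinP; apply: measurable_funM => //; exact: measurable_gauss.
move=> x _; rewrite /= lee_fin [leRHS]ger0_norm; last first.
  by rewrite mulr_ge0 ?expR_ge0// addr_ge0// invr_ge0 ltW.
rewrite normrM (ger0_norm (gauss_ge0 _ _)).
(* One half of the exponent absorbs the linear factor. *)
have -> : gauss c x = gauss (c / 2) x * gauss (c / 2) x.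
  by rewrite /gauss -expRD; congr expR; field.
rewrite mulrA ler_wpM2r ?gauss_ge0// /gauss expRN ler_pdivrMr ?expR_gt0//.
apply: (@le_trans _ _ ((1 + c^-1) * (1 + c / 2 * x ^+ 2))); last first.
  by rewrite ler_wpM2l ?expR_ge1Dx// addr_ge0// invr_ge0 ltW.
have ci0 : 0 < c^-1 by rewrite invr_gt0.
apply: (@le_trans _ _ (1 + x ^+ 2 / 2)).
  rewrite -[x ^+ 2]real_normK ?num_real//.
  have := sqr_ge0 (`|x| - 1); nra.
have -> : (1 + c^-1) * (1 + c / 2 * x ^+ 2) = 1 + c^-1 + c / 2 * x ^+ 2 + x ^+ 2 / 2.
  by field; rewrite gt_eqF.
have := sqr_ge0 x; nra.
Qed.

Lemma gauss_natr_cvg0 c : 0 < c -> gauss c n.+1%:R @[n --> \oo] --> (0 : R).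
Proof.
move=> c0; apply: (@squeeze_cvgr _ _ _ _ (cst 0) (fun n => c^-1 * harmonic n)).
- near=> n; rewrite expR_ge0 /= /gauss expRN -invfM lef_pV2 ?posrE ?expR_gt0 ?mulr_gt0//.
  apply: le_trans (expR_ge1Dx _); rewrite ler_wpDl// ler_pM2l// -natrX ler_nat.
  by rewrite -mulnn leq_pmulr.
- exact: cvg_cst.
- by rewrite -(mulr0 c^-1); apply: cvgMr; exact: cvg_harmonic.
Unshelve. all: by end_near. Qed.

Lemma integrableM_bounded (f h : R -> R) (K : R) :
  mu.-integrable setT (EFin \o f) -> measurable_fun setT h ->
  (forall x, `|h x| <= K) -> mu.-integrable setT (EFin \o (fun x => f x * h x)).
Proof.
move=> fi mh hK; have mf : measurable_fun setT f.
  by apply/measurable_EFinP; exact: measurable_int fi.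
have := integrableZl measurableT K (integrable_abse fi).
apply: le_integrable => //.
  by apply/measurable_EFinP; exact: measurable_funM.
move=> x _; rewrite /= lee_fin normrM [leRHS]normrM normr_id mulrC.
by rewrite ler_wpM2r// (le_trans (hK x))// ler_norm.
Qed.

Lemma norm_sin_le1 x : `|sin x| <= 1.
Proof. by rewrite ler_norml sin_geN1 sin_le1. Qed.

Lemma norm_cos_le1 x : `|cos x| <= 1.
Proof. by rewrite ler_norml cos_geN1 cos_le1. Qed.

Lemma continuous_sinM t : continuous (fun x => sin (t * x)).
Proof.
move=> x; apply: (@continuous_comp _ _ _ ( *%R t) sin); last exact: continuous_sin.
exact: mulrl_continuous.
Qed.

Lemma continuous_cosM t : continuous (fun x => cos (t * x)).
Proof.
move=> x; apply: (@continuous_comp _ _ _ ( *%R t) cos); last exact: continuous_cos.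
exact: mulrl_continuous.
Qed.

Lemma measurable_sinM t : measurable_fun setT (fun x => sin (t * x)).
Proof. by apply: continuous_measurable_fun; exact: continuous_sinM. Qed.

Lemma measurable_cosM t : measurable_fun setT (fun x => cos (t * x)).
Proof. by apply: continuous_measurable_fun; exact: continuous_cosM. Qed.

Lemma is_derive_sinM t x : is_derive x 1 (fun x => sin (t * x)) (t * cos (t * x)).
Proof.
eapply is_derive_eq; first by apply: is_derive1_comp.
by rewrite /GRing.scale/=; ring.
Qed.

Lemma integrable_gauss_cos c t : 0 < c ->
  mu.-integrable setT (EFin \o (fun x => gauss c x * cos (t * x))).
Proof.
move=> c0; apply: (integrableM_bounded (integrable_gauss c0) (measurable_cosM t)) => x.
exact: norm_cos_le1.
Qed.

Lemma integrable_id_gauss_sin c t : 0 < c ->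
  mu.-integrable setT (EFin \o (fun x => x * gauss c x * sin (t * x))).
Proof.
move=> c0; apply: (integrableM_bounded (integrable_id_gauss c0) (measurable_sinM t)) => x.
exact: norm_sin_le1.
Qed.

(** The difference of the two integrands is the derivative of
    [gauss c x * sin (t * x)], which vanishes at both infinities. *)
Lemma gauss_sin_by_parts c t : 0 < c ->
  2 * c * \int[mu]_x (x * gauss c x * sin (t * x)) =
  t * \int[mu]_x (gauss c x * cos (t * x)).
Proof.
move=> c0.
have i1 := integrable_gauss_cos t c0; have i2 := integrable_id_gauss_sin t c0.
have j1 : mu.-integrable setT (EFin \o (fun x => t * (gauss c x * cos (t * x)))).
  exact: (integrableZl measurableT t i1).
have j2 : mu.-integrable setT (EFin \o (fun x => 2 * c * (x * gauss c x * sin (t * x)))).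
  exact: (integrableZl measurableT (2 * c) i2).
apply/esym/eqP; rewrite -subr_eq0 -!RintegralZl// -RintegralB//; apply/eqP.
apply: (@Rintegral_derive_limit R _ (fun x => gauss c x * sin (t * x)) setT
  (fun n => - n.+1%:R) (fun n => n.+1%:R)) => //.
- by have := integrableB measurableT j1 j2.
- move=> x; apply: cvgB; apply: cvgM; try exact: cvg_cst.
    by apply: cvgM; [exact: continuous_gauss|exact: continuous_cosM].
  apply: cvgM; last exact: continuous_sinM.
  by apply: cvgM; [exact: cvg_id|exact: continuous_gauss].
- move=> x; have D1 := is_derive_gauss c x.
  have D3 := is_deriveM D1 (is_derive_sinM t x).
  by apply: (is_derive_eq D3); rewrite /GRing.scale/=; ring.
- by move=> n; rewrite gtrN.
- move=> x _; apply: filterS (nbhs_infty_ger `|x|) => n xn; rewrite in_itv/= -ler_norml.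
  by rewrite (le_trans xn)// ler_nat.
- apply: (@squeeze_cvgr _ _ _ _ (fun n => - (2 * gauss c n.+1%:R)) (fun n => 2 * gauss c n.+1%:R)).
  + near=> n; rewrite -ler_norml.
    rewrite mulrN sinN mulrN opprK /gauss sqrrN -mulrDr normrM mulrC (ger0_norm (expR_ge0 _)).
    rewrite ler_wpM2r ?expR_ge0// (le_trans (ler_normD _ _))//.
    by have := norm_sin_le1 (t * n.+1%:R); lra.
  + rewrite -oppr0 -(mulr0 2); apply: cvgN; apply: cvgMr; exact: gauss_natr_cvg0.
  + rewrite -(mulr0 2); apply: cvgMr; exact: gauss_natr_cvg0.
Unshelve. all: by end_near. Qed.

Lemma is_derive_gauss_fourier c t : 0 < c ->
  is_derive t 1 (fun t => \int[mu]_x (gauss c x * cos (t * x)))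
    (- \int[mu]_x (x * gauss c x * sin (t * x))).
Proof.
move=> c0; pose f t x := gauss c x * cos (t * x).
have tI : `]t - 1, t + 1[%classic t by rewrite /= in_itv/=; apply/andP; split; lra.
have df s x : is_derive s 1 (f^~ x) (- (x * gauss c x * sin (s * x))).
  have D2 : is_derive s 1 (cst (gauss c x) * (fun s => cos (s * x))) (- (x * gauss c x * sin (s * x))).
    by apply: is_derive_eq; rewrite /GRing.scale/= /cst/=; ring.
  exact: D2.
have dom s x : `|partial1of2 f s x| <= `|x * gauss c x|.
  rewrite partial1of2E (@derive_val _ _ _ _ _ _ _ (df s x)) normrN normrM.
  by rewrite ler_piMr// norm_sin_le1.
have iG : mu.-integrable setT (EFin \o (fun x => `|x * gauss c x|)).
  by have := integrable_abse (integrable_id_gauss c0).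
have intf s : `]t - 1, t + 1[%classic s -> mu.-integrable setT (EFin \o f s).
  by move=> _; exact: integrable_gauss_cos.
have derf s x : `]t - 1, t + 1[%classic s -> setT x -> derivable (f^~ x) s 1.
  by move=> _ _; exact: (@ex_derive _ _ _ _ _ _ _ (df s x)).
apply: DeriveDef.
  exact: (derivable_under_integral measurableT tI intf derf (fun=> normr_ge0 _) iG
    (fun s x _ _ => dom s x)).
rewrite -derive1E (differentiation_under_integral measurableT tI intf derf (fun=> normr_ge0 _) iG
    (fun s x _ _ => dom s x)).
rewrite -mulN1r -RintegralZl//; last exact: integrable_id_gauss_sin.
apply: eq_Rintegral => x _.
by rewrite partial1of2E (@derive_val _ _ _ _ _ _ _ (df t x)) mulN1r.
Qed.

(** Differentiating under the integral and integrating by parts, the left-hand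
    side [A] solves [A' = - t / (2 * c) * A]; so [A t * expR (t ^+ 2 / (4 * c))]
    has zero derivative. *)
Lemma gauss_fourier c t : 0 < c ->
  \int[mu]_x (gauss c x * cos (t * x)) =
  expR (- (t ^+ 2 / (4 * c))) * \int[mu]_x gauss c x.
Proof.
move=> c0; pose A s := \int[mu]_x (gauss c x * cos (s * x)).
pose E s := expR (s ^+ 2 / (4 * c)).
have dE s : is_derive s 1 E (s / (2 * c) * E s).
  have H : is_derive s 1 (fun s : R => s ^+ 2 / (4 * c)) (s / (2 * c)).
    by apply: is_derive_eq; rewrite /GRing.scale/=; field; rewrite gt_eqF.
  exact: (is_derive_eq (@is_derive1_comp _ expR (fun s => s ^+ 2 / (4 * c))
    s _ _ (is_derive_expR _) H) (mulrC _ _)).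
have dAE s : is_derive s 1 (A * E) 0.
  have dA := is_derive_gauss_fourier s c0.
  apply: (is_derive_eq (is_deriveM dA (dE s))); rewrite /GRing.scale/=.
  have := gauss_sin_by_parts s c0; rewrite -/(A s).
  move: (Rintegral _ _ _) => I IA.
  have -> : I = s / (2 * c) * A s.
    by rewrite -mulrA mulrCA -IA; field; rewrite gt_eqF.
  by ring.
have H : A t * E t = A 0 * E 0 := is_derive_0_is_cst t 0 dAE.
have Et : E t != 0 by rewrite gt_eqF ?expR_gt0.
rewrite expRN -/(E t) -/(A t); apply: (mulIf Et).
rewrite mulrAC mulVf// mul1r H /E expr0n mul0r expR0 mulr1 /A.
by apply: eq_Rintegral => x _; rewrite mul0r cos0 mulr1.
Qed.

End gaussian_fourier.

(** * Convolutions of normal densities *)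

Section normal_facts.
Context {R : realType}.
Notation mu := (@lebesgue_measure R).
Implicit Types (s t x u m a : R).

Lemma measurable_cosMD t a : measurable_fun setT (fun x => cos (t * x + a)).
Proof.
under eq_fun do rewrite cosD; apply: measurable_funB; apply: measurable_funM => //.
  exact: measurable_cosM.
exact: measurable_sinM.
Qed.

(** The phase [a] covers cosines and sines at once. After a translation by the
    mean, the sine part of the addition formula is odd and drops out. *)
Lemma normal_pdf_fourier m s t a : s != 0 ->
  \int[mu]_u (normal_pdf m s u * cos (t * u + a)) =
  expR (- (s ^+ 2 * t ^+ 2 / 2)) * cos (t * m + a).
Proof.
move=> s0; have c0 : 0 < (s ^+ 2 *+ 2)^-1.
  by rewrite invr_gt0 mulrn_wgt0// exprn_even_gt0.
set c := (_)^-1 in c0.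
have ic := integrable_gauss_cos t c0.
have is_ : mu.-integrable setT (EFin \o (fun x => gauss c x * sin (t * x))).
  apply: (integrableM_bounded (integrable_gauss c0) (measurable_sinM t)) => x.
  exact: norm_sin_le1.
have peakI : normal_peak s * \int[mu]_x gauss c x = 1.
  rewrite -RintegralZl//; last exact: integrable_gauss.
  transitivity (\int[mu]_x normal_pdf 0 s x); last by rewrite /Rintegral integral_normal_pdf.
  by apply: eq_Rintegral => x _; rewrite normal_pdf_gauss// subr0.
pose b := t * m + a.
pose h v := normal_peak s * cos b * (gauss c v * cos (t * v)) -
            normal_peak s * sin b * (gauss c v * sin (t * v)).
transitivity (\int[mu]_u h (u - m)).
  apply: eq_Rintegral => u _; rewrite normal_pdf_gauss// -/c /h.
  have -> : t * u + a = t * (u - m) + b by rewrite /b; ring.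
  by rewrite cosD; ring.
have i1 := integrableZl measurableT (normal_peak s * cos b) ic.
have i2 := integrableZl measurableT (normal_peak s * sin b) is_.
rewrite (Rintegral_shift m (f := h)); last exact: (integrableB measurableT i1 i2).
rewrite /h RintegralB// !RintegralZl//.
rewrite [X in _ - _ * X]Rintegral_odd//; last first.
  by move=> x; rewrite /gauss sqrrN mulrN sinN mulrN.
have -> : s ^+ 2 * t ^+ 2 / 2 = t ^+ 2 / (4 * c).
  by rewrite /c -mulr_natl; field.
rewrite mulr0 subr0 gauss_fourier//.
move: peakI; move: (\int[mu]_x gauss c x) => I peakI.
rewrite -/b; move: (expR _) (cos b) => e k.
rewrite [LHS](_ : _ = normal_peak s * I * (e * k)); last by ring.
by rewrite peakI mul1r.
Qed.

(** Completing the square in [u]: given a sum [x] of two independent standard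
    normal variables, each of them is normal with mean [x / 2] and variance
    [1 / 2]. *)
Lemma normal_pdf_mul x u : normal_pdf 0 1 (x - u) * normal_pdf 0 1 u =
  normal_pdf 0 (Num.sqrt 2) x * normal_pdf (x / 2) (Num.sqrt 2)^-1 u :> R.
Proof.
rewrite !normal_pdf_gauss ?invr_eq0// !subr0 exprVn sqr_sqrtr//.
rewrite mulrACA [RHS]mulrACA /gauss -!expRD; congr (_ * expR _); last by field.
rewrite /normal_peak exprVn sqr_sqrtr// -!invfM; congr (_^-1).
rewrite -!sqrtrM ?mulr_ge0 ?mulrn_wge0 ?mulr_ge0 ?pi_ge0//; congr Num.sqrt.
by field.
Qed.

(** By [normal_pdf_mul] the integral averages [sin (2 * j * u)] under a normal
    law of mean [x / 2] and variance [1 / 2], whose characteristic function has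
    modulus [expR (- j ^+ 2)] at frequency [2 * j]. The lower bound rests on this
    identity: a modulated normal density stays a modulated normal density under
    Gaussian convolution, with a computable loss of amplitude. *)
Lemma normal_sin_conv (j x : R) :
  \int[mu]_u (normal_pdf 0 1 (x - u) * (normal_pdf 0 1 u * sin (2 * j * u))) =
  expR (- j ^+ 2) * (normal_pdf 0 (Num.sqrt 2) x * sin (j * x)).
Proof.
under eq_Rintegral => u _ do rewrite mulrA normal_pdf_mul -mulrA -[sin _]cosBpihalf.
rewrite RintegralZl//; last first.
  apply: (integrableM_bounded (K := 1)); first exact: integrable_normal_pdf.
    exact: measurable_cosMD.
  by move=> u; exact: norm_cos_le1.
rewrite normal_pdf_fourier// exprVn sqr_sqrtr// mulrCA; congr (_ * (_ * _)).
  by congr expR; field.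
by rewrite cosBpihalf; congr sin; field.
Qed.

Lemma normal_conv x :
  \int[mu]_u (normal_pdf 0 1 (x - u) * normal_pdf 0 1 u) = normal_pdf 0 (Num.sqrt 2) x.
Proof.
under eq_Rintegral => u _ do rewrite normal_pdf_mul.
rewrite RintegralZl//; last exact: integrable_normal_pdf.
by rewrite [X in _ * X]/Rintegral integral_normal_pdf mulr1.
Qed.

End normal_facts.

(** * The integral of the Cauchy density *)

Section cauchy_integral.
Context {R : realType}.
Notation mu := (@lebesgue_measure R).

Lemma integral_oneDsqrV : (\int[mu]_x ((oneDsqr x)^-1)%:E = (pi : R)%:E)%E.
Proof.
have c1 : continuous (fun x : R => (oneDsqr x)^-1).
  by move=> x; apply: continuous_oneDsqrV.
rewrite ge0_symfun_integralT//.
- rewrite (_ : [set x | _] = `[0, +oo[%classic); last first.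
    by apply/seteqP; split => x/=; rewrite in_itv/= andbT.
  by rewrite integral0y_oneDsqr -EFinM; congr EFin; field.
- by move=> x; rewrite /oneDsqr /= sqrrN.
Qed.

Lemma ge0_integral_scale (T : R) (G : R -> R) : 0 < T -> continuous G ->
  (forall x, 0 <= G x) ->
  (\int[mu]_x (G x)%:E = \int[mu]_x (G (T * x) * T)%:E)%E.
Proof.
move=> T0 cG G0.
have dT : derive1 ( *%R T : R -> R) = cst T.
  apply/funext => x; rewrite derive1E.
  have H : is_derive x 1 (fun x => T * x) T.
    by apply: is_derive_eq; rewrite /GRing.scale/= mulr1.
  exact: derive_val.
rewrite (@increasing_ge0_integration_by_substitutionT R ( *%R T) G)//; rewrite ?dT.
- by [].
- by move=> x y xy; rewrite ltr_pM2l.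
- by move=> x; exact: cvg_cst.
- exact: is_cvg_cst.
- exact: is_cvg_cst.
- by apply: gt0_cvgMrNy => //; exact: cvg_id.
- by apply: gt0_cvgMry => //; exact: cvg_id.
Qed.

Lemma integral_cauchy_scaled (T : R) : 0 < T ->
  (\int[mu]_x ((1 + T ^+ 2 * x ^+ 2)^-1)%:E = (pi / T)%:E)%E.
Proof.
move=> T0.
have c1 : continuous (fun x : R => (oneDsqr x)^-1).
  by move=> x; apply: continuous_oneDsqrV.
have V0 (x : R) : 0 <= (oneDsqr x)^-1 by rewrite invr_ge0 /oneDsqr addr_ge0 ?sqr_ge0.
have := ge0_integral_scale T0 c1 V0; rewrite integral_oneDsqrV => E.
have mG : measurable_fun setT (fun x : R => ((oneDsqr (T * x))^-1 * T)%:E).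
  apply/measurable_EFinP; apply: measurable_funM => //.
  apply: (@measurableT_comp _ _ _ _ _ _ (fun x : R => (oneDsqr x)^-1) _ ( *%R T)).
    exact: continuous_measurable_fun.
  exact: measurable_funM.
transitivity ((T^-1)%:E * \int[mu]_x ((oneDsqr (T * x))^-1 * T)%:E)%E.
  rewrite -ge0_integralZl//.
  - apply: eq_integral => x _; rewrite -EFinM; congr EFin.
    by rewrite (mulrCA T^-1) mulVf ?gt_eqF// mulr1 /oneDsqr exprMn.
  - by move=> x _; rewrite lee_fin mulr_ge0// ltW.
  - by rewrite lee_fin invr_ge0 ltW.
by rewrite -E -EFinM mulrC.
Qed.

End cauchy_integral.

(** * The sinc kernel and its action on a normal density *)

Section sinc_kernel.
Context {R : realType}.
Notation mu := (@lebesgue_measure R).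
Implicit Types (T t x y z u : R).

Lemma continuous_cosMr z : continuous (fun t => cos (t * z)).
Proof.
rewrite (_ : (fun t => _) = (fun t => cos (z * t))); first exact: continuous_cosM.
by apply/funext => t; rewrite mulrC.
Qed.

Lemma continuous_sinMr z : continuous (fun t => sin (t * z)).
Proof.
rewrite (_ : (fun t => _) = (fun t => sin (z * t))); first exact: continuous_sinM.
by apply/funext => t; rewrite mulrC.
Qed.

Lemma continuous_cos_transform (D : set R) (h : R -> R) :
  measurable D -> mu.-integrable D (EFin \o h) ->
  continuous (fun z => \int[mu]_(t in D) (h t * cos (t * z))).
Proof.
move=> mD hi z.
have mh : measurable_fun D h by apply/measurable_EFinP; exact: measurable_int hi.
have dom y x : `|h y * cos (y * x)| <= `|h y|.
  by rewrite normrM ler_piMr// norm_cos_le1.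
have iabs : mu.-integrable D (EFin \o (fun t => `|h t|)).
  by have := integrable_abse hi.
apply: (@continuity_under_integral R _ _ mu (fun z t => h t * cos (t * z)) D mD
  (z - 1) (z + 1) _ _ (fun t => `|h t|)) => //.
- move=> x _; apply: le_integrable iabs => //.
    apply/measurable_EFinP; apply: measurable_funM => //.
    by apply: measurable_funTS; under eq_fun do rewrite mulrC; exact: measurable_cosM.
  by move=> y _ /=; rewrite lee_fin normr_id.
- apply: aeW => y _ x _; apply: cvgM; first exact: cvg_cst.
  exact: continuous_cosM.
- by move=> x _; apply: aeW => y _.
- by rewrite inE /= in_itv/=; apply/andP; split; lra.
Qed.

(** The function [sin (T * z) / (pi * z)], see [sinc_kernelE], as an average of
    cosines: this form needs no case distinction at [z = 0] and shows the
    frequencies that the kernel lets through. *)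
Definition sinc_kernel T z := pi^-1 * \int[mu]_(t in `[0, T]) cos (t * z).

(** The convolution of [sinc_kernel T] with the standard normal density, see
    [sinc_kernel_conv]: the part of the normal density at frequencies below [T]. *)
Definition sinc_gauss T z :=
  pi^-1 * \int[mu]_(t in `[0, T]) (gauss 2^-1 t * cos (t * z)).

Lemma itv_measure T : 0 <= T -> mu `[0, T]%classic = T%:E.
Proof.
move=> T0; rewrite lebesgue_measure_itv/= lte_fin; case: ltgtP T0 => // [_ _|<- _//].
by rewrite oppr0 adde0.
Qed.

Lemma integrable_itv_bounded T (f : R -> R) (K : R) : 0 <= T ->
  measurable_fun setT f -> (forall x, `|f x| <= K) ->
  mu.-integrable `[0, T] (EFin \o f).
Proof.
move=> T0 mf fK; apply: measurable_bounded_integrable => //.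
- by apply: (@le_lt_trans _ _ T%:E); rewrite ?ltry// le_eqVlt; apply/orP; left; apply/eqP; exact: itv_measure.
- exact: measurable_funTS.
- exists K; split; first exact: num_real.
  by move=> x Kx y _; exact: le_trans (fK y) (ltW Kx).
Qed.

Lemma measurable_sinc_kernel T : 0 <= T -> measurable_fun setT (sinc_kernel T).
Proof.
move=> T0; apply: measurable_funM => //; apply: continuous_measurable_fun.
under eq_fun do under eq_Rintegral do rewrite -[cos _]mul1r.
apply: continuous_cos_transform => //.
by apply: (integrable_itv_bounded (K := 1)) => // x; rewrite normr1.
Qed.

Lemma continuous_sinc_gauss T : 0 <= T -> continuous (sinc_gauss T).
Proof.
move=> T0 z; apply: cvgM; first exact: cvg_cst.
apply: continuous_cos_transform => //.
apply: (integrableS measurableT) => //; apply: integrable_gauss; lra.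
Qed.

Lemma sinc_kernel_le T z : 0 <= T -> `|sinc_kernel T z| <= T / pi.
Proof.
move=> T0; rewrite normrM ger0_norm ?invr_ge0 ?pi_ge0// mulrC ler_wpM2r ?invr_ge0 ?pi_ge0//.
have mc : measurable_fun setT (fun t : R => cos (t * z)).
  by under eq_fun do rewrite mulrC; exact: measurable_cosM.
have ic := integrable_itv_bounded T0 mc (fun x => norm_cos_le1 _).
apply: le_trans (le_normr_Rintegral _ ic) _ => //.
apply: (@le_trans _ _ (\int[mu]_(t in `[0, T]) 1)).
  apply: le_Rintegral => //.
  - exact: (integrable_norm ic).
  - by apply: (integrable_itv_bounded (K := 1)) => // x; rewrite normr1.
  - by move=> x _; exact: norm_cos_le1.
by rewrite Rintegral_cst//= itv_measure//= mul1r.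
Qed.

Lemma sinc_kernelE T z : 0 < T -> z * (pi * sinc_kernel T z) = sin (T * z).
Proof.
move=> T0; rewrite /sinc_kernel mulVKf; last by rewrite gt_eqF// pi_gt0.
have mc : measurable_fun setT (fun t : R => cos (t * z)).
  by under eq_fun do rewrite mulrC; exact: measurable_cosM.
have ic := integrable_itv_bounded (ltW T0) mc (fun x => norm_cos_le1 _).
rewrite -RintegralZl//.
apply: (@Rintegral_derive_limit R _ (fun t => sin (z * t)) `[0, T] (fun=> 0) (fun=> T)) => //.
- exact: (integrableZl _ z ic).
- move=> t; apply: cvgM; first exact: cvg_cst.
  exact: continuous_cosMr.
- by move=> t; rewrite [t * z]mulrC; exact: is_derive_sinM.
- by move=> n x.
- by move=> t Tt; exact: nearW.
- by rewrite mulr0 sin0 subr0 mulrC; exact: cvg_cst.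
Qed.

(** The sum of two bounds: the kernel is at most [T / pi], and [z] times the
    kernel at most [1 / pi]. The majorant has an explicit integral, which is
    twice the exact value [T / pi] of the integral of the squared kernel. *)
Lemma sinc_kernel_sqr_le T z : 0 < T ->
  sinc_kernel T z ^+ 2 <= 2 * T ^+ 2 / pi ^+ 2 * (1 + T ^+ 2 * z ^+ 2)^-1.
Proof.
move=> T0; have pi0 : 0 < pi :> R := pi_gt0 R.
have k1 : (pi * sinc_kernel T z) ^+ 2 <= T ^+ 2.
  rewrite -[leLHS]real_normK ?num_real// lerXn2r ?nnegrE ?(ltW T0)//.
  rewrite normrM (ger0_norm (ltW pi0)) -ler_pdivlMl// mulrC.
  by rewrite sinc_kernel_le// ltW.
have k2 : z ^+ 2 * (pi * sinc_kernel T z) ^+ 2 <= 1.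
  by rewrite -exprMn sinc_kernelE// -(cos2Dsin2 (T * z)) lerDr sqr_ge0.
have D0 : 0 < 1 + T ^+ 2 * z ^+ 2.
  by rewrite ltr_pwDl// mulr_ge0// sqr_ge0.
rewrite ler_pdivlMr// ler_pdivlMr ?exprn_gt0//.
have T2 : 0 < T ^+ 2 by rewrite exprn_gt0.
have : T ^+ 2 * (z ^+ 2 * (pi * sinc_kernel T z) ^+ 2) <= T ^+ 2 * 1.
  by rewrite ler_pM2l.
rewrite !exprMn in k1 *; lra.
Qed.

Lemma integral_sinc_kernel_sqr T : 0 < T ->
  (\int[mu]_z (sinc_kernel T z ^+ 2)%:E <= (2 * T / pi)%:E)%E.
Proof.
move=> T0; have pi0 : 0 < pi :> R := pi_gt0 R.
have c2 : 0 <= 2 * T ^+ 2 / pi ^+ 2.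
  by apply: divr_ge0; rewrite ?sqr_ge0//; apply: mulr_ge0; rewrite ?sqr_ge0.
have V0 z : 0 <= (1 + T ^+ 2 * z ^+ 2)^-1.
  by rewrite invr_ge0 addr_ge0// mulr_ge0// sqr_ge0.
have mV : measurable_fun setT (fun z : R => (1 + T ^+ 2 * z ^+ 2)^-1).
  rewrite (_ : (fun x => _) = (fun x => (oneDsqr x)^-1) \o ( *%R T)); last first.
    by apply/funext => x /=; rewrite /oneDsqr exprMn.
  apply: measurableT_comp; last exact: measurable_funM.
  by apply: continuous_measurable_fun => x; exact: continuous_oneDsqrV.
apply: (@le_trans _ _ (\int[mu]_z ((2 * T ^+ 2 / pi ^+ 2)%:E * ((1 + T ^+ 2 * z ^+ 2)^-1)%:E))%E).
  apply: ge0_le_integral => //.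
  - by move=> z _; rewrite lee_fin sqr_ge0.
  - apply/measurable_EFinP; apply: measurable_funX.
    exact: (measurable_sinc_kernel (ltW T0)).
  - by apply/measurable_EFinP; apply: measurable_funM.
  - by move=> z _; rewrite -EFinM lee_fin sinc_kernel_sqr_le.
rewrite ge0_integralZl//=; first last.
- by move=> z _; rewrite lee_fin.
- exact/measurable_EFinP.
rewrite integral_cauchy_scaled// -EFinM lee_fin.
rewrite le_eqVlt; apply/orP; left; apply/eqP.
by move: (pi : R) pi0 => p /lt0r_neq0 p0; field; rewrite p0 lt0r_neq0.
Qed.

Lemma normal_pdf01 x : normal_pdf 0 1 x = normal_peak 1 * gauss 2^-1 x :> R.
Proof. by rewrite normal_pdf_gauss ?oner_neq0// subr0 expr1n. Qed.

Lemma integrable_gauss_half : mu.-integrable setT (EFin \o gauss 2^-1).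
Proof. by apply: integrable_gauss; rewrite invr_gt0. Qed.

Lemma integrable_gauss_cosr z :
  mu.-integrable setT (EFin \o (fun t => gauss 2^-1 t * cos (t * z))).
Proof.
apply: (integrableM_bounded (K := 1) integrable_gauss_half).
  by apply: continuous_measurable_fun; exact: continuous_cosMr.
by move=> x; exact: norm_cos_le1.
Qed.

(** Fourier inversion for the Gaussian, folded onto the half-line by evenness. *)
Lemma normal_pdf_half_fourier z :
  normal_pdf 0 1 z = pi^-1 * \int[mu]_(t in `[0, +oo[) (gauss 2^-1 t * cos (t * z)).
Proof.
have pi0 : 0 < pi :> R := pi_gt0 R.
have := Rintegral_even (integrable_gauss_cosr z) _ => H.
have {}H : \int[mu]_t (gauss 2^-1 t * cos (t * z)) =
    2 * \int[mu]_(t in `[0, +oo[) (gauss 2^-1 t * cos (t * z)).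
  by apply: H => t; rewrite /gauss sqrrN mulNr cosN.
have pk : normal_peak 1 ^+ 2 = (2 * pi)^-1 :> R.
  rewrite /normal_peak expr1n mul1r exprVn sqr_sqrtr ?mulr_natl//.
  by rewrite mulrn_wge0// ltW.
have pk0 : normal_peak 1 != 0 :> R by rewrite gt_eqF// normal_peak_gt0// oner_neq0.
have I1 : normal_peak 1 * \int[mu]_t gauss 2^-1 t = 1.
  rewrite -RintegralZl//; last exact: integrable_gauss_half.
  transitivity (\int[mu]_t normal_pdf (0 : R) 1 t); last by rewrite /Rintegral integral_normal_pdf.
  by apply: eq_Rintegral => t _; rewrite normal_pdf01.
have G : \int[mu]_t (gauss 2^-1 t * cos (t * z)) =
    gauss 2^-1 z * \int[mu]_t gauss 2^-1 t.
  under eq_Rintegral => t _ do rewrite [t * z]mulrC.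
  have e4 : 4 * 2^-1 = 2 :> R by field.
  by rewrite gauss_fourier// e4 /gauss (mulrC (z ^+ 2)).
have G2 : \int[mu]_t (gauss 2^-1 t * cos (t * z)) = gauss 2^-1 z / normal_peak 1.
  by rewrite G; apply: (mulIf pk0); rewrite mulfVK// -mulrA [X in _ * X]mulrC I1 mulr1.
have -> : \int[mu]_(t in `[0, +oo[) (gauss 2^-1 t * cos (t * z)) =
    (gauss 2^-1 z / normal_peak 1) / 2.
  by rewrite -G2 H mulrAC divff ?mul1r.
rewrite normal_pdf01; apply: (mulIf pk0).
rewrite mulrAC -expr2 pk; move: (pi : R) pi0 => p /lt0r_neq0 p0.
by field; rewrite p0 pk0.
Qed.

Lemma normal_sub_sinc_gauss T z : 0 < T ->
  normal_pdf 0 1 z - sinc_gauss T z =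
  pi^-1 * \int[mu]_(t in `[T, +oo[) (gauss 2^-1 t * cos (t * z)).
Proof.
move=> T0; rewrite normal_pdf_half_fourier -mulrBr; congr (_ * _).
rewrite Rintegral_itvB//.
- rewrite Rintegral_itv_obnd_cbnd//.
  exact: integrableS (integrable_gauss_cosr z).
- exact: integrableS (integrable_gauss_cosr z).
- by rewrite bnd_simp ltW.
Qed.

Lemma gauss_half_cvg0 T : 0 <= T ->
  gauss 2^-1 (T + n.+1%:R) @[n --> \oo] --> (0 : R).
Proof.
move=> T0.
apply: (@squeeze_cvgr _ _ _ _ (cst 0) (fun n => gauss 2^-1 n.+1%:R)).
- apply: nearW => n; rewrite gauss_ge0/= /gauss ler_expR lerN2 ler_pM2l//.
  by rewrite lerXn2r ?nnegrE ?addr_ge0// lerDr.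
- exact: cvg_cst.
- exact: gauss_natr_cvg0.
Qed.

Lemma near_itv_shift T x : `[T, +oo[%classic x ->
  \forall n \near \oo, x \in `[T, T + n.+1%:R].
Proof.
rewrite /= in_itv/= andbT => Tx; apply: filterS (nbhs_infty_ger (x - T)) => n xn.
by rewrite in_itv/= Tx -lerBlDl (le_trans xn)// ler_nat.
Qed.

Lemma integral_id_gauss_tail T : 0 < T ->
  \int[mu]_(t in `[T, +oo[) (t * gauss 2^-1 t) = gauss 2^-1 T.
Proof.
move=> T0; have h0 : (0 : R) < 2^-1 by rewrite invr_gt0.
apply: (@Rintegral_derive_limit R _ (fun t => - gauss 2^-1 t) `[T, +oo[ (fun=> T)
  (fun n => T + n.+1%:R)) => //.
- by apply: integrableS (integrable_id_gauss h0).
- by move=> t; apply: cvgM; [exact: cvg_id|exact: continuous_gauss].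
- move=> t; have H := is_derive_gauss 2^-1 t.
  by apply: (is_derive_eq (is_deriveN H)); rewrite mulfV// mul1r mulNr opprK.
- by move=> n; rewrite ltrDl.
- by move=> n x /=; rewrite !in_itv/= andbT => /andP[].
- by move=> x; exact: near_itv_shift.
- rewrite opprK -[X in _ --> X]add0r -oppr0; apply: cvgD; last exact: cvg_cst.
  by apply: cvgN; apply: gauss_half_cvg0; exact: ltW.
Qed.

(** The factor [z] gained here gives the tail its decay in [z], hence its square
    integrability. *)
Lemma gauss_cos_tail_by_parts T z : 0 < T ->
  z * \int[mu]_(t in `[T, +oo[) (gauss 2^-1 t * cos (t * z)) =
  \int[mu]_(t in `[T, +oo[) (t * gauss 2^-1 t * sin (t * z)) - gauss 2^-1 T * sin (T * z).
Proof.
move=> T0; have h0 : (0 : R) < 2^-1 by rewrite invr_gt0.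
have i1 : mu.-integrable `[T, +oo[ (EFin \o (fun t => gauss 2^-1 t * cos (t * z))).
  exact: integrableS (integrable_gauss_cosr z).
have i2 : mu.-integrable `[T, +oo[ (EFin \o (fun t => t * gauss 2^-1 t * sin (t * z))).
  apply: (@integrableS _ _ _ _ setT) => //.
  have := integrable_id_gauss_sin z h0.
  by apply: eq_integrable => // x _ /=; rewrite [z * x]mulrC.
have j1 : mu.-integrable `[T, +oo[ (EFin \o (fun t => z * (gauss 2^-1 t * cos (t * z)))).
  exact: (integrableZl _ z i1).
have E : \int[mu]_(t in `[T, +oo[) (z * (gauss 2^-1 t * cos (t * z)) -
    t * gauss 2^-1 t * sin (t * z)) = - (gauss 2^-1 T * sin (T * z)).
  apply: (@Rintegral_derive_limit R _ (fun t => gauss 2^-1 t * sin (z * t)) `[T, +oo[ (fun=> T)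
    (fun n => T + n.+1%:R)) => //.
  - exact: (integrableB _ j1 i2).
  - move=> t; apply: cvgB; apply: cvgM.
    + exact: cvg_cst.
    + by apply: cvgM; [exact: continuous_gauss|exact: continuous_cosMr].
    + by apply: cvgM; [exact: cvg_id|exact: continuous_gauss].
    + exact: continuous_sinMr.
  - move=> t; apply: (is_derive_eq (is_deriveM (is_derive_gauss 2^-1 t) (is_derive_sinM z t))).
    by rewrite /GRing.scale/= mulfV// mul1r (mulrC z t); ring.
  - by move=> n; rewrite ltrDl.
  - by move=> n x /=; rewrite !in_itv/= andbT => /andP[].
  - by move=> x; exact: near_itv_shift.
  - rewrite -[X in _ --> X]add0r (mulrC T); apply: cvgB; last exact: cvg_cst.
    apply: (@squeeze_cvgr _ _ _ _ (fun n => - gauss 2^-1 (T + n.+1%:R))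
      (fun n => gauss 2^-1 (T + n.+1%:R))).
    + apply: nearW => n; rewrite -ler_norml normrM (ger0_norm (gauss_ge0 _ _)).
      by rewrite ler_piMr ?gauss_ge0// norm_sin_le1.
    + by rewrite -oppr0; apply: cvgN; apply: gauss_half_cvg0; exact: ltW.
    + by apply: gauss_half_cvg0; exact: ltW.
move: E; rewrite RintegralB// RintegralZl//.
by move: (Rintegral _ _ _) (Rintegral _ _ _) => I J E; lra.
Qed.

(** The tail integral [I] of [normal_sub_sinc_gauss] satisfies
    [`|I| <= 2 * gauss 2^-1 T] directly and [`|z * I| <= 2 * gauss 2^-1 T] by
    parts; the squares add up to the constant 8. As [1 <= 2 * t] for [t >= T],
    both bounds reduce to the explicit integral of [t * gauss 2^-1 t]. The factor
    [1 ^+ 2] gives the right-hand side the form of [integral_cauchy_scaled]. *)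
Lemma normal_sub_sinc_gauss_le T z : 2^-1 <= T ->
  (normal_pdf 0 1 z - sinc_gauss T z) ^+ 2 <=
  8 * pi ^- 2 * expR (- T ^+ 2) * (1 + 1 ^+ 2 * z ^+ 2)^-1.
Proof.
move=> T1; have h0 : (0 : R) < 2^-1 by rewrite invr_gt0.
have T0 : 0 < T by exact: lt_le_trans T1.
have pi0 : 0 < pi :> R := pi_gt0 R.
have it : mu.-integrable `[T, +oo[ (EFin \o (fun t => t * gauss 2^-1 t)).
  exact: integrableS (integrable_id_gauss h0).
have i1 : mu.-integrable `[T, +oo[ (EFin \o (fun t => gauss 2^-1 t * cos (t * z))).
  exact: integrableS (integrable_gauss_cosr z).
have i2 : mu.-integrable `[T, +oo[ (EFin \o (fun t => t * gauss 2^-1 t * sin (t * z))).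
  apply: (@integrableS _ _ _ _ setT) => //.
  have := integrable_id_gauss_sin z h0.
  by apply: eq_integrable => // x _ /=; rewrite [z * x]mulrC.
have g0 := gauss_ge0 2^-1 T.
rewrite normal_sub_sinc_gauss//; set I := Rintegral _ _ _.
have I1 : `|I| <= 2 * gauss 2^-1 T.
  apply: le_trans (le_normr_Rintegral _ i1) _ => //.
  rewrite -(integral_id_gauss_tail T0) -RintegralZl//.
  apply: le_Rintegral => //.
  - exact: (integrable_norm i1).
  - exact: (integrableZl _ 2 it).
  - move=> t /=; rewrite in_itv/= andbT => Tt.
    rewrite normrM (ger0_norm (gauss_ge0 _ _)) mulrA.
    apply: (@le_trans _ _ (gauss 2^-1 t)).
      by rewrite ler_piMr ?gauss_ge0 ?norm_cos_le1.
    rewrite ler_peMl ?gauss_ge0//.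
    by rewrite -ler_pdivrMl// mulr1 (le_trans T1).
have I2 : `|z * I| <= 2 * gauss 2^-1 T.
  rewrite /I gauss_cos_tail_by_parts// (le_trans (ler_normB _ _))//.
  rewrite mulr_natl mulr2n lerD//; last first.
    by rewrite normrM (ger0_norm g0) ler_piMr ?norm_sin_le1.
  apply: le_trans (le_normr_Rintegral _ i2) _ => //.
  rewrite -(integral_id_gauss_tail T0).
  apply: le_Rintegral => //; first exact: (integrable_norm i2).
  move=> t /=; rewrite in_itv/= andbT => Tt.
  rewrite normrM ger0_norm ?ler_piMr ?norm_sin_le1// mulr_ge0 ?gauss_ge0//.
    by apply: ltW; exact: lt_le_trans Tt.
  by apply: ltW; exact: lt_le_trans Tt.
have -> : expR (- T ^+ 2) = gauss 2^-1 T ^+ 2.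
  by rewrite /gauss -expRM_natl; congr expR; rewrite mulrN mulrA mulfV// mul1r.
have sq (a b : R) : `|a| <= b -> a ^+ 2 <= b ^+ 2.
  by move=> ab; rewrite -[leLHS]real_normK ?num_real// lerXn2r ?nnegrE// (le_trans _ ab).
have D0 : 0 < 1 + 1 ^+ 2 * z ^+ 2.
  by rewrite ltr_pwDl// mulr_ge0// sqr_ge0.
rewrite ler_pdivlMr// exprMn exprVn.
have : 0 < pi ^- 2 :> R by rewrite invr_gt0 exprn_gt0.
move: (pi ^- 2) => p p0; rewrite -[leLHS]mulrA -[leRHS]mulrA (mulrC 8) -[leRHS]mulrA.
rewrite ler_pM2l//.
rewrite expr1n mul1r.
have := sq _ _ I1; have := sq _ _ I2; rewrite !exprMn; nra.
Qed.

Lemma integral_normal_sub_sinc_gauss T : 2^-1 <= T ->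
  (\int[mu]_z ((normal_pdf 0 1 z - sinc_gauss T z) ^+ 2)%:E <=
   (8 / pi * expR (- T ^+ 2))%:E)%E.
Proof.
move=> T1; have T0 : 0 < T by apply: lt_le_trans T1; rewrite invr_gt0.
have pi0 : 0 < pi :> R := pi_gt0 R.
have c2 : 0 <= 8 * pi ^- 2 * expR (- T ^+ 2) :> R.
  by rewrite !mulr_ge0 ?expR_ge0// invr_ge0 sqr_ge0.
have V0 z : 0 <= (1 + 1 ^+ 2 * z ^+ 2)^-1 :> R.
  by rewrite invr_ge0 addr_ge0// mulr_ge0// sqr_ge0.
have mV : measurable_fun setT (fun z : R => (1 + 1 ^+ 2 * z ^+ 2)^-1).
  apply: continuous_measurable_fun => x; rewrite (_ : (fun _ => _) = (fun x => (oneDsqr x)^-1)).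
    exact: continuous_oneDsqrV.
  by apply/funext => z; rewrite expr1n mul1r.
apply: (@le_trans _ _ (\int[mu]_z ((8 * pi ^- 2 * expR (- T ^+ 2))%:E *
    ((1 + 1 ^+ 2 * z ^+ 2)^-1)%:E))%E).
  apply: ge0_le_integral => //.
  - by move=> z _; rewrite lee_fin sqr_ge0.
  - apply/measurable_EFinP; apply: measurable_funX; apply: measurable_funB.
      exact: measurable_normal_pdf.
    by apply: continuous_measurable_fun; apply: continuous_sinc_gauss; exact: ltW.
  - by apply/measurable_EFinP; apply: measurable_funM.
  - by move=> z _; rewrite -EFinM lee_fin normal_sub_sinc_gauss_le.
rewrite ge0_integralZl//=; first last.
- by move=> z _; rewrite lee_fin.
- exact/measurable_EFinP.
rewrite integral_cauchy_scaled// -EFinM lee_fin divr1.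
rewrite le_eqVlt; apply/orP; left; apply/eqP.
by move: (pi : R) pi0 (expR _) => p /lt0r_neq0 p0 e; field.
Qed.

(** The convolution multiplies each frequency [t] of the kernel by the value
    [expR (- t ^+ 2 / 2)] of the normal characteristic function; exchanging the
    two integrals makes this a computation frequency by frequency. *)
Lemma sinc_kernel_conv T x u : 0 < T ->
  \int[mu]_y (sinc_kernel T (x - y) * normal_pdf 0 1 (y - u)) = sinc_gauss T (x - u).
Proof.
move=> T0.
(* The indicator of [`[0, T]] makes both integrals run over the whole line. *)
pose J : R -> R := \1_`[0, T]; pose f y t : R := normal_pdf u 1 y * (cos (t * (x - y)) * J t).
have J0 t : 0 <= J t by [].
have mJ : measurable_fun setT J by exact: measurable_indic.
have mcos : measurable_fun setT (@cos R).
  by apply: continuous_measurable_fun; exact: continuous_cos.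
have mn := @measurable_normal_pdf R u 1.
have n0 := @normal_pdf_ge0 R u 1.
have pdfE y : normal_pdf 0 1 (y - u) = normal_pdf u 1 y.
  by rewrite !normal_pdf_gauss ?oner_neq0// subr0.
have iJ : mu.-integrable setT (EFin \o J).
  exact: integrable_indic_itv.
have JE (h : R -> R) : \int[mu]_(t in `[0, T]) h t = \int[mu]_t (h t * J t).
  by rewrite Rintegral_mkcond patch_indic.
have cJ y : mu.-integrable setT (EFin \o (fun t => cos (t * (x - y)) * J t)).
  have : mu.-integrable setT (EFin \o (fun t => J t * cos (t * (x - y)))).
    apply: (integrableM_bounded (K := 1) iJ); last by move=> t; exact: norm_cos_le1.
    by apply: continuous_measurable_fun; exact: continuous_cosMr.
  by apply: eq_integrable => // t _; rewrite /= mulrC.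
have f1 y : mu.-integrable setT (fun t => (f y t)%:E).
  exact: (integrableZl measurableT _ (cJ y)).
have f2 t : mu.-integrable setT (fun y => (f y t)%:E).
  apply: (integrableM_bounded (K := 1) (integrable_normal_pdf u 1)).
    apply: measurable_funM => //.
    apply: (measurableT_comp mcos); apply: measurable_funM => //; exact: measurable_funB.
  move=> y; rewrite normrM mulr_ile1// ?norm_cos_le1// ger0_norm// /J indicE.
  by case: (_ \in _).
have fi : (mu \x mu)%E.-integrable setT
    (fun z : measurableTypeR R * measurableTypeR R => (f z.1 z.2)%:E).
  have mf : measurable_fun [set: measurableTypeR R * measurableTypeR R]
      (fun z : measurableTypeR R * measurableTypeR R => (f z.1 z.2)%:E).
    have m1 : measurable_fun [set: measurableTypeR R * measurableTypeR R] (fun z : measurableTypeR R * measurableTypeR R => z.1 : R).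
      exact: measurable_fst.
    have m2 : measurable_fun [set: measurableTypeR R * measurableTypeR R] (fun z : measurableTypeR R * measurableTypeR R => z.2 : R).
      exact: measurable_snd.
    apply/measurable_EFinP; apply: measurable_funM; first exact: (measurableT_comp mn m1).
    apply: measurable_funM; last exact: (measurableT_comp mJ m2).
    apply: (measurableT_comp mcos); apply: measurable_funM => //.
    exact: measurable_funB.
  apply/integrable12ltyP => //.
  apply: (@le_lt_trans _ _ (\int[mu]_y (T%:E * (normal_pdf u 1 y)%:E))%E).
    apply: ge0_le_integral => //.
    - by move=> y _; apply: integral_ge0.
    - apply: (measurable_fun_fubini_tonelli_F
        (fun z : measurableTypeR R * measurableTypeR R => `|(f z.1 z.2)%:E|%E)) => //.
      exact: measurableT_comp.
    - by apply/measurable_EFinP; apply: measurable_funM.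
    - move=> y _; apply: (@le_trans _ _ (\int[mu]_t ((normal_pdf u 1 y)%:E * (J t)%:E))%E).
        apply: ge0_le_integral => //.
        + exact: measurableT_comp (measurable_int _ (f1 y)).
        + by apply/measurable_EFinP; apply: measurable_funM.
        + move=> t _; rewrite -EFinM lee_fin !normrM (ger0_norm (n0 _)) ler_wpM2l//.
          by rewrite (ger0_norm (J0 _)) ler_piMl// norm_cos_le1.
      rewrite ge0_integralZl ?lee_fin//; first last.
      + by move=> t _; rewrite lee_fin.
      + exact/measurable_EFinP.
      rewrite integral_indic// setIT muleC le_eqVlt; apply/orP; left; apply/eqP.
      by congr (_ * _)%E; exact: itv_measure (ltW T0).
  rewrite ge0_integralZl//=.
  - by rewrite integral_normal_pdf mule1 ltry.
  - exact/measurable_EFinP.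
  - by move=> y _; rewrite lee_fin.
  - by rewrite lee_fin ltW.
transitivity (pi^-1 * \int[mu]_y \int[mu]_t f y t).
  rewrite -RintegralZl//; last exact: (integrable_Rintegral fi f1).
  apply: eq_Rintegral => y _; rewrite pdfE /sinc_kernel JE -mulrA; congr (_ * _).
  by rewrite mulrC -RintegralZl.
rewrite (Rintegral_Fubini fi f1 f2) /sinc_gauss JE; congr (_ * _).
apply: eq_Rintegral => t _.
transitivity (\int[mu]_y (normal_pdf u 1 y * cos (- t * y + t * x)) * J t).
  rewrite -RintegralZr//; last first.
    apply: (integrableM_bounded (K := 1) (integrable_normal_pdf u 1)).
      exact: measurable_cosMD.
    by move=> y; exact: norm_cos_le1.
  apply: eq_Rintegral => y _; rewrite /f mulrA; congr (_ * cos _ * _); ring.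
rewrite normal_pdf_fourier ?oner_neq0// /gauss expr1n mul1r sqrrN.
by congr (expR _ * cos _ * _); ring.
Qed.

End sinc_kernel.

(** * Squared distances of product functions *)

Section product_difference.
Context {R : realType}.
Notation mu := (@lebesgue_measure R).

Lemma measurable_tuple_prod (d : nat) (f : 'I_d -> R -> R) :
  (forall i, measurable_fun setT (f i)) ->
  measurable_fun [set: euclid R d] (fun x => \prod_i f i (tnth x i)).
Proof. by move=> mf; exact: (@measurable_prod_tnth _ (measurableTypeR R) R). Qed.

Lemma ge0_integral_tuple_prod_le (d : nat) (f : 'I_d -> R -> R) (M : R) :
  (forall i, measurable_fun setT (f i)) -> (forall i x, 0 <= f i x) ->
  (forall i, \int[mu]_x (f i x)%:E <= M%:E)%E ->
  (\int[lebesgue_measure_d R d]_x (\prod_i f i (tnth x i))%:E <= (M ^+ d)%:E)%E.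
Proof.
move=> mf f0 fM; rewrite /lebesgue_measure_d (ge0_integral_tuple_prod mu)//.
have -> : (M ^+ d)%:E = (\prod_(i < d) M%:E)%E by rewrite prodEFin prodr_const card_ord.
apply: (proj2 (A := (0 <= \prod_(i < d) \int[mu]_x (f i x)%:E)%E)).
apply: (big_ind2 (fun x y => (0 <= x)%E /\ (x <= y)%E)) => //.
- by move=> x y z w [x0 xy] [z0 zw]; split; [exact: mule_ge0|exact: lee_pmul].
- by move=> i _; split=> //; apply: integral_ge0 => x _; rewrite lee_fin.
Qed.

Lemma measurable_EFin_sqrM d0 (T : measurableType d0) (k : R) (g : T -> R) :
  measurable_fun setT g -> measurable_fun setT (fun x => k%:E * (g x ^+ 2)%:E)%E.
Proof.
move=> mg; apply: emeasurable_funM; first exact: measurable_cst.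
by apply/measurable_EFinP; exact: measurable_funX.
Qed.

Lemma ge0_integral_sqr_lin d0 (T : measurableType d0) (m : {measure set T -> \bar R})
    (k l : R) (g h : T -> R) : 0 <= k -> 0 <= l ->
  measurable_fun setT g -> measurable_fun setT h ->
  (\int[m]_x (k%:E * (g x ^+ 2)%:E + l%:E * (h x ^+ 2)%:E) =
   k%:E * \int[m]_x (g x ^+ 2)%:E + l%:E * \int[m]_x (h x ^+ 2)%:E)%E.
Proof.
move=> k0 l0 mg mh.
have sq0 (y : R) : (0 <= (y ^+ 2)%:E)%E by rewrite lee_fin sqr_ge0.
rewrite ge0_integralD//.
- rewrite !ge0_integralZl//.
  + by apply/measurable_EFinP; exact: measurable_funX.
  + by apply/measurable_EFinP; exact: measurable_funX.
- by move=> x _; rewrite mule_ge0.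
- exact: measurable_EFin_sqrM.
- by move=> x _; rewrite mule_ge0.
- exact: measurable_EFin_sqrM.
Qed.

(** Telescoping, one coordinate at a time: with [A] and [B] the products over the
    other coordinates, [a0 * A - b0 * B = (a0 - b0) * A + b0 * (A - B)]. The base
    [2 * M + 2] is generous enough to absorb both terms of the recursion. *)
Lemma integral_prod_diff_sqr (d : nat) (a b : 'I_d -> R -> R) (M e : R) :
  0 <= M -> 0 <= e ->
  (forall i, measurable_fun setT (a i)) -> (forall i, measurable_fun setT (b i)) ->
  (forall i, \int[mu]_x (a i x ^+ 2)%:E <= M%:E)%E ->
  (forall i, \int[mu]_x (b i x ^+ 2)%:E <= M%:E)%E ->
  (forall i, \int[mu]_x ((a i x - b i x) ^+ 2)%:E <= e%:E)%E ->
  (\int[lebesgue_measure_d R d]_x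
     ((\prod_i a i (tnth x i) - \prod_i b i (tnth x i)) ^+ 2)%:E <=
   (d%:R * (2 * M + 2) ^+ d * e)%:E)%E.
Proof.
move=> M0 e0; elim: d a b => [|d IH] a b ma mb aM bM abe.
  rewrite mul0r mul0r integral0_eq// => x _.
  by rewrite !big_ord0 subrr expr0n.
pose A (x : euclid R d) := \prod_i a (lift ord0 i) (tnth x i).
pose B (x : euclid R d) := \prod_i b (lift ord0 i) (tnth x i).
have mA : measurable_fun setT A.
  exact: (measurable_tuple_prod (f := fun i => a (lift ord0 i))).
have mB : measurable_fun setT B.
  exact: (measurable_tuple_prod (f := fun i => b (lift ord0 i))).
have mD : measurable_fun [set: euclid R d.+1]
    (fun x => ((\prod_i a i (tnth x i) - \prod_i b i (tnth x i)) ^+ 2)%:E).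
  apply/measurable_EFinP; apply: measurable_funX; apply: measurable_funB;
    exact: measurable_tuple_prod.
rewrite /lebesgue_measure_d ge0_integral_tuple_cons//; last first.
  by move=> x; rewrite lee_fin sqr_ge0.
have IHd := IH _ _ (fun i => ma (lift ord0 i)) (fun i => mb (lift ord0 i))
  (fun i => aM _) (fun i => bM _) (fun i => abe _).
have A2 : (\int[lebesgue_measure_d R d]_x (A x ^+ 2)%:E <= (M ^+ d)%:E)%E.
  under eq_integral do rewrite /A -prodrXl.
  apply: (ge0_integral_tuple_prod_le (f := fun i y => a (lift ord0 i) y ^+ 2)) => //.
  - by move=> i; exact: measurable_funX.
  - by move=> i x; exact: sqr_ge0.
set c := (d%:R * (2 * M + 2) ^+ d * e) in IHd.
have c0 : 0 <= c by rewrite !mulr_ge0// exprn_ge0// addr_ge0// mulr_ge0.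
have mab : measurable_fun setT (fun x => a ord0 x - b ord0 x) by exact: measurable_funB.
have mAB : measurable_fun setT (fun y => A y - B y) by exact: measurable_funB.
have Md0 : 0 <= M ^+ d by rewrite exprn_ge0.
have sq0 (y : R) : (0 <= (y ^+ 2)%:E)%E by rewrite lee_fin sqr_ge0.
apply: (@le_trans _ _ (\int[mu]_x ((2 * M ^+ d)%:E * ((a ord0 x - b ord0 x) ^+ 2)%:E +
   (2 * c)%:E * (b ord0 x ^+ 2)%:E))%E).
  apply: ge0_le_integral => //.
  - by move=> x _; apply: integral_ge0 => y _; rewrite lee_fin sqr_ge0.
  - apply: (measurable_fun_fubini_tonelli_F
      (fun z : measurableTypeR R * euclid R d =>
       ((\prod_(i < d.+1) a i (tnth [tuple of z.1 :: z.2] i) -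
         \prod_(i < d.+1) b i (tnth [tuple of z.1 :: z.2] i)) ^+ 2)%:E)) => //.
    exact: (measurableT_comp mD (@measurable_cons_pair _ (measurableTypeR R) d)).
  - apply: emeasurable_funD.
      exact: (@measurable_EFin_sqrM _ (measurableTypeR R) _ _ mab).
    exact: (@measurable_EFin_sqrM _ (measurableTypeR R) _ _ (mb ord0)).
  - move=> x _; rewrite -!EFinM.
    apply: (@le_trans _ _ (\int[lebesgue_measure_d R d]_y
       ((2 * (a ord0 x - b ord0 x) ^+ 2)%:E * (A y ^+ 2)%:E +
        (2 * b ord0 x ^+ 2)%:E * ((A y - B y) ^+ 2)%:E))%E).
      apply: ge0_le_integral => //.
      + have mc : measurable_fun [set: euclid R d]
            (fun y : euclid R d => [tuple of x :: y] : euclid R d.+1).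
          exact: (@measurable_cons _ _ _ (measurableTypeR R)).
        exact: (measurableT_comp mD mc).
      + apply: emeasurable_funD; [exact: (measurable_EFin_sqrM _ mA)|].
        exact: (measurable_EFin_sqrM _ mAB).
      + move=> y _; rewrite -!EFinM -EFinD lee_fin !big_ord_recl.
        rewrite (_ : \prod_(i < d) a _ _ = A y); last first.
          by apply: eq_bigr => i _; rewrite tnthS.
        rewrite (_ : \prod_(i < d) b _ _ = B y); last first.
          by apply: eq_bigr => i _; rewrite tnthS.
        rewrite !tnth0; move: (a ord0 x) (b ord0 x) (A y) (B y) => a0 b0 A0 B0.
        by have := sqr_ge0 ((a0 - b0) * A0 - b0 * (A0 - B0)); nra.
    have k0 : 0 <= 2 * (a ord0 x - b ord0 x) ^+ 2 by apply: mulr_ge0 => //; exact: sqr_ge0.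
    have l0 : 0 <= 2 * b ord0 x ^+ 2 by apply: mulr_ge0 => //; exact: sqr_ge0.
    rewrite ge0_integral_sqr_lin//; apply: leeD.
      by rewrite mulrAC [X in (_ <= X)%E]EFinM; apply: lee_wpmul2l => //; rewrite lee_fin.
    by rewrite mulrAC [X in (_ <= X)%E]EFinM; apply: lee_wpmul2l => //; rewrite lee_fin.
have k0 : 0 <= 2 * M ^+ d by rewrite mulr_ge0.
have l0 : 0 <= 2 * c by rewrite mulr_ge0.
rewrite (@ge0_integral_sqr_lin _ (measurableTypeR R))//; last exact: mb.
apply: (@le_trans _ _ ((2 * M ^+ d)%:E * e%:E + (2 * c)%:E * M%:E)%E).
  by apply: leeD; apply: lee_wpmul2l => //; rewrite lee_fin.
rewrite -!EFinM -EFinD lee_fin /c exprS -[in leRHS]addn1 natrD.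
set N := 2 * M + 2; have MN : M ^+ d <= N ^+ d.
  by rewrite lerXn2r ?nnegrE//; rewrite /N; lra.
have N0 : 0 <= N ^+ d by exact: le_trans MN.
have : 2 * M ^+ d * e <= 2 * N ^+ d * e by rewrite ler_wpM2r// ler_wpM2l.
have : 0 <= d%:R * N ^+ d * e by rewrite !mulr_ge0.
have : 0 <= N ^+ d * e * M by rewrite !mulr_ge0.
have NE : N = 2 * M + 2 by [].
move: (M ^+ d) (N ^+ d) d%:R => Md Nd D H1 H2 H3; rewrite NE; lra.
Qed.

End product_difference.

(** * Gaussian mixtures *)

Section mixtures.
Context {R : realType} {d : nat}.
Notation mud := (lebesgue_measure_d R d).
Implicit Types (x y u : euclid R d) (G P : probability (euclid R d) R).

Definition shift_prod (h : R -> R) x u := \prod_(i < d) h (tnth x i - tnth u i).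

Lemma measurable_shift_prod (h : R -> R) : measurable_fun setT h ->
  measurable_fun [set: euclid R d * euclid R d] (fun z => shift_prod h z.1 z.2).
Proof.
move=> mh; apply: measurable_prod => i _; apply: (measurableT_comp mh).
have m1 : measurable_fun [set: euclid R d * euclid R d] (fun z => tnth z.1 i : R).
  exact: (measurableT_comp (@measurable_tnth _ (measurableTypeR R) d i) measurable_fst).
have m2 : measurable_fun [set: euclid R d * euclid R d] (fun z => tnth z.2 i : R).
  exact: (measurableT_comp (@measurable_tnth _ (measurableTypeR R) d i) measurable_snd).
exact: measurable_funB.
Qed.

Lemma measurable_shift_prod2 (h : R -> R) x : measurable_fun setT h ->
  measurable_fun [set: euclid R d] (fun u => shift_prod h x u).
Proof. by move=> mh; exact: (measurableT_comp (measurable_shift_prod mh) (pair1_measurable x)). Qed.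

Lemma shift_prod_le (h : R -> R) (K : R) x u : (forall z, `|h z| <= K) ->
  `|shift_prod h x u| <= K ^+ d.
Proof.
move=> hK; rewrite normr_prod (_ : K ^+ d = \prod_(i < d) K); last first.
  by rewrite prodr_const card_ord.
by apply: ler_prod => i _; rewrite normr_ge0 hK.
Qed.

Lemma normal_pdf01_bound (z : R) : `|normal_pdf 0 1 z| <= normal_peak 1.
Proof. by rewrite ger0_norm ?normal_pdf_ge0// normal_pdf_ub// oner_neq0. Qed.

Lemma gaussian_mixtureE G x :
  ((gaussian_mixture G x)%:E = \int[G]_u (shift_prod (normal_pdf 0 1) x u)%:E)%E.
Proof.
rewrite /gaussian_mixture fineK//; apply: integrable_fin_num => //.
apply: (probability_integrable_bounded G (K := normal_peak 1 ^+ d)) => [|u].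
  by apply: measurable_shift_prod2; exact: measurable_normal_pdf.
by apply: shift_prod_le; exact: normal_pdf01_bound.
Qed.

Lemma shift_prod_normal_ge0 x u : 0 <= shift_prod (normal_pdf 0 1) x u.
Proof. by apply: prodr_ge0 => i _; exact: normal_pdf_ge0. Qed.

Lemma gaussian_mixture_ge0 G x : 0 <= gaussian_mixture G x.
Proof.
by apply: Rintegral_ge0 => u _; exact: shift_prod_normal_ge0.
Qed.

Lemma measurable_gaussian_mixture G :
  measurable_fun [set: euclid R d] (gaussian_mixture G).
Proof.
apply/measurable_EFinP.
rewrite (_ : _ \o _ = fun x => \int[G]_u (shift_prod (normal_pdf 0 1) x u)%:E)%E; last first.
  by apply/funext => x /=; rewrite gaussian_mixtureE.
apply: (measurable_fun_fubini_tonelli_F (fun z : euclid R d * euclid R d =>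
  (shift_prod (normal_pdf 0 1) z.1 z.2)%:E)).
  by apply/measurable_EFinP; apply: measurable_shift_prod; exact: measurable_normal_pdf.
by move=> z; rewrite lee_fin shift_prod_normal_ge0.
Qed.

(** Tonelli's theorem: an observation is a centre [u] drawn from [G], blurred by
    Gaussian noise. *)
Lemma ge0_integral_mixture G P (F : euclid R d -> \bar R) :
  has_density P (gaussian_mixture G) ->
  measurable_fun [set: euclid R d] F -> (forall y, 0 <= F y)%E ->
  (\int[P]_y F y =
   \int[G]_u \int[mud]_y (F y * (shift_prod (normal_pdf 0 1) y u)%:E))%E.
Proof.
move=> Pf mF F0.
have mn := @measurable_normal_pdf R 0 1.
rewrite (integral_density (measurable_gaussian_mixture G) (gaussian_mixture_ge0 G) Pf)//.
rewrite (fubini_tonelli (fun z : euclid R d * euclid R d =>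
    F z.2 * (shift_prod (normal_pdf 0 1) z.2 z.1)%:E)%E)//=; last 2 first.
  apply: emeasurable_funM; first exact: (measurableT_comp mF measurable_snd).
  apply/measurable_EFinP.
  have ms : measurable_fun [set: euclid R d * euclid R d] (fun z => (z.2, z.1)).
    by apply: measurable_fun_pair.
  exact: (measurableT_comp (measurable_shift_prod mn) ms).
  by move=> z; rewrite mule_ge0// lee_fin shift_prod_normal_ge0.
apply: eq_integral => y _; rewrite gaussian_mixtureE ge0_integralZl//.
- by apply/measurable_EFinP; exact: measurable_shift_prod2.
- by move=> u _; rewrite lee_fin shift_prod_normal_ge0.
Qed.

End mixtures.

(** * Norms of the smoothed normal density *)

Section kernel_norms.
Context {R : realType}.
Notation mu := (@lebesgue_measure R).
Implicit Types (T z : R).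

Lemma normal_peak1_le1 : normal_peak 1 <= 1 :> R.
Proof.
have p0 : 0 < pi *+ 2 :> R by rewrite pmulrn_lgt0 ?pi_gt0.
rewrite /normal_peak expr1n mul1r invf_le1 ?sqrtr_gt0//.
rewrite -[leLHS]sqrtr1 ler_wsqrtr// -mulr_natl.
by have := pi_ge2 R; move: (pi : R) => p p2; lra.
Qed.

Lemma measurable_sinc_gauss T : 0 <= T -> measurable_fun setT (sinc_gauss T).
Proof. by move=> T0; apply: continuous_measurable_fun; exact: continuous_sinc_gauss. Qed.

Lemma integral_normal_pdf_sqr :
  (\int[mu]_z (normal_pdf 0 1 z ^+ 2)%:E <= (1 : R)%:E)%E.
Proof.
have mn := @measurable_normal_pdf R 0 1.
apply: (@le_trans _ _ (\int[mu]_z (normal_pdf 0 1 z)%:E)%E); last by rewrite integral_normal_pdf.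
apply: ge0_le_integral => //.
- by move=> z _; rewrite lee_fin sqr_ge0.
- by apply/measurable_EFinP; exact: measurable_funX.
- exact/measurable_EFinP.
- move=> z _; rewrite lee_fin expr2 ler_piMl ?normal_pdf_ge0//.
  by rewrite (le_trans (normal_pdf_ub _ _ (oner_neq0 _)))// normal_peak1_le1.
Qed.

Lemma integral_sinc_gauss_sqr T : 2^-1 <= T ->
  (\int[mu]_z (sinc_gauss T z ^+ 2)%:E <= (18 : R)%:E)%E.
Proof.
move=> T1; have T0 : 0 < T by apply: lt_le_trans T1; rewrite invr_gt0.
have mn := @measurable_normal_pdf R 0 1.
have mg := measurable_sinc_gauss (ltW T0).
apply: (@le_trans _ _ (\int[mu]_z (2%:E * (normal_pdf 0 1 z ^+ 2)%:E +
    2%:E * ((normal_pdf 0 1 z - sinc_gauss T z) ^+ 2)%:E))%E).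
  apply: ge0_le_integral => //.
  - by move=> z _; rewrite lee_fin sqr_ge0.
  - by apply/measurable_EFinP; exact: measurable_funX.
  - apply: emeasurable_funD; apply: (@measurable_EFin_sqrM _ _ (measurableTypeR R)) => //.
    exact: measurable_funB.
  - move=> z _; rewrite -!EFinM -EFinD lee_fin.
    by have := sqr_ge0 (2 * normal_pdf 0 1 z - sinc_gauss T z); nra.
rewrite (@ge0_integral_sqr_lin _ _ (measurableTypeR R))//; last exact: measurable_funB.
(* The squared norms of the normal density and of the smoothing error are at
   most 1 and 8. *)
apply: (@le_trans _ _ (2%:E * 1%:E + 2%:E * 8%:E)%E); last first.
  by rewrite -!EFinM -EFinD lee_fin; lra.
apply: leeD; apply: lee_wpmul2l => //; rewrite ?lee_fin//; first exact: integral_normal_pdf_sqr.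
apply: le_trans (integral_normal_sub_sinc_gauss T1) _; rewrite lee_fin.
rewrite -[leRHS]mulr1 ler_pM ?expR_ge0 ?divr_ge0 ?pi_ge0//.
  rewrite ler_pdivrMr ?pi_gt0// ler_peMr//.
  by have := pi_ge2 R; move: (pi : R) => p p2; lra.
by rewrite -expR0 ler_expR lerNl oppr0 sqr_ge0.
Qed.

Lemma sinc_gauss_bounded T : 0 <= T -> exists K : R, forall z, `|sinc_gauss T z| <= K.
Proof.
move=> T0; exists (pi^-1 * \int[mu]_(t in `[0, T]) gauss 2^-1 t) => z.
have i1 : mu.-integrable `[0, T] (EFin \o (fun t => gauss 2^-1 t * cos (t * z))).
  exact: integrableS (integrable_gauss_cosr z).
rewrite normrM ger0_norm ?invr_ge0 ?pi_ge0// ler_wpM2l ?invr_ge0 ?pi_ge0//.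
apply: le_trans (le_normr_Rintegral _ i1) _ => //.
apply: le_Rintegral => //.
- exact: (integrable_norm i1).
- exact: integrableS integrable_gauss_half.
- by move=> t _; rewrite normrM (ger0_norm (gauss_ge0 _ _)) ler_piMr ?gauss_ge0 ?norm_cos_le1.
Qed.

Lemma variance_le d0 (Y : measurableType d0) (P : probability Y R)
    (g : Y -> R) (K : R) : measurable_fun setT g -> (forall y, `|g y| <= K) ->
  \int[P]_y ((g y - \int[P]_z g z) ^+ 2) <= \int[P]_y (g y ^+ 2).
Proof.
move=> mg gK; set c := \int[P]_z g z.
have ig := probability_integrable_bounded P mg gK.
have ig2 : P.-integrable setT (EFin \o (fun x => g x ^+ 2)).
  apply: (probability_integrable_bounded P (K := K ^+ 2)) => [|x]; first exact: measurable_funX.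
  by rewrite normrX lerXn2r ?nnegrE// (le_trans _ (gK x)).
have ic : P.-integrable setT (EFin \o cst (c ^+ 2)).
  exact: (probability_integrable_bounded P (K := `|c ^+ 2|)).
have i2 := integrableZl measurableT (2 * c) ig.
have i3 : P.-integrable setT (EFin \o (fun y => 2 * c * g y - c ^+ 2)).
  exact: (integrableB measurableT i2 ic).
have intg : \int[P]_y (2 * c * g y - c ^+ 2) = c ^+ 2.
  rewrite (RintegralB measurableT i2 ic) RintegralZl//.
  rewrite Rintegral_cst//= (_ : fine _ = 1); first by rewrite -/c; ring.
  by apply: (@EFin_inj R); rewrite fineK ?fin_num_measure//; exact: probability_setT.
have -> : \int[P]_y ((g y - c) ^+ 2) = \int[P]_y (g y ^+ 2 - (2 * c * g y - c ^+ 2)).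
  by apply: eq_Rintegral => y _; ring.
by rewrite (RintegralB measurableT ig2 i3) intg gerBl sqr_ge0.
Qed.

End kernel_norms.

(** * Risk of the sinc estimator *)

Section sinc_estimator.
Context {R : realType} {d : nat}.
Notation mu := (@lebesgue_measure R).
Notation mud := (lebesgue_measure_d R d).
Implicit Types (x y u : euclid R d) (G P : probability (euclid R d) R) (T : R).

Definition sinc_estimator T n (X : n.-tuple (euclid R d)) x : R :=
  \sum_(i < n) n%:R^-1 * shift_prod (sinc_kernel T) x (tnth X i).

Lemma measurable_sinc_estimator T n : 0 <= T -> estimators (@sinc_estimator T n).
Proof.
move=> T0; rewrite /estimators/=; apply: measurable_sum => i.
apply: measurable_funM => //.
have m1 : measurable_fun [set: n.-tuple (euclid R d) * euclid R d]
    (fun z => (z.2, tnth z.1 i)).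
  apply: measurable_fun_pair; first exact: measurable_snd.
  exact: (measurableT_comp (measurable_tnth i) measurable_fst).
exact: (measurableT_comp (measurable_shift_prod (measurable_sinc_kernel T0)) m1).
Qed.

(** Smoothing commutes with mixing, so that the mean of the estimator is a mixture
    of smoothed Gaussians over the same unknown [G]. *)
Lemma sinc_kernel_mixture G P T x : 0 < T -> has_density P (gaussian_mixture G) ->
  \int[P]_y shift_prod (sinc_kernel T) x y = \int[G]_u shift_prod (sinc_gauss T) x u.
Proof.
move=> T0 Pf; pose K : R := (T / pi) ^+ d.
have mk := measurable_sinc_kernel (ltW T0).
have mg := measurable_sinc_gauss (ltW T0).
have kK y : `|shift_prod (sinc_kernel T) x y| <= K.
  by apply: shift_prod_le => z; exact: sinc_kernel_le (ltW T0).
have ik := probability_integrable_bounded P (measurable_shift_prod2 x mk) kK.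
have [A gA] := sinc_gauss_bounded (ltW T0).
have ig := probability_integrable_bounded G (measurable_shift_prod2 x mg)
  (fun u => shift_prod_le x u gA).
have iK (Q : probability (euclid R d) R) : Q.-integrable setT (EFin \o cst K).
  exact: (probability_integrable_bounded Q (K := `|K|)).
(* The kernel changes sign; adding its bound [K] makes Tonelli applicable, and
   [K] drops out at the end. *)
have F0 y : (0 <= (shift_prod (sinc_kernel T) x y + K)%:E)%E.
  by have := kK y; rewrite ler_norml => /andP[+ _]; rewrite -subr_ge0 opprK lee_fin.
have mF : measurable_fun [set: euclid R d] (fun y => (shift_prod (sinc_kernel T) x y + K)%:E).
  by apply/measurable_EFinP; apply: measurable_funD => //; exact: measurable_shift_prod2.
have := ge0_integral_mixture Pf mF F0.
have -> : (\int[P]_y (shift_prod (sinc_kernel T) x y + K)%:E =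
    (\int[P]_y shift_prod (sinc_kernel T) x y + K)%:E)%E.
  rewrite (integralD measurableT ik (iK P)) probability_integral_cst EFinD fineK//.
  exact: integrable_fin_num.
have inner u : (\int[mud]_y ((shift_prod (sinc_kernel T) x y + K)%:E *
    (shift_prod (normal_pdf 0 1) y u)%:E) = (shift_prod (sinc_gauss T) x u + K)%:E)%E.
  pose h (i : 'I_d) z := sinc_kernel T (tnth x i - z) * normal_pdf 0 1 (z - tnth u i).
  pose h' (i : 'I_d) z := normal_pdf 0 1 (z - tnth u i) : R.
  have ih' i : mu.-integrable setT (EFin \o h' i).
    exact: (integrable_shift _ (integrable_normal_pdf 0 1)).
  have ih i : mu.-integrable setT (EFin \o h i).
    have : mu.-integrable setT (EFin \o (fun z => h' i z * sinc_kernel T (tnth x i - z))).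
      apply: (integrableM_bounded (K := T / pi) (ih' i)).
        by apply: (measurableT_comp mk); exact: measurable_funB.
      by move=> z; exact: sinc_kernel_le (ltW T0).
    by apply: eq_integrable => // z _; rewrite /= mulrC.
  have Ih := integrable_tuple_prod ih; have Ih' := integrable_tuple_prod ih'.
  transitivity (\int[mud]_y ((\prod_i h i (tnth y i))%:E + K%:E * (\prod_i h' i (tnth y i))%:E))%E.
    apply: eq_integral => y _; rewrite -!EFinM -EFinD mulrDl; congr ((_ + _)%:E).
    by rewrite /shift_prod -big_split.
  rewrite (integralD measurableT Ih (integrableZl measurableT K Ih')) (integralZl measurableT Ih').
  rewrite -[X in (X + _)%E]fineK; last exact: (integrable_fin_num measurableT Ih).
  rewrite -[X in (_ + _ * X)%E]fineK; last exact: (integrable_fin_num measurableT Ih').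
  rewrite -!/(Rintegral _ _ _) !Rintegral_tuple_prod// -EFinM -EFinD.
  rewrite [X in _ + K * X]big1 ?mulr1; last first.
    move=> i _; rewrite (Rintegral_shift _ (integrable_normal_pdf 0 1)).
    by rewrite /Rintegral integral_normal_pdf.
  by congr ((_ + _)%:E); apply: eq_bigr => i _; exact: sinc_kernel_conv.
under eq_integral => u _ do rewrite inner.
rewrite (integralD measurableT ig (iK G)) probability_integral_cst.
rewrite -[X in (_ = X + _)%E]fineK ?integrable_fin_num// -EFinD => -[].
by move=> /addIr.
Qed.

(** Decomposition into variance and squared bias. The bias is an average over the
    centres [u], and Jensen's inequality moves the square inside this average. *)
Lemma sinc_estimator_pointwise G P T n x : 0 < T -> (0 < n)%N ->
  has_density P (gaussian_mixture G) ->
  (\int[tuple_measure P n]_X ((sinc_estimator T X x - gaussian_mixture G x) ^+ 2)%:E <=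
   (n%:R^-1)%:E * \int[P]_y (shift_prod (sinc_kernel T) x y ^+ 2)%:E +
   \int[G]_u ((shift_prod (sinc_gauss T) x u - shift_prod (normal_pdf 0 1) x u) ^+ 2)%:E)%E.
Proof.
move=> T0 n0 Pf; pose K : R := (T / pi) ^+ d.
have mk := measurable_sinc_kernel (ltW T0).
have mg := measurable_sinc_gauss (ltW T0).
have mn := @measurable_normal_pdf R 0 1.
have kK y : `|shift_prod (sinc_kernel T) x y| <= K.
  by apply: shift_prod_le => z; exact: sinc_kernel_le (ltW T0).
have mkx := measurable_shift_prod2 x mk.
have ik := probability_integrable_bounded P mkx kK.
have ik2 : P.-integrable setT (EFin \o (fun y => shift_prod (sinc_kernel T) x y ^+ 2)).
  apply: (probability_integrable_bounded P (K := K ^+ 2)) => [|y]; first exact: measurable_funX.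
  by rewrite normrX lerXn2r ?nnegrE// (le_trans _ (kK y)).
pose m := \int[P]_y shift_prod (sinc_kernel T) x y.
pose W y := n%:R^-1 * (shift_prod (sinc_kernel T) x y - m).
have nn0 : n%:R != 0 :> R by rewrite pnatr_eq0 -lt0n.
have mW : measurable_fun [set: euclid R d] W.
  by apply: measurable_funM => //; exact: measurable_funB.
have WM y : `|W y| <= n%:R^-1 * (K + `|m|).
  rewrite normrM ger0_norm ?invr_ge0// ler_wpM2l ?invr_ge0//.
  by rewrite (le_trans (ler_normB _ _))// lerD2r.
have im : P.-integrable setT (EFin \o cst m).
  exact: (probability_integrable_bounded P (K := `|m|)).
have W0 : \int[P]_y W y = 0.
  rewrite RintegralZl//; last exact: (integrableB measurableT ik im).
  rewrite (RintegralB measurableT ik im) [X in _ - X](_ : _ = m) ?subrr ?mulr0//.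
  by rewrite /Rintegral probability_integral_cst.
pose b := m - gaussian_mixture G x.
rewrite (eq_integral (fun X : n.-tuple (euclid R d) => ((\sum_i W (tnth X i) + b) ^+ 2)%:E)); last first.
  move=> X _; congr ((_ ^+ 2)%:E); rewrite /sinc_estimator /W /b -!mulr_sumr.
  rewrite sumrB sumr_const card_ord mulrBr -[m *+ n]mulr_natl mulKf//.
  by rewrite addrA subrK.
rewrite (integral_tuple_sum_sqr n b mW WM W0) EFinD; apply: leeD.
  have -> : (\int[P]_y (shift_prod (sinc_kernel T) x y ^+ 2)%:E =
      (\int[P]_y (shift_prod (sinc_kernel T) x y ^+ 2))%R%:E)%E.
    by rewrite fineK// integrable_fin_num.
  rewrite -EFinM lee_fin /W.
  under eq_Rintegral => y _ do rewrite exprMn.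
  rewrite RintegralZl//; last first.
    apply: (probability_integrable_bounded P (K := (K + `|m|) ^+ 2)) => [|y].
      by apply: measurable_funX; exact: measurable_funB.
    rewrite normrX lerXn2r ?nnegrE ?addr_ge0//; first exact: le_trans (kK y).
    by rewrite (le_trans (ler_normB _ _))// lerD2r.
  rewrite expr2 mulrA mulVKf//.
  by rewrite ler_wpM2l ?invr_ge0//; exact: variance_le mkx kK.
have [A gA] := sinc_gauss_bounded (ltW T0).
have ig := probability_integrable_bounded G (measurable_shift_prod2 x mg)
  (fun u => shift_prod_le x u gA).
have in_ := probability_integrable_bounded G (measurable_shift_prod2 x mn)
  (fun u => shift_prod_le x u (@normal_pdf01_bound R)).
rewrite /b /m (sinc_kernel_mixture x T0 Pf) /gaussian_mixture -(RintegralB measurableT ig in_).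
apply: (sqr_Rintegral_le G (K := A ^+ d + normal_peak 1 ^+ d)).
  by apply: measurable_funB; exact: measurable_shift_prod2.
move=> u; rewrite (le_trans (ler_normB _ _))// lerD// shift_prod_le//.
exact: normal_pdf01_bound.
Qed.

Lemma integral_shift_prod_sqr_le (h : R -> R) (M : R) u :
  measurable_fun setT h -> (\int[mu]_z (h z ^+ 2)%:E <= M%:E)%E ->
  (\int[mud]_x (shift_prod h x u ^+ 2)%:E <= (M ^+ d)%:E)%E.
Proof.
move=> mh hM; under eq_integral do rewrite /shift_prod -prodrXl.
apply: (ge0_integral_tuple_prod_le (f := fun i z => h (z - tnth u i) ^+ 2)) => //.
- move=> i; apply: measurable_funX; apply: (measurableT_comp mh); exact: measurable_funB.
- by move=> i z; exact: sqr_ge0.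
- move=> i; rewrite (ge0_integral_shift (tnth u i) (f := fun z => (h z ^+ 2)%:E))//.
    by apply/measurable_EFinP; exact: measurable_funX.
  by move=> z; rewrite lee_fin sqr_ge0.
Qed.

Lemma integral_shift_prod_sub_sqr_le T u : 2^-1 <= T ->
  (\int[mud]_x ((shift_prod (sinc_gauss T) x u - shift_prod (normal_pdf 0 1) x u) ^+ 2)%:E <=
   (d%:R * 38 ^+ d * (8 / pi * expR (- T ^+ 2)))%:E)%E.
Proof.
move=> T1; have T0 : 0 < T by apply: lt_le_trans T1; rewrite invr_gt0.
have mg := measurable_sinc_gauss (ltW T0).
have mn := @measurable_normal_pdf R 0 1.
have msh (h : R -> R) (i : 'I_d) : measurable_fun setT h ->
    measurable_fun setT (fun z : R => h (z - tnth u i)).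
  by move=> mh; apply: (measurableT_comp mh); exact: measurable_funB.
have Ish (h : R -> R) (i : 'I_d) : measurable_fun setT h ->
    (\int[mu]_z (h (z - tnth u i)%R ^+ 2)%:E = \int[mu]_z (h z ^+ 2)%:E)%E.
  move=> mh; rewrite (ge0_integral_shift (tnth u i) (f := fun z => (h z ^+ 2)%:E))//.
    by apply/measurable_EFinP; exact: measurable_funX.
  by move=> z; rewrite lee_fin sqr_ge0.
(* The number 18 bounds the squared norms of both factors. *)
have -> : 38 = 2 * 18 + 2 :> R by lra.
apply: (integral_prod_diff_sqr (a := fun i z => sinc_gauss T (z - tnth u i))
  (b := fun i z => normal_pdf 0 1 (z - tnth u i))) => //.
- by rewrite mulr_ge0 ?divr_ge0 ?pi_ge0 ?expR_ge0.
- by move=> i; exact: msh.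
- by move=> i; exact: msh.
- by move=> i; rewrite Ish//; exact: integral_sinc_gauss_sqr.
- move=> i; rewrite Ish//; apply: le_trans integral_normal_pdf_sqr _.
  by rewrite lee_fin; lra.
- move=> i; rewrite (Ish (fun z => sinc_gauss T z - normal_pdf 0 1 z)); last exact: measurable_funB.
  under eq_integral do rewrite -sqrrN opprB.
  exact: integral_normal_sub_sinc_gauss.
Qed.

(** Once [x] is integrated out, translation invariance removes the dependence on
    the observation [y] and on the centre [u]; the bound is therefore the same
    for all mixing measures [G]. *)
Lemma sinc_estimator_risk G P T n : 2^-1 <= T -> (0 < n)%N ->
  has_density P (gaussian_mixture G) ->
  (risk (@L2_loss R d) (@sinc_estimator T n) P (gaussian_mixture G) <=
   (n%:R^-1 * (2 * T / pi) ^+ d + d%:R * 38 ^+ d * (8 / pi * expR (- T ^+ 2)))%:E)%E.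
Proof.
move=> T1 n0 Pf; have T0 : 0 < T by apply: lt_le_trans T1; rewrite invr_gt0.
have mk := measurable_sinc_kernel (ltW T0).
have mg := measurable_sinc_gauss (ltW T0).
have mn := @measurable_normal_pdf R 0 1.
have mH : measurable_fun [set: n.-tuple (euclid R d) * euclid R d]
    (fun z => ((sinc_estimator T z.1 z.2 - gaussian_mixture G z.2) ^+ 2)%:E).
  apply/measurable_EFinP; apply: measurable_funX; apply: measurable_funB.
    exact: (@measurable_sinc_estimator T n (ltW T0)).
  exact: (measurableT_comp (measurable_gaussian_mixture G) measurable_snd).
have sq0 (z : R) : (0 <= (z ^+ 2)%:E)%E by rewrite lee_fin sqr_ge0.
rewrite /risk /L2_loss.
rewrite (fubini_tonelli (m1 := tuple_measure P n) (m2 := mud) _ mH)//=.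
pose A x := (\int[P]_y (shift_prod (sinc_kernel T) x y ^+ 2)%:E)%E.
pose B x := (\int[G]_u ((shift_prod (sinc_gauss T) x u - shift_prod (normal_pdf 0 1) x u) ^+ 2)%:E)%E.
have mA2 : measurable_fun [set: euclid R d * euclid R d]
    (fun z => (shift_prod (sinc_kernel T) z.1 z.2 ^+ 2)%:E).
  by apply/measurable_EFinP; apply: measurable_funX; exact: measurable_shift_prod.
have mB2 : measurable_fun [set: euclid R d * euclid R d]
    (fun z => ((shift_prod (sinc_gauss T) z.1 z.2 - shift_prod (normal_pdf 0 1) z.1 z.2) ^+ 2)%:E).
  apply/measurable_EFinP; apply: measurable_funX; apply: measurable_funB;
    exact: measurable_shift_prod.
have mA : measurable_fun [set: euclid R d] A.
  exact: (measurable_fun_fubini_tonelli_F _ mA2).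
have mB : measurable_fun [set: euclid R d] B.
  exact: (measurable_fun_fubini_tonelli_F _ mB2).
have A0 x : (0 <= A x)%E by apply: integral_ge0.
have B0 x : (0 <= B x)%E by apply: integral_ge0.
apply: (@le_trans _ _ (\int[mud]_x ((n%:R^-1)%:E * A x + B x))%E).
  apply: ge0_le_integral => //.
  - by move=> x _; apply: integral_ge0.
  - exact: (measurable_fun_fubini_tonelli_G _ mH).
  - by apply: emeasurable_funD => //; exact: emeasurable_funM.
  - by move=> x _; exact: sinc_estimator_pointwise.
rewrite ge0_integralD//; last 2 first.
- by move=> x _; rewrite mule_ge0.
- exact: emeasurable_funM.
rewrite ge0_integralZl// EFinD; apply: leeD.
  rewrite EFinM; apply: lee_wpmul2l => //.
  rewrite (fubini_tonelli (m1 := mud) (m2 := P) _ mA2)//=.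
  rewrite -[leRHS](probability_integral_cst P); apply: ge0_le_integral => //.
  - by move=> x _; apply: integral_ge0.
  - exact: (measurable_fun_fubini_tonelli_G _ mA2).
  - move=> y _; apply: integral_shift_prod_sqr_le => //.
    exact: integral_sinc_kernel_sqr.
rewrite (fubini_tonelli (m1 := mud) (m2 := G) _ mB2)//=.
rewrite -[leRHS](probability_integral_cst G); apply: ge0_le_integral => //.
- by move=> x _; apply: integral_ge0.
- exact: (measurable_fun_fubini_tonelli_G _ mB2).
- by move=> u _; exact: integral_shift_prod_sub_sqr_le.
Qed.

End sinc_estimator.

(** * Probabilities given by a density *)

Section density_probability.
Context d (T : measurableType d) (R : realType).
Context (m : {sigma_finite_measure set T -> \bar R}) (f : T -> R).
Context (mf : measurable_fun setT f) (f0 : forall x, 0 <= f x)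
  (f1 : (\int[m]_x (f x)%:E = 1)%E).

Definition density_prob (A : set T) : \bar R := (\int[m]_(x in A) (f x)%:E)%E.

Let density0 : density_prob set0 = 0%E.
Proof. by rewrite /density_prob integral_set0. Qed.

Let density_ge0 A : (0 <= density_prob A)%E.
Proof. by apply: integral_ge0 => x _; rewrite lee_fin. Qed.

Let density_sigma_additive : semi_sigma_additive density_prob.
Proof.
move=> /= F mF tF mUF; rewrite /density_prob ge0_integral_bigcup//=; last 2 first.
- by apply/measurable_EFinP; exact: measurable_funTS.
- by move=> x _; rewrite lee_fin.
apply: is_cvg_ereal_nneg_natsum_cond => n _ _.
by apply: integral_ge0 => x _; rewrite lee_fin.
Qed.

HB.instance Definition _ := isMeasure.Build _ _ _
  density_prob density0 density_ge0 density_sigma_additive.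

Let density_setT : density_prob setT = 1%E.
Proof. exact: f1. Qed.

HB.instance Definition _ :=
  @Measure_isProbability.Build _ _ R density_prob density_setT.

Lemma exists_density_probability : exists P : probability T R,
  forall A, measurable A -> P A = (\int[m]_(x in A) (f x)%:E)%E.
Proof. by exists density_prob. Qed.

End density_probability.

(** * Orthogonality of sines over a period *)

Section sine_orthogonality.
Context {R : realType}.
Notation mu := (@lebesgue_measure R).

Lemma sin_natmul_pi (n : nat) : sin (n%:R * pi) = 0 :> R.
Proof.
elim: n => [|n IH]; first by rewrite mul0r sin0.
by rewrite -natr1 mulrDl mul1r sinDpi IH oppr0.
Qed.

Lemma integral_cos_period (k : R) : sin (k * pi) = 0 -> k != 0 ->
  \int[mu]_(x in `[- pi, pi]) cos (k * x) = 0.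
Proof.
move=> sk k0; have pi0 : 0 < pi :> R := pi_gt0 R.
have ic : mu.-integrable `[- pi, pi] (EFin \o (fun x => cos (k * x))).
  apply: continuous_compact_integrable; first exact: segment_compact.
  by apply: continuous_subspaceT; exact: continuous_cosM.
apply: (@Rintegral_derive_limit R _ (fun x => k^-1 * sin (k * x)) `[- pi, pi] (fun=> - pi) (fun=> pi)) => //.
- exact: continuous_cosM.
- move=> x; have H := is_derive_sinM k x.
  have := @is_deriveZ _ _ _ _ k^-1 x 1 _ H.
  by rewrite /GRing.scale/= mulrA mulVf// mul1r.
- by move=> _; rewrite gtrN.
- by move=> n x.
- by move=> x xp; exact: nearW.
- rewrite mulrN sinN sk oppr0 mulr0 subrr; exact: cvg_cst.
Qed.

Lemma integral_sinM_sinM (a b : nat) :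
  \int[mu]_(x in `[- pi, pi]) (sin (a.+1%:R * x) * sin (b.+1%:R * x)) =
  if a == b then pi else 0.
Proof.
have pi0 : 0 < pi :> R := pi_gt0 R.
have ic k : mu.-integrable `[- pi, pi] (EFin \o (fun x => 2^-1 * cos (k * x))).
  apply: continuous_compact_integrable; first exact: segment_compact.
  apply: continuous_subspaceT => x; apply: cvgM; first exact: cvg_cst.
  exact: continuous_cosM.
have ic' k : mu.-integrable `[- pi, pi] (EFin \o (fun x => cos (k * x))).
  apply: continuous_compact_integrable; first exact: segment_compact.
  by apply: continuous_subspaceT; exact: continuous_cosM.
transitivity (\int[mu]_(x in `[- pi, pi]) (2^-1 * cos ((a.+1%:R - b.+1%:R) * x) -
    2^-1 * cos ((a.+1%:R + b.+1%:R) * x))).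
  apply: eq_Rintegral => x _; rewrite mulrBl mulrDl cosB cosD; lra.
rewrite RintegralB// !RintegralZl//.
rewrite [X in _ - _ * X]integral_cos_period; last 2 first.
- by rewrite -natrD sin_natmul_pi.
- by rewrite -natrD pnatr_eq0.
rewrite mulr0 subr0; case: eqP => [->|/eqP ab].
  under eq_Rintegral do rewrite subrr mul0r cos0.
  rewrite Rintegral_cst//= mul1r lebesgue_measure_itv/= lte_fin gtrN//= opprK.
  by rewrite -mulr2n -[pi *+ 2]mulr_natl mulKf.
rewrite integral_cos_period ?mulr0//.
  by rewrite mulrBl sinB !sin_natmul_pi mul0r mulr0 subrr.
by rewrite subr_eq0 eqr_nat eqSS.
Qed.

Lemma integral_sinM (k : R) : \int[mu]_(x in `[- pi, pi]) sin (k * x) = 0.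
Proof.
have is_ : mu.-integrable `[- pi, pi] (EFin \o (fun x => sin (k * x))).
  apply: continuous_compact_integrable; first exact: segment_compact.
  by apply: continuous_subspaceT; exact: continuous_sinM.
rewrite Rintegral_mkcond; apply: Rintegral_odd.
  by rewrite -restrict_EFin -integrable_mkcond.
move=> x; rewrite !patchE mulrN sinN.
rewrite (_ : (- x \in `[- pi, pi]%classic) = (x \in `[- pi, pi]%classic)); first by case: ifP; rewrite ?oppr0.
by apply/idP/idP; rewrite !inE/= !in_itv/= lerN2 (lerNl x pi) andbC.
Qed.

End sine_orthogonality.

(** * Integrals of finite linear combinations *)

Section linear_combinations.
Context d0 (Y : measurableType d0) (R : realType).
Context (m : {measure set Y -> \bar R}) (I : finType) (F : I -> Y -> R).
Context (iF : forall i, m.-integrable setT (EFin \o F i)).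

Lemma integrable_lincomb (a : I -> R) :
  m.-integrable setT (EFin \o (fun y => \sum_i a i * F i y)).
Proof.
rewrite (_ : _ \o _ = fun y => \sum_(i <- index_enum I) ((a i)%:E * (F i y)%:E))%E; last first.
  by apply/funext => y; rewrite /= -sumEFin; apply: eq_bigr => i _; rewrite EFinM.
by apply: integrable_sum => // i _; exact: (integrableZl measurableT (a i) (iF i)).
Qed.

Lemma Rintegral_lincomb (a : I -> R) :
  \int[m]_y (\sum_i a i * F i y) = \sum_i a i * \int[m]_y F i y.
Proof.
have iaF i := integrableZl measurableT (a i) (iF i).
apply: (@EFin_inj R); rewrite /Rintegral fineK; last first.
  exact: (integrable_fin_num measurableT (integrable_lincomb a)).
rewrite -sumEFin.
transitivity (\int[m]_y (\sum_i (a i)%:E * (F i y)%:E))%E.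
  by apply: eq_integral => y _; rewrite -sumEFin; apply: eq_bigr => i _; rewrite EFinM.
rewrite (integral_sum measurableT iaF).
apply: eq_bigr => i _; rewrite (integralZl measurableT (iF i)) EFinM fineK//.
exact: (integrable_fin_num measurableT (iF i)).
Qed.

End linear_combinations.

(** * A cube of Gaussian mixtures around a normal density *)

Section hypercube.
Context {R : realType} (d m : nat).
Notation mu := (@lebesgue_measure R).
Notation mud := (lebesgue_measure_d R d).
Implicit Types (x u : euclid R d) (c : {ffun 'I_d -> 'I_m} -> R) (b : R).

Notation J := {ffun 'I_d -> 'I_m}.

(** Frequencies start at 1 because a zero frequency would make the sine product
    vanish. *)
Definition freq (j : J) (i : 'I_d) : R := (j i).+1%:R.

Definition sine_prod (j : J) x := \prod_i sin (freq j i * tnth x i).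

(** The density of the sum of two independent standard normal vectors. *)
Definition normal2 x := \prod_i normal_pdf 0 (Num.sqrt 2) (tnth x i) : R.

Definition modulation b c x := 1 + \sum_j (b * c j) * sine_prod j x.

Definition mod_density b c x := normal2 x * modulation b c x.

(** What the coefficient of a sine product in the mixing density must be
    multiplied by, to make up for the attenuation in [normal_sin_conv]. *)
Definition gain (j : J) := \prod_i expR (freq j i ^+ 2).

(** The density of a mixing measure that produces [mod_density b c]; the
    convolution halves its frequencies and removes the gains. *)
Definition mixing_density b c u := \prod_i normal_pdf 0 1 (tnth u i) *
  (1 + \sum_j (b * c j) * (gain j * \prod_i sin (2 * freq j i * tnth u i))).

Lemma prod_norm_le1 (f : 'I_d -> R) : (forall i, `|f i| <= 1) -> `|\prod_i f i| <= 1.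
Proof.
move=> f1; elim/big_ind : _ => [|a c a1 c1|i _]; rewrite ?normr1 ?normrM//.
by rewrite -[leRHS]mul1r ler_pM.
Qed.

Lemma sine_prod_le1 j x : `|sine_prod j x| <= 1.
Proof.
by apply: prod_norm_le1 => i; exact: norm_sin_le1.
Qed.

Lemma gain_ge1 j : 1 <= gain j.
Proof.
rewrite /gain; elim/big_ind : _ => // [x y x1 y1|i _].
  by rewrite -[leLHS]mul1r ler_pM.
by rewrite -expR0 ler_expR sqr_ge0.
Qed.

Lemma lincomb_bound b c (r s : J -> R) : 0 <= b -> (forall j, `|c j| <= 1) ->
  (forall j, `|s j| <= r j) -> b * \sum_j r j <= 2^-1 ->
  `|\sum_j (b * c j) * s j| <= 2^-1.
Proof.
move=> b0 c1 sr br; apply: le_trans (ler_norm_sum _ _ _) (le_trans _ br).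
rewrite mulr_sumr; apply: ler_sum => j _; rewrite normrM normrM (ger0_norm b0) -mulrA.
by rewrite ler_wpM2l// -[leRHS]mul1r ler_pM.
Qed.

Context (d0 : (0 < d)%N).
Context (b : R) (b0 : 0 <= b) (bgain : b * \sum_j gain j <= 2^-1).

Lemma b_card : b * \sum_(j : J) 1 <= 2^-1.
Proof.
apply: le_trans bgain; rewrite ler_wpM2l//; apply: ler_sum => j _; exact: gain_ge1.
Qed.

Lemma modulation_ge c x : (forall j, `|c j| <= 1) -> 2^-1 <= modulation b c x.
Proof.
move=> c1; have := lincomb_bound b0 c1 (fun j => sine_prod_le1 j x) b_card.
rewrite ler_norml => /andP[H _]; rewrite /modulation; move: (\sum_j _) H => s H; lra.
Qed.

Lemma normal2_gt0 x : 0 < normal2 x.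
Proof.
apply: prodr_gt0 => i _; rewrite normal_pdf_gauss ?sqrtr_eq0 -?ltNge//.
by rewrite mulr_gt0 ?expR_gt0// normal_peak_gt0// sqrtr_eq0 -ltNge.
Qed.

Lemma mod_density_ge c x : (forall j, `|c j| <= 1) -> normal2 x / 2 <= mod_density b c x.
Proof.
by move=> c1; rewrite /mod_density ler_wpM2l ?modulation_ge// ltW// normal2_gt0.
Qed.

Lemma mod_density_gt0 c x : (forall j, `|c j| <= 1) -> 0 < mod_density b c x.
Proof.
by move=> c1; apply: lt_le_trans (mod_density_ge x c1); rewrite divr_gt0 ?normal2_gt0.
Qed.

Lemma mixing_density_ge0 c u : (forall j, `|c j| <= 1) -> 0 <= mixing_density b c u.
Proof.
move=> c1; rewrite mulr_ge0//.
  by apply: prodr_ge0 => i _; exact: normal_pdf_ge0.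
have H j : `|gain j * \prod_i sin (2 * freq j i * tnth u i)| <= gain j.
  rewrite normrM ger0_norm; last by rewrite (le_trans ler01)// gain_ge1.
  rewrite ler_piMr//; first by rewrite (le_trans ler01)// gain_ge1.
  by apply: prod_norm_le1 => i; exact: norm_sin_le1.
have := lincomb_bound b0 c1 H bgain.
rewrite ler_norml => /andP[{}H _]; move: (\sum_j _) H => s H; lra.
Qed.

Lemma sqrt2_neq0 : Num.sqrt (2 : R) != 0.
Proof. by rewrite sqrtr_eq0 -ltNge. Qed.

Lemma normal2_sineE j x : normal2 x * sine_prod j x =
  \prod_i (normal_pdf 0 (Num.sqrt 2) (tnth x i) * sin (freq j i * tnth x i)).
Proof. by rewrite -big_split. Qed.

Lemma integrable_normal_sin (s t : R) :
  mu.-integrable setT (EFin \o (fun z => normal_pdf 0 s z * sin (t * z))).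
Proof.
apply: (integrableM_bounded (K := 1) (integrable_normal_pdf 0 s)).
  exact: measurable_sinM.
by move=> z; exact: norm_sin_le1.
Qed.

Lemma Rintegral_normal_sin (s t : R) : s != 0 ->
  \int[mu]_z (normal_pdf 0 s z * sin (t * z)) = 0.
Proof.
move=> s0; apply: Rintegral_odd; first exact: integrable_normal_sin.
by move=> z; rewrite !normal_pdf_gauss// !subr0 /gauss sqrrN mulrN sinN mulrN.
Qed.

Lemma integrable_normal2 : mud.-integrable setT (EFin \o normal2).
Proof.
apply: (integrable_tuple_prod (m := mu) (f := fun=> normal_pdf 0 (Num.sqrt 2))) => i.
exact: integrable_normal_pdf.
Qed.

Lemma Rintegral_normal2 : \int[mud]_x normal2 x = 1.
Proof.
rewrite /normal2 (Rintegral_tuple_prod (m := mu) (f := fun=> normal_pdf 0 (Num.sqrt 2))).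
  by apply: big1 => i _; rewrite /Rintegral integral_normal_pdf.
by move=> i; exact: integrable_normal_pdf.
Qed.

Lemma integrable_normal2_sine j :
  mud.-integrable setT (EFin \o (fun x => normal2 x * sine_prod j x)).
Proof.
have H i := integrable_normal_sin (Num.sqrt 2) (freq j i).
have := integrable_tuple_prod (m := mu) H.
by apply: eq_integrable => // x _; rewrite /= normal2_sineE.
Qed.

Lemma Rintegral_normal2_sine j : \int[mud]_x (normal2 x * sine_prod j x) = 0.
Proof.
under eq_Rintegral do rewrite normal2_sineE.
rewrite (Rintegral_tuple_prod (m := mu) (f := fun i z => normal_pdf 0 (Num.sqrt 2) z * sin (freq j i * z))).
  by rewrite (bigD1 (Ordinal d0))//= Rintegral_normal_sin ?mul0r// sqrt2_neq0.
by move=> i; exact: integrable_normal_sin.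
Qed.

Lemma mod_densityE c x : mod_density b c x =
  normal2 x + \sum_j (b * c j) * (normal2 x * sine_prod j x).
Proof.
rewrite /mod_density /modulation mulrDr mulr1 mulr_sumr; congr (_ + _).
by apply: eq_bigr => j _; rewrite mulrCA.
Qed.

Lemma integrable_mod_density c : mud.-integrable setT (EFin \o mod_density b c).
Proof.
have H := integrableD measurableT integrable_normal2
  (integrable_lincomb integrable_normal2_sine (fun j => b * c j)).
by apply: eq_integrable H => // x _; rewrite /= mod_densityE EFinD.
Qed.

Lemma measurable_mod_density c : measurable_fun [set: euclid R d] (mod_density b c).
Proof. by apply/measurable_EFinP; exact: measurable_int (integrable_mod_density c). Qed.

Lemma Rintegral_mod_density c : \int[mud]_x mod_density b c x = 1.
Proof.
under eq_Rintegral do rewrite mod_densityE.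
rewrite (RintegralD measurableT integrable_normal2
  (integrable_lincomb integrable_normal2_sine (fun j => b * c j))).
rewrite Rintegral_normal2 (Rintegral_lincomb integrable_normal2_sine).
by rewrite big1 ?addr0// => j _; rewrite Rintegral_normal2_sine mulr0.
Qed.

Lemma exists_mod_law c : (forall j, `|c j| <= 1) ->
  exists P : probability (euclid R d) R, has_density P (mod_density b c).
Proof.
move=> c1; apply: exists_density_probability.
- exact: measurable_mod_density.
- by move=> x; exact: ltW (mod_density_gt0 x c1).
- rewrite -[LHS]fineK ?integrable_fin_num ?integrable_mod_density//.
  by congr EFin; exact: Rintegral_mod_density.
Qed.

Let mix_base u := \prod_i normal_pdf 0 1 (tnth u i) : R.
Let mix_sine j u := \prod_i (normal_pdf 0 1 (tnth u i) * sin (2 * freq j i * tnth u i)) : R.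

Let mixing_densityE c u : mixing_density b c u =
  mix_base u + \sum_j (b * c j * gain j) * mix_sine j u.
Proof.
rewrite /mixing_density mulrDr mulr1 mulr_sumr; congr (_ + _).
apply: eq_bigr => j _; rewrite /mix_sine big_split /= -/(mix_base u).
by rewrite mulrCA -!mulrA; congr (_ * (_ * _)); rewrite mulrCA.
Qed.

(** By Fubini the mixture factors over coordinates, where [normal_conv] and
    [normal_sin_conv] apply, and the gains cancel the attenuations. The bound on
    the total gain makes the mixing density nonnegative, and so restricts the
    amplitude [b]. *)
Lemma mod_density_mixture c : (forall j, `|c j| <= 1) ->
  gaussian_mixtures R d (mod_density b c).
Proof.
move=> c1.
have ib : mud.-integrable setT (EFin \o mix_base).
  apply: (integrable_tuple_prod (m := mu) (f := fun=> normal_pdf 0 1)) => i.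
  exact: integrable_normal_pdf.
have is_ j : mud.-integrable setT (EFin \o mix_sine j).
  apply: (integrable_tuple_prod (m := mu)
    (f := fun i z => normal_pdf 0 1 z * sin (2 * freq j i * z))) => i.
  exact: integrable_normal_sin.
have il := integrable_lincomb is_ (fun j => b * c j * gain j).
have iq : mud.-integrable setT (EFin \o mixing_density b c).
  by apply: eq_integrable (integrableD measurableT ib il) => // u _;
    rewrite /= mixing_densityE EFinD.
have mq : measurable_fun [set: euclid R d] (mixing_density b c).
  by apply/measurable_EFinP; exact: measurable_int iq.
have q0 u : 0 <= mixing_density b c u by exact: mixing_density_ge0.
have Rq1 : \int[mud]_u mixing_density b c u = 1.
  under eq_Rintegral do rewrite mixing_densityE.
  rewrite (RintegralD measurableT ib il) (Rintegral_lincomb is_).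
  rewrite big1 ?addr0 => [|j _].
    rewrite (Rintegral_tuple_prod (m := mu) (f := fun=> normal_pdf 0 1)).
      by apply: big1 => i _; rewrite /Rintegral integral_normal_pdf.
    by move=> i; exact: integrable_normal_pdf.
  rewrite (Rintegral_tuple_prod (m := mu) (f := fun i z => normal_pdf 0 1 z * sin (2 * freq j i * z))).
    by rewrite (bigD1 (Ordinal d0))//= Rintegral_normal_sin ?mul0r ?mulr0// oner_neq0.
  by move=> i; exact: integrable_normal_sin.
have q1 : (\int[mud]_u (mixing_density b c u)%:E = 1)%E.
  by rewrite -[LHS]fineK ?integrable_fin_num//; congr EFin; exact: Rq1.
have [G Gq] := exists_density_probability mq q0 q1.
exists G => //; apply/funext => x.
pose k u := shift_prod (normal_pdf 0 1) x u : R.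
have mk : measurable_fun [set: euclid R d] k.
  by apply: measurable_shift_prod2; exact: measurable_normal_pdf.
apply: (@EFin_inj R); rewrite gaussian_mixtureE.
rewrite (integral_density mq q0 Gq); last 2 first.
- exact/measurable_EFinP.
- by move=> u; rewrite lee_fin shift_prod_normal_ge0.
pose k0 (i : 'I_d) z := normal_pdf 0 1 (tnth x i - z) * normal_pdf 0 1 z : R.
pose k1 j (i : 'I_d) z := normal_pdf 0 1 (tnth x i - z) *
  (normal_pdf 0 1 z * sin (2 * freq j i * z)) : R.
have mn (i : 'I_d) : measurable_fun setT (fun z : R => normal_pdf 0 1 (tnth x i - z) : R).
  by apply: (measurableT_comp (measurable_normal_pdf 0 1)); exact: measurable_funB.
have ik0 i : mu.-integrable setT (EFin \o k0 i).
  have := integrableM_bounded (integrable_normal_pdf 0 1) (mn i)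
    (fun z => @normal_pdf01_bound R (tnth x i - z)).
  by apply: eq_integrable => // z _; rewrite /k0 /= mulrC.
have ik1 j i : mu.-integrable setT (EFin \o k1 j i).
  have := integrableM_bounded (integrable_normal_sin 1 (2 * freq j i)) (mn i)
    (fun z => @normal_pdf01_bound R (tnth x i - z)).
  by apply: eq_integrable => // z _; rewrite /k1 /= mulrC.
have iK0 := integrable_tuple_prod (m := mu) ik0.
have iK1 j := integrable_tuple_prod (m := mu) (ik1 j).
have iL := integrable_lincomb iK1 (fun j => b * c j * gain j).
transitivity ((\int[mud]_u (\prod_i k0 i (tnth u i) +
    \sum_j (b * c j * gain j) * \prod_i k1 j i (tnth u i)))%R%:E); last first.
  rewrite (RintegralD measurableT iK0 iL) (Rintegral_lincomb iK1) mod_densityE.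
  rewrite (Rintegral_tuple_prod (m := mu) ik0); congr ((_ + _)%:E).
    by apply: eq_bigr => i _; exact: normal_conv.
  apply: eq_bigr => j _; rewrite (Rintegral_tuple_prod (m := mu) (ik1 j)).
  under [X in _ * X = _]eq_bigr => i _ do rewrite normal_sin_conv.
  rewrite big_split/= -normal2_sineE -!mulrA; congr (_ * (_ * _)).
  rewrite mulrA -big_split/= big1 ?mul1r// => i _.
  by rewrite expRN mulfV// gt_eqF// expR_gt0.
rewrite fineK; last first.
  by apply: (integrable_fin_num measurableT); exact: (integrableD measurableT iK0 iL).
apply: eq_integral => u _; rewrite -EFinM; congr EFin.
rewrite mixing_densityE mulrDr mulr_sumr; congr (_ + _).
  by rewrite /k /shift_prod -big_split.
apply: eq_bigr => j _; rewrite mulrCA; congr (_ * _).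
by rewrite /k /shift_prod -big_split.
Qed.

End hypercube.

(** * Sine products on the cube of side 2 pi *)

Section cube.
Context {R : realType} (d m : nat).
Notation mu := (@lebesgue_measure R).
Notation mud := (lebesgue_measure_d R d).
Notation J := {ffun 'I_d -> 'I_m}.
Implicit Types (x : euclid R d) (a c : J -> R) (j k : J).

Notation S := (@sine_prod R d m).

Definition cube_indic x : R := \prod_i \1_(`[- pi, pi]%classic : set R) (tnth x i).

Definition cube_form a c x := cube_indic x * ((\sum_j a j * S j x) * (\sum_j c j * S j x)).

Definition cube_lin a x := cube_indic x * (\sum_j a j * S j x).

Lemma integrable_indic_continuous (f : R -> R) : continuous f ->
  mu.-integrable setT (EFin \o (fun z => \1_(`[- pi, pi]%classic : set R) z * f z)).
Proof.
move=> cf; have : mu.-integrable `[- pi, pi] (EFin \o f).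
  apply: continuous_compact_integrable; first exact: segment_compact.
  exact: continuous_subspaceT.
rewrite integrable_mkcond//; apply: eq_integrable => // z _.
by rewrite restrict_EFin patch_indic /= mulrC.
Qed.

Lemma Rintegral_indicM (f : R -> R) :
  \int[mu]_z (\1_(`[- pi, pi]%classic : set R) z * f z) = \int[mu]_(z in `[- pi, pi]) f z.
Proof.
by rewrite [RHS]Rintegral_mkcond patch_indic; apply: eq_Rintegral => z _; rewrite mulrC.
Qed.

Let prod2 j k x := \prod_i (\1_(`[- pi, pi]%classic : set R) (tnth x i) *
  (sin (freq j i * tnth x i) * sin (freq k i * tnth x i))).

Let prod1 j x := \prod_i (\1_(`[- pi, pi]%classic : set R) (tnth x i) *
  sin (freq j i * tnth x i)).

Let integrable_prod2 j k : mud.-integrable setT (EFin \o prod2 j k).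
Proof.
apply: (integrable_tuple_prod (m := mu) (f := fun i z => \1_(`[- pi, pi]%classic : set R) z *
  (sin (freq j i * z) * sin (freq k i * z)))) => i.
apply: integrable_indic_continuous => z; apply: cvgM; exact: continuous_sinM.
Qed.

Let integrable_prod1 j : mud.-integrable setT (EFin \o prod1 j).
Proof.
apply: (integrable_tuple_prod (m := mu) (f := fun i z => \1_(`[- pi, pi]%classic : set R) z *
  sin (freq j i * z))) => i.
by apply: integrable_indic_continuous; exact: continuous_sinM.
Qed.

Let Rintegral_prod2 j k : \int[mud]_x prod2 j k x = if j == k then pi ^+ d else 0.
Proof.
rewrite (Rintegral_tuple_prod (m := mu) (f := fun i z => \1_(`[- pi, pi]%classic : set R) z *
  (sin (freq j i * z) * sin (freq k i * z)))); last first.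
  by move=> i; apply: integrable_indic_continuous => z; apply: cvgM; exact: continuous_sinM.
under eq_bigr do rewrite Rintegral_indicM integral_sinM_sinM.
case: eqP => [->|/eqP jk].
  under eq_bigr do rewrite eqxx.
  by rewrite prodr_const card_ord.
have [i ji] : exists i, j i != k i.
  by apply/existsP; move: jk; apply: contraNT; rewrite negb_exists => /forallP H;
    apply/eqP/ffunP => i; apply/eqP; move: (H i); rewrite negbK.
by rewrite (bigD1 i)//= val_eqE (negbTE ji) mul0r.
Qed.

(** Distinct multi-indices differ in some coordinate, and there the product of the
    two sines integrates to zero over a period. *)
Lemma cube_formP a c : mud.-integrable setT (EFin \o cube_form a c) /\
  \int[mud]_x cube_form a c x = pi ^+ d * \sum_j a j * c j.
Proof.
have E x : cube_form a c x = \sum_(p : J * J) (a p.1 * c p.2) * prod2 p.1 p.2 x.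
  rewrite /cube_form mulr_suml mulr_sumr -(pair_bigA _ (fun j k => a j * c k * prod2 j k x))/=.
  apply: eq_bigr => j _; rewrite mulr_sumr mulr_sumr; apply: eq_bigr => k _.
  rewrite /prod2 !big_split/= -/(cube_indic x) -/(S j x) -/(S k x); ring.
have ip (p : J * J) := integrable_prod2 p.1 p.2.
split.
  apply: eq_integrable (integrable_lincomb ip (fun p => a p.1 * c p.2)) => // x _.
  by rewrite /= E.
under eq_Rintegral do rewrite E.
rewrite (Rintegral_lincomb ip) mulr_sumr -(pair_bigA _ (fun j k => a j * c k * \int[mud]_x prod2 j k x))/=.
apply: eq_bigr => j _; rewrite (bigD1 j)//= Rintegral_prod2 eqxx big1 ?addr0 1?mulrC// => k kj.
by rewrite Rintegral_prod2 eq_sym (negbTE kj) mulr0.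
Qed.

Lemma cube_linP a : (0 < d)%N -> mud.-integrable setT (EFin \o cube_lin a) /\
  \int[mud]_x cube_lin a x = 0.
Proof.
move=> d0; have E x : cube_lin a x = \sum_j a j * prod1 j x.
  rewrite /cube_lin mulr_sumr; apply: eq_bigr => j _.
  by rewrite /prod1 big_split/= -/(cube_indic x) -/(S j x) mulrCA.
split.
  by apply: eq_integrable (integrable_lincomb integrable_prod1 a) => // x _; rewrite /= E.
under eq_Rintegral do rewrite E.
rewrite (Rintegral_lincomb integrable_prod1) big1// => j _.
rewrite (Rintegral_tuple_prod (m := mu) (f := fun i z => \1_(`[- pi, pi]%classic : set R) z *
  sin (freq j i * z))); last first.
  by move=> i; apply: integrable_indic_continuous; exact: continuous_sinM.
by rewrite (bigD1 (Ordinal d0))//= Rintegral_indicM integral_sinM mul0r mulr0.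
Qed.

(** The minimum over [`[- pi, pi]] of a coordinate of [normal2], attained at the
    endpoints. *)
Definition normal2_min : R := normal_peak (Num.sqrt 2) * gauss 4^-1 pi.

Lemma normal2_min_gt0 : 0 < normal2_min.
Proof. by rewrite mulr_gt0 ?expR_gt0// normal_peak_gt0// sqrt2_neq0. Qed.

Lemma cube_indic01 x : cube_indic x = 0 \/
  (cube_indic x = 1 /\ normal2_min ^+ d <= normal2 x).
Proof.
have [/forallP cx|] := boolP [forall i, (- pi <= tnth x i) && (tnth x i <= pi)].
  right; split.
    by apply: big1 => i _; rewrite indicE mem_set//= in_itv/=.
  rewrite (_ : normal2_min ^+ d = \prod_(i < d) normal2_min); last by rewrite prodr_const card_ord.
  apply: ler_prod => i _; rewrite ltW ?normal2_min_gt0//=.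
  rewrite normal_pdf_gauss ?sqrt2_neq0// subr0 sqr_sqrtr// /normal2_min.
  rewrite ler_wpM2l ?normal_peak_ge0// /gauss ler_expR lerN2 -[2 *+ 2]mulr_natl -natrM.
  rewrite ler_wpM2l ?invr_ge0// -[leLHS]real_normK ?num_real// lerXn2r ?nnegrE ?pi_ge0//.
  by rewrite ler_norml cx.
rewrite negb_forall => /existsP[i xi]; left; rewrite /cube_indic (bigD1 i)//=.
rewrite indicE memNset ?mul0r//= in_itv/=; exact/negP.
Qed.

End cube.

(** * A dual certificate for weighted squared errors *)

Section certificate.
Context {R : realType}.

(** As [F] need not be integrable, the comparison goes through the positive part
    of [U], which [F] also bounds. *)
Lemma ge0_Rintegral_le d0 (Y : measurableType d0) (m : {measure set Y -> \bar R})
    (U : Y -> R) (F : Y -> \bar R) :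
  m.-integrable setT (EFin \o U) -> measurable_fun setT F -> (forall y, 0 <= F y)%E ->
  (forall y, (U y)%:E <= F y)%E -> ((\int[m]_y U y)%:E <= \int[m]_y F y)%E.
Proof.
move=> iU mF F0 UF; rewrite fineK; last exact: (integrable_fin_num measurableT iU).
apply: (@le_trans _ _ (\int[m]_y ((EFin \o U)^\+ y))%E).
  apply: le_integral => //; first exact: integrable_funepos.
  by move=> y _; rewrite funeposE le_max lexx.
apply: ge0_le_integral => //.
- by apply: measurable_funepos; exact: measurable_int iU.
- by move=> y _; rewrite funeposE ge_max UF F0.
Qed.

(** Termwise, [p * t ^+ 2 >= 2 * z * t - z ^+ 2 / p] with [t = y - h]. Since the
    [z e] add up to zero, [y] disappears from the lower bound: it holds for
    whatever value [y] an estimator takes. *)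
Lemma sum_sqr_certificate (E : finType) (p h z : E -> R) (y : R) :
  (forall e, 0 < p e) -> \sum_e z e = 0 ->
  \sum_e (- (2 * z e * h e) - z e ^+ 2 / p e) <= \sum_e p e * (y - h e) ^+ 2.
Proof.
move=> p0 z0.
have <- : \sum_e (- (2 * z e * h e) - z e ^+ 2 / p e + 2 * y * z e) =
    \sum_e (- (2 * z e * h e) - z e ^+ 2 / p e).
  by rewrite big_split/= -mulr_sumr z0 mulr0 addr0.
apply: ler_sum => e _; rewrite -subr_ge0.
have -> : p e * (y - h e) ^+ 2 - (- (2 * z e * h e) - z e ^+ 2 / p e + 2 * y * z e) =
    (p e * (y - h e) - z e) ^+ 2 / p e.
  by field; rewrite gt_eqF.
by rewrite divr_ge0 ?sqr_ge0// ltW.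
Qed.

End certificate.

(** * Lower bound on a weighted sum of losses *)

Section assouad.
Context {R : realType} (d m : nat).
Notation mud := (lebesgue_measure_d R d).
Notation J := {ffun 'I_d -> 'I_m}.
Notation E := {ffun J -> bool}.
Notation S := (@sine_prod R d m).
Implicit Types (x : euclid R d) (a c : J -> R) (j k : J) (e : E).
Context (d0 : (0 < d)%N) (b : R) (b0 : 0 <= b)
  (bgain : b * \sum_(j : J) gain j <= 2^-1).

Definition sgn e j : R := (-1) ^+ e j.

Definition zero_at j c : J -> R := fun k => if k == j then 0 else c k.

Definition flip j e : E := [ffun k => if k == j then ~~ e k else e k].

Lemma sgn_le1 e j : `|sgn e j| <= 1.
Proof. by rewrite normr_sign. Qed.

Lemma sgn_sqr e j : sgn e j * sgn e j = 1.
Proof. by rewrite -expr2 sqrr_sign. Qed.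

Lemma flipK j : involutive (flip j).
Proof.
by move=> e; apply/ffunP => k; rewrite !ffunE; case: (k == j); rewrite ?negbK.
Qed.

(** Flipping the sign of index [j] changes [sgn e j] and leaves
    [zero_at j (sgn e)] unchanged, so the terms cancel in pairs. *)
Lemma sum_sgn_zero_at j (F : (J -> R) -> R) :
  \sum_e sgn e j * F (zero_at j (sgn e)) = 0.
Proof.
have H : \sum_e sgn e j * F (zero_at j (sgn e)) =
    - \sum_e sgn e j * F (zero_at j (sgn e)).
  rewrite [in LHS](reindex_inj (can_inj (flipK j)))/= -sumrN; apply: eq_bigr => e _.
  rewrite /sgn ffunE eqxx signrN mulNr; congr (- (_ * F _)); apply/funext => k.
  by rewrite /zero_at; case: eqP => // /eqP kj; rewrite /sgn ffunE (negbTE kj).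
by move: H; move: (\sum_e _) => s; lra.
Qed.

(** On the cube, the certificate is applied at each [x] with
    [z e = - l * \sum_j sgn e j * s e j * sine_prod j x], whose sum over [e] vanishes
    by the hypothesis on [s]; off the cube the loss is only known to be
    nonnegative. Integrating in [x], orthogonality keeps the diagonal terms. The
    weights [p e] stand for the likelihoods of the densities given the sample. *)
Lemma weighted_loss_lower_bound (p : E -> R) (s : E -> J -> R) (l : R) (g : euclid R d -> R) :
  measurable_fun [set: euclid R d] g -> (forall e, 0 < p e) ->
  (forall j, \sum_e sgn e j * s e j = 0) ->
  ((normal2_min ^+ d ^+ 2 * pi ^+ d *
     \sum_e \sum_j (2 * l * b * s e j - l ^+ 2 * (s e j ^+ 2 / p e)))%:E <=
   \sum_e (p e)%:E * L2_loss g (mod_density b (sgn e)))%E.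
Proof.
move=> mg p0 s0; set w0 := normal2_min ^+ d.
pose a e j := sgn e j * s e j.
(* The certificate at [x], with the indicator of the cube as a factor; the term
   [cube_lin] comes from the constant 1 in [modulation] and integrates to 0. *)
pose u e x := 2 * l * cube_lin (a e) x + 2 * l * b * cube_form (a e) (sgn e) x
  - l ^+ 2 / p e * cube_form (a e) (a e) x.
have iu e : mud.-integrable setT (EFin \o u e).
  have i1 := integrableZl measurableT (2 * l) (cube_linP (a e) d0).1.
  have i2 := integrableZl measurableT (2 * l * b) (cube_formP (a e) (sgn e)).1.
  have i3 := integrableZl measurableT (l ^+ 2 / p e) (cube_formP (a e) (a e)).1.
  exact: (integrableB measurableT (integrableD measurableT i1 i2) i3).
have Iu e : \int[mud]_x u e x =
    pi ^+ d * \sum_j (2 * l * b * s e j - l ^+ 2 * (s e j ^+ 2 / p e)).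
  have i1 := integrableZl measurableT (2 * l) (cube_linP (a e) d0).1.
  have i2 := integrableZl measurableT (2 * l * b) (cube_formP (a e) (sgn e)).1.
  have i3 := integrableZl measurableT (l ^+ 2 / p e) (cube_formP (a e) (a e)).1.
  rewrite (RintegralB measurableT (integrableD measurableT i1 i2) i3).
  rewrite (RintegralD measurableT i1 i2).
  rewrite (RintegralZl _ measurableT (cube_linP (a e) d0).1) (cube_linP (a e) d0).2.
  rewrite (RintegralZl _ measurableT (cube_formP (a e) (sgn e)).1) (cube_formP _ _).2.
  rewrite (RintegralZl _ measurableT (cube_formP (a e) (a e)).1) (cube_formP _ _).2.
  rewrite mulr0 add0r sumrB mulrBr; congr (_ - _).
    rewrite mulrCA; congr (_ * _); rewrite mulr_sumr; apply: eq_bigr => j _.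
    by congr (_ * _); rewrite /a mulrAC sgn_sqr mul1r.
  rewrite mulrCA; congr (_ * _); rewrite mulr_sumr; apply: eq_bigr => j _.
  rewrite (_ : a e j * a e j = s e j ^+ 2); last by rewrite /a mulrACA sgn_sqr mul1r.
  by rewrite -mulrA; congr (_ * _); rewrite mulrC.
have mloss e : measurable_fun [set: euclid R d]
    (fun x => ((g x - mod_density b (sgn e) x) ^+ 2)%:E).
  apply/measurable_EFinP; apply: measurable_funX; apply: measurable_funB => //.
  exact: measurable_mod_density.
have sq0 (y : R) : (0 <= (y ^+ 2)%:E)%E by rewrite lee_fin sqr_ge0.
have -> : (\sum_e (p e)%:E * L2_loss g (mod_density b (sgn e)) =
    \int[mud]_x \sum_e ((p e)%:E * ((g x - mod_density b (sgn e) x) ^+ 2)%:E))%E.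
  rewrite ge0_integral_sum//.
  - apply: eq_bigr => e _; rewrite ge0_integralZl// lee_fin ltW//.
  - by move=> e; apply: emeasurable_funM => //; exact: measurable_cst.
  - by move=> e x _; rewrite mule_ge0// lee_fin ltW.
have -> : w0 ^+ 2 * pi ^+ d * (\sum_e \sum_j (2 * l * b * s e j - l ^+ 2 * (s e j ^+ 2 / p e))) =
    \int[mud]_x \sum_e w0 ^+ 2 * u e x.
  rewrite (Rintegral_lincomb iu) -mulrA mulr_sumr mulr_sumr; apply: eq_bigr => e _.
  by rewrite Iu.
apply: ge0_Rintegral_le.
- exact: (integrable_lincomb iu).
- by apply: emeasurable_sum => e; apply: emeasurable_funM => //; exact: measurable_cst.
- by move=> x; apply: sume_ge0 => e _; rewrite mule_ge0// lee_fin ltW.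
move=> x.
under [leRHS]eq_bigr do rewrite -EFinM.
rewrite sumEFin lee_fin.
(* Off the cube, the left-hand side is zero. *)
have [c0|[c1 wx]] := cube_indic01 x.
  rewrite big1 => [|e _].
    by apply: sumr_ge0 => e _; rewrite mulr_ge0 ?sqr_ge0// ltW.
  by rewrite /u /cube_lin /cube_form c0 !mul0r !mulr0 addr0 subr0 mulr0.
have wx0 := normal2_gt0 x; have nx0 : normal2 x != 0 by rewrite gt_eqF.
pose z e := - l * \sum_j a e j * S j x.
have zs : \sum_e z e = 0.
  rewrite /z -mulr_sumr exchange_big/= big1 ?mulr0// => j _.
  by rewrite -mulr_suml s0 mul0r.
have := sum_sqr_certificate (fun e => modulation b (sgn e) x) (g x / normal2 x) p0 zs.
(* Dividing by [normal2 x] turns the densities into their modulations. *)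
have -> : \sum_e p e * (g x - mod_density b (sgn e) x) ^+ 2 =
    normal2 x ^+ 2 * \sum_e p e * (g x / normal2 x - modulation b (sgn e) x) ^+ 2.
  rewrite mulr_sumr; apply: eq_bigr => e _; rewrite /mod_density [RHS]mulrCA; congr (_ * _).
  by rewrite -exprMn mulrBr (mulrCA (normal2 x)) mulfV// mulr1.
rewrite -mulr_sumr => H.
have -> : \sum_e u e x = \sum_e (- (2 * z e * modulation b (sgn e) x) - z e ^+ 2 / p e).
  apply: eq_bigr => e _; rewrite /u /cube_lin /cube_form c1 !mul1r /z /modulation.
  rewrite (_ : \sum_j (b * sgn e j) * S j x = b * \sum_j sgn e j * S j x); last first.
    by rewrite mulr_sumr; apply: eq_bigr => j _; rewrite mulrA.
  by move: (\sum_j _) (\sum_j _) => A B; field; rewrite gt_eqF.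
have w00 : 0 <= w0 by rewrite exprn_ge0// ltW// normal2_min_gt0.
have Q0 : 0 <= \sum_e p e * (g x / normal2 x - modulation b (sgn e) x) ^+ 2.
  by apply: sumr_ge0 => e _; rewrite mulr_ge0 ?sqr_ge0// ltW.
apply: (@le_trans _ _ (w0 ^+ 2 * \sum_e p e * (g x / normal2 x - modulation b (sgn e) x) ^+ 2)).
  by rewrite ler_wpM2l// sqr_ge0.
by rewrite ler_wpM2r// lerXn2r ?nnegrE// ltW.
Qed.

End assouad.

(** * Lower bound on the sum of the risks *)

Section risk_sum.
Context {R : realType} (d m : nat).
Notation mud := (lebesgue_measure_d R d).
Notation J := {ffun 'I_d -> 'I_m}.
Notation E := {ffun J -> bool}.
Notation S := (@sine_prod R d m).
Implicit Types (x : euclid R d) (c : J -> R) (j k : J) (e : E).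
Context (d0 : (0 < d)%N) (b : R) (b0 : 0 <= b)
  (bgain : b * \sum_(j : J) gain j <= 2^-1).

Notation dens := (mod_density b).

(** Its integral is one plus the chi-square divergence between the density
    stripped of its perturbation of index [j] and the full density. *)
Definition density_ratio j c x := dens (zero_at j c) x ^+ 2 / dens c x.

(** With [D] the perturbation of index [j] and [p] the full density, the ratio is
    [(p - D) ^+ 2 / p = (p - D) - D + D ^+ 2 / p], and [normal2 x <= 2 * p] controls
    the last term. *)
Lemma density_ratio_le j c x : (forall k, `|c k| <= 1) ->
  density_ratio j c x <=
  dens (zero_at j c) x - b * c j * (normal2 x * S j x) + 2 * b ^+ 2 * normal2 x.
Proof.
move=> c1; have w0 := normal2_gt0 x.
have p0 := mod_density_gt0 b0 bgain x c1.
have p2 := mod_density_ge b0 bgain x c1.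
have sE : dens (zero_at j c) x = dens c x - b * c j * (normal2 x * S j x).
  rewrite !mod_densityE (bigD1 j)//= [in RHS](bigD1 j)//= /zero_at eqxx mulr0 mul0r add0r.
  rewrite addrA addrAC addrK; congr (_ + _); apply: eq_bigr => k kj.
  by rewrite (negbTE kj).
rewrite /density_ratio sE ler_pdivrMr//.
have s1 := sine_prod_le1 j x.
have D2 : (b * c j * (normal2 x * S j x)) ^+ 2 <= b ^+ 2 * normal2 x ^+ 2.
  rewrite (_ : _ ^+ 2 = b ^+ 2 * normal2 x ^+ 2 * ((c j * S j x) ^+ 2)); last by ring.
  have H : (c j * S j x) ^+ 2 <= 1.
    by rewrite -[leLHS]real_normK ?num_real// exprn_ile1 ?normr_ge0// normrM -[leRHS]mul1r ler_pM.
  by rewrite ler_piMr// mulr_ge0// sqr_ge0.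
have : b ^+ 2 * normal2 x ^+ 2 <= 2 * b ^+ 2 * normal2 x * dens c x.
  have := ler_wpM2l (mulr_ge0 (mulr_ge0 (ler0n R 2) (sqr_ge0 b)) (ltW w0)) p2.
  by apply: le_trans; rewrite le_eqVlt; apply/orP; left; apply/eqP; field.
move: (b * c j * _) D2 => D D2 H; nra.
Qed.

Lemma density_ratio_ge0 j c x : (forall k, `|c k| <= 1) -> 0 <= density_ratio j c x.
Proof.
by move=> c1; rewrite divr_ge0 ?sqr_ge0// ltW// mod_density_gt0.
Qed.

Lemma measurable_density_ratio j c : (forall k, `|c k| <= 1) ->
  measurable_fun [set: euclid R d] (density_ratio j c).
Proof.
move=> c1; apply: measurable_funM.
  by apply: measurable_funX; exact: measurable_mod_density.
rewrite (_ : (fun x => _) = (fun y : R => y `^ (-1)) \o dens c).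
  apply: measurableT_comp; first exact: measurable_powR.
  exact: measurable_mod_density.
by apply/funext => x /=; rewrite powR_inv1// ltW// mod_density_gt0.
Qed.

Lemma integrable_density_ratio j c : (forall k, `|c k| <= 1) ->
  mud.-integrable setT (EFin \o density_ratio j c) /\
  \int[mud]_x density_ratio j c x <= 1 + 2 * b ^+ 2.
Proof.
move=> c1.
have i1 := integrable_mod_density b (zero_at j c).
have i2 := integrableZl measurableT (b * c j) (integrable_normal2_sine j).
have i3 := integrableZl measurableT (2 * b ^+ 2) (integrable_normal2 (R := R) d).
have ib := integrableD measurableT (integrableB measurableT i1 i2) i3.
have ir : mud.-integrable setT (EFin \o density_ratio j c).
  apply: le_integrable ib => //.
    by apply/measurable_EFinP; exact: measurable_density_ratio.
  move=> x _; rewrite /= lee_fin ger0_norm ?density_ratio_ge0//.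
  exact: le_trans (density_ratio_le j x c1) (ler_norm _).
split => //; apply: (@le_trans _ _ (\int[mud]_x (dens (zero_at j c) x -
    b * c j * (normal2 x * S j x) + 2 * b ^+ 2 * normal2 x))).
  by apply: le_Rintegral => // x _; exact: density_ratio_le.
rewrite (RintegralD measurableT (integrableB measurableT i1 i2) i3).
rewrite (RintegralB measurableT i1 i2) (RintegralZl _ measurableT (integrable_normal2_sine j)).
rewrite (RintegralZl _ measurableT (integrable_normal2 (R := R) d)).
by rewrite Rintegral_normal2 Rintegral_normal2_sine// Rintegral_mod_density// mulr0 subr0 mulr1.
Qed.

(** Written against Lebesgue measure on samples, the sum of the risks is a single
    integral, and [weighted_loss_lower_bound] applies at each sample with the
    likelihoods [p e] as weights. The functions [s e j], likelihoods without the
    sign of index [j], satisfy its hypothesis by [sum_sgn_zero_at]. They have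
    integral 1, while [s e j ^+ 2 / p e] has integral at most 2 as long as a
    single sign is not detectable from [n] observations; each sign then costs
    [b ^+ 2 / 2]. *)
Lemma sum_risk_lower_bound n (fhat : n.-tuple (euclid R d) -> euclid R d -> R)
    (P : E -> probability (euclid R d) R) :
  estimators fhat -> (forall e, has_density (P e) (dens (sgn e))) ->
  (1 + 2 * b ^+ 2) ^+ n <= 2 ->
  ((normal2_min ^+ d ^+ 2 * pi ^+ d * (#|{: E * J}|%:R * (b ^+ 2 / 2)))%:E <=
   \sum_e risk (@L2_loss R d) fhat (P e) (dens (sgn e)))%E.
Proof.
move=> mf Pd bn.
pose M := tuple_measure mud n.
pose p e (X : n.-tuple (euclid R d)) := \prod_i dens (sgn e) (tnth X i).
pose s e j (X : n.-tuple (euclid R d)) := \prod_i dens (zero_at j (sgn e)) (tnth X i).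
pose q e j (X : n.-tuple (euclid R d)) := \prod_i density_ratio j (sgn e) (tnth X i).
have p0 e X : 0 < p e X.
  by apply: prodr_gt0 => i _; apply: (mod_density_gt0 b0 bgain); exact: sgn_le1.
have qE e j X : s e j X ^+ 2 / p e X = q e j X.
  by rewrite /s /p /q -prodrXl -prodf_div.
have is_ e j : M.-integrable setT (EFin \o s e j).
  apply: (integrable_tuple_prod (m := mud) (f := fun=> dens (zero_at j (sgn e)))) => i.
  exact: integrable_mod_density.
have iq e j : M.-integrable setT (EFin \o q e j).
  apply: (integrable_tuple_prod (m := mud) (f := fun=> density_ratio j (sgn e))) => i.
  exact: (integrable_density_ratio j (sgn_le1 e)).1.
have Is e j : \int[M]_X s e j X = 1.
  rewrite (Rintegral_tuple_prod (m := mud) (f := fun=> dens (zero_at j (sgn e)))).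
    by apply: big1 => i _; exact: Rintegral_mod_density.
  by move=> i; exact: integrable_mod_density.
have Iq e j : \int[M]_X q e j X <= 2.
  rewrite (Rintegral_tuple_prod (m := mud) (f := fun=> density_ratio j (sgn e))).
    apply: le_trans bn; rewrite prodr_const card_ord lerXn2r ?nnegrE//.
    - by apply: Rintegral_ge0 => x _; exact: density_ratio_ge0 (sgn_le1 e).
    - by rewrite addr_ge0// mulr_ge0// sqr_ge0.
    - exact: (integrable_density_ratio j (sgn_le1 e)).2.
  by move=> i; exact: (integrable_density_ratio j (sgn_le1 e)).1.
have md e : measurable_fun [set: euclid R d] (dens (sgn e)) by exact: measurable_mod_density.
have dge0 e x : 0 <= dens (sgn e) x.
  by apply: ltW; apply: (mod_density_gt0 b0 bgain); exact: sgn_le1.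
have mp e : measurable_fun [set: n.-tuple (euclid R d)] (p e).
  exact: (measurable_prod_tnth (f := fun=> dens (sgn e))).
pose L e (X : n.-tuple (euclid R d)) := L2_loss (fhat X) (dens (sgn e)).
have mL e : measurable_fun [set: n.-tuple (euclid R d)] (L e).
  apply: (measurable_fun_fubini_tonelli_F (fun z : n.-tuple (euclid R d) * euclid R d =>
    ((fhat z.1 z.2 - dens (sgn e) z.2) ^+ 2)%:E)).
    apply/measurable_EFinP; apply: measurable_funX; apply: measurable_funB; first exact: mf.
    exact: (measurableT_comp (md e) measurable_snd).
  by move=> z; rewrite lee_fin sqr_ge0.
have L0 e X : (0 <= L e X)%E by apply: integral_ge0 => x _; rewrite lee_fin sqr_ge0.
have riskE e : risk (@L2_loss R d) fhat (P e) (dens (sgn e)) =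
    (\int[M]_X ((p e X)%:E * L e X))%E.
  rewrite /risk (integral_tuple_density (m := mud) (f := dens (sgn e)))//.
  - by apply: eq_integral => X _; rewrite muleC.
  - by move=> H mH H0; exact: integral_density (md e) (dge0 e) (Pd e) mH H0.
  - exact: mL.
  - exact: L0.
have mpL (e : E) : measurable_fun [set: n.-tuple (euclid R d)] (fun X => (p e X)%:E * L e X)%E.
  by apply: emeasurable_funM => //; exact/measurable_EFinP.
have pL0 (e : E) X : (0 <= (p e X)%:E * L e X)%E by rewrite mule_ge0// lee_fin ltW.
under [leRHS]eq_bigr do rewrite riskE.
rewrite -ge0_integral_sum//.
pose kp : R := normal2_min ^+ d ^+ 2 * pi ^+ d.
(* The summand of [weighted_loss_lower_bound] for [l = b / 2], the value that
   maximizes [2 * l * b - 2 * l ^+ 2]. *)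
pose v (i : E * J) X := b ^+ 2 * s i.1 i.2 X - (b / 2) ^+ 2 * q i.1 i.2 X.
have iv i : M.-integrable setT (EFin \o v i).
  have i1 := integrableZl measurableT (b ^+ 2) (is_ i.1 i.2).
  have i2 := integrableZl measurableT ((b / 2) ^+ 2) (iq i.1 i.2).
  exact: (integrableB measurableT i1 i2).
have Iv i : b ^+ 2 / 2 <= \int[M]_X v i X.
  have i1 := integrableZl measurableT (b ^+ 2) (is_ i.1 i.2).
  have i2 := integrableZl measurableT ((b / 2) ^+ 2) (iq i.1 i.2).
  rewrite (RintegralB measurableT i1 i2) (RintegralZl _ measurableT (is_ _ _)).
  rewrite (RintegralZl _ measurableT (iq _ _)) Is mulr1.
  have := ler_wpM2l (sqr_ge0 (b / 2)) (Iq i.1 i.2).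
  by move: (Rintegral _ _ _) => Q; rewrite expr_div_n; lra.
have kp0 : 0 <= kp by rewrite mulr_ge0 ?sqr_ge0// exprn_ge0// pi_ge0.
apply: (@le_trans _ _ (\int[M]_X (\sum_i kp * v i X))%R%:E).
  rewrite (Rintegral_lincomb iv) lee_fin -/kp -mulr_sumr ler_wpM2l//.
  rewrite mulr_natl -sumr_const; apply: ler_sum => i _; exact: Iv.
apply: ge0_Rintegral_le.
- exact: (integrable_lincomb iv).
- exact: emeasurable_sum.
- by move=> X; apply: sume_ge0.
move=> X; have mfX : measurable_fun [set: euclid R d] (fhat X).
  exact: (measurableT_comp mf (pair1_measurable X)).
have s0 j : \sum_e sgn e j * s e j X = 0.
  exact: (sum_sgn_zero_at j (fun c => \prod_i dens c (tnth X i))).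
have := weighted_loss_lower_bound d0 b (b / 2) mfX (fun e => p0 e X) s0.
apply: le_trans; rewrite lee_fin -mulr_sumr ler_wpM2l// le_eqVlt; apply/orP; left; apply/eqP.
rewrite -(pair_bigA _ (fun e j => v (e, j) X))/=; apply: eq_bigr => e _; apply: eq_bigr => j _.
by rewrite /v/= qE (_ : 2 * (b / 2) * b = b ^+ 2)//; field.
Qed.

End risk_sum.

(** * Choice of the bandwidth and of the amplitude *)

Section rates.
Context {R : realType}.
Implicit Types (d n : nat).

Lemma powR_half (x : R) d : 0 <= x -> x `^ (d%:R / 2) = Num.sqrt x ^+ d.
Proof.
by move=> x0; rewrite mulrC powRrM powR12_sqrt// powR_mulrn// sqrtr_ge0.
Qed.

Lemma ln_ge_quarter n : (2 <= n)%N -> 4^-1 <= ln n%:R :> R.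
Proof.
move=> n2; rewrite -[leLHS]expRK ler_ln ?posrE ?expR_gt0 ?ltr0n//; last exact: leq_trans n2.
apply: (@le_trans _ _ 2); last by rewrite ler_nat.
have := expR_ge1Dx (- 4^-1 : R); rewrite expRN => H.
rewrite -[leLHS]invrK -[leRHS]invrK lef_pV2 ?posrE ?invr_gt0 ?expR_gt0//.
by apply: le_trans H; lra.
Qed.

(** The bandwidth [sqrt (ln n)] brings the squared bias, of order
    [expR (- T ^+ 2)], down to the order [1 / n]. *)
Lemma minimax_upper d n : (0 < d)%N -> (2 <= n)%N ->
  (minimax_risk (gaussian_mixtures R d) L2_loss n <=
   ((1 + d%:R * 38 ^+ d * (8 * 2 ^+ d)) * (ln n%:R `^ (d%:R / 2) / n%:R))%:E)%E.
Proof.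
move=> d0 n2; have n0 : (0 < n)%N by exact: leq_trans n2.
have nR0 : 0 < n%:R :> R by rewrite ltr0n.
have L4 := ln_ge_quarter n2.
have L0 : 0 <= ln n%:R :> R by apply: le_trans L4; rewrite invr_ge0.
pose T : R := Num.sqrt (ln n%:R).
have T1 : 2^-1 <= T.
  (* The bound [2^-1] is what the bias estimate requires of the bandwidth. *)
  rewrite (_ : 2^-1 = Num.sqrt (4^-1)) ?ler_wsqrtr//.
  by rewrite (_ : 4^-1 = 2^-1 ^+ 2 :> R) ?sqrtr_sqr ?ger0_norm//; field.
have pi2 := pi_ge2 R; have pi0 := pi_gt0 R.
(* The infimum over estimators is at most the worst risk of one of them. *)
apply: (@le_trans _ _ (n%:R^-1 * (2 * T / pi) ^+ d +
    d%:R * 38 ^+ d * (8 / pi * expR (- T ^+ 2)))%:E).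
  apply: (le_trans (ereal_inf_lbound _)).
    exists (@sinc_estimator R d T n) => //; apply: measurable_sinc_estimator.
    by apply: le_trans T1; rewrite invr_ge0.
  apply: ge_ereal_sup => _ [P [f [[G _ <-] Pf ->]]].
  exact: sinc_estimator_risk.
rewrite lee_fin powR_half// -/T sqr_sqrtr// expRN lnK ?posrE//.
have T0 : 0 <= T by apply: le_trans T1; rewrite invr_ge0.
have h1 : (2 * T / pi) ^+ d <= T ^+ d.
  rewrite lerXn2r ?nnegrE ?divr_ge0 ?mulr_ge0 ?pi_ge0//.
  by rewrite ler_pdivrMr// mulrC ler_wpM2l.
have h2 : 8 / pi <= 8 * (2 ^+ d * T ^+ d).
  rewrite ler_wpM2l//; apply: (@le_trans _ _ 1).
    by rewrite invf_le1//; move: (pi : R) pi2 => p; lra.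
  rewrite -exprMn exprn_ege1//; move: T1; lra.
rewrite [leRHS]mulrDl mul1r lerD//.
  by rewrite mulrC ler_wpM2r ?invr_ge0.
rewrite -!mulrA ler_wpM2l// ler_wpM2l ?exprn_ge0//.
rewrite mulrA (mulrA 8) (mulrA (8 * _)) ler_wpM2r ?invr_ge0//.
by rewrite -mulrA.
Qed.

(** Numerator of the amplitude [lower_scale d / sqrt n]; the exponential pays for
    rounding up the number of frequencies in [minimax_lower]. *)
Definition lower_scale d : R := expR (- (4 * d%:R)) / 2.

Definition lower_const d : R := normal2_min ^+ d ^+ 2 * pi ^+ d *
  (lower_scale d ^+ 2 / 2) / Num.sqrt (8 * d%:R) ^+ d.

Lemma lower_const_gt0 d : (0 < d)%N -> 0 < lower_const d.
Proof.
move=> d0; rewrite /lower_const divr_gt0//; last first.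
  by rewrite exprn_gt0// sqrtr_gt0 mulr_gt0// ltr0n.
by rewrite !mulr_gt0 ?exprn_gt0 ?normal2_min_gt0 ?pi_gt0// divr_gt0 ?expR_gt0.
Qed.

(** Each of the [m ^ d] gains is at most [expR (d * m ^+ 2)], and
    [m <= expR (m ^+ 2)]. *)
Lemma sum_gain_le d m : (0 < d)%N ->
  \sum_(j : {ffun 'I_d -> 'I_m}) gain j <= expR (2 * (d%:R * m%:R ^+ 2)) :> R.
Proof.
move=> d0.
apply: (@le_trans _ _ (\sum_(j : {ffun 'I_d -> 'I_m}) expR (d%:R * m%:R ^+ 2))).
  apply: ler_sum => j _; rewrite expRM_natl -[d in _ ^+ d]card_ord -prodr_const.
  apply: ler_prod => i _; rewrite expR_ge0/= ler_expR lerXn2r ?nnegrE// ler_nat.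
  exact: ltn_ord.
rewrite sumr_const card_ffun !card_ord -[leLHS]mulr_natl natrX.
set D := d%:R * _; rewrite (_ : 2 * D = D + D); last by ring.
rewrite expRD ler_wpM2r ?expR_ge0// /D expRM_natl {D}.
rewrite lerXn2r ?nnegrE ?expR_ge0//.
apply: (@le_trans _ _ (m%:R ^+ 2)); last first.
  by apply: le_trans (expR_ge1Dx _); rewrite lerDr.
by rewrite -natrX ler_nat -mulnn; case: (m) => // k; rewrite leq_pmulr.
Qed.

(** The number [m] of frequencies per coordinate is [sqrt (ln n / (8 * d))] rounded
    up. It is large enough for [m ^ d] to be of order [(ln n) ^ (d / 2)], and small
    enough for the total gain to be of order [sqrt n], which allows an amplitude
    of order [1 / sqrt n]. *)
Lemma minimax_lower d n : (0 < d)%N -> (2 <= n)%N ->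
  ((lower_const d * (ln n%:R `^ (d%:R / 2) / n%:R))%:E <=
   minimax_risk (gaussian_mixtures R d) L2_loss n)%E.
Proof.
move=> d0 n2; have n0 : (0 < n)%N by exact: leq_trans n2.
have nR0 : 0 < n%:R :> R by rewrite ltr0n.
have dR0 : 0 < d%:R :> R by rewrite ltr0n.
have L0 : 0 <= ln n%:R :> R.
  by apply: le_trans (ln_ge_quarter n2); rewrite invr_ge0.
pose y : R := Num.sqrt (ln n%:R / (8 * d%:R)).
have y0 : 0 <= y by exact: sqrtr_ge0.
have y2 : y ^+ 2 = ln n%:R / (8 * d%:R) by rewrite sqr_sqrtr// divr_ge0// mulr_ge0.
pose m := (Num.truncn y).+1.
have [my ym] : m%:R <= y + 1 /\ y <= m%:R.
  have /andP[h1 h2] := truncn_itv y0; split; last exact: ltW.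
  by rewrite /m -natr1 lerD2r.
(* The exponent in [sum_gain_le]; the term [4 * d] is the effect of rounding up. *)
have dm : 2 * (d%:R * m%:R ^+ 2) <= ln n%:R / 2 + 4 * d%:R :> R.
  have H : m%:R ^+ 2 <= 2 * (ln n%:R / (8 * d%:R)) + 2 :> R.
    rewrite -y2; apply: (@le_trans _ _ ((y + 1) ^+ 2)); last by have := sqr_ge0 (y - 1); lra.
    by rewrite lerXn2r ?nnegrE ?addr_ge0.
  apply: (@le_trans _ _ (2 * (d%:R * (2 * (ln n%:R / (8 * d%:R)) + 2)))).
    by rewrite ler_wpM2l// ler_wpM2l// ltW.
  rewrite le_eqVlt; apply/orP; left; apply/eqP.
  by field; rewrite gt_eqF.
pose b : R := lower_scale d / Num.sqrt n%:R.
have sn0 : 0 < Num.sqrt n%:R :> R by rewrite sqrtr_gt0.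
have sc0 : 0 < lower_scale d by rewrite divr_gt0 ?expR_gt0.
have b0 : 0 <= b by rewrite divr_ge0 ?ltW.
have sn : expR (ln n%:R / 2) = Num.sqrt n%:R :> R.
  by rewrite -powR12_sqrt ?ltW// /powR gt_eqF// mulrC.
have bgain : b * \sum_(j : {ffun 'I_d -> 'I_m}) gain j <= 2^-1.
  apply: (@le_trans _ _ (b * expR (ln n%:R / 2 + 4 * d%:R))).
    rewrite ler_wpM2l//; apply: (le_trans (sum_gain_le m d0)).
    by rewrite ler_expR.
  rewrite expRD sn /b /lower_scale expRN.
  rewrite le_eqVlt; apply/orP; left; apply/eqP.
  by move: (expR_gt0 (4 * d%:R : R)); move: (expR _) => e e0; field; rewrite !gt_eqF.
have b2 : b ^+ 2 = lower_scale d ^+ 2 / n%:R.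
  by rewrite expr_div_n sqr_sqrtr// ltW.
have scle : lower_scale d <= 2^-1.
  by rewrite /lower_scale -[leRHS]mul1r ler_wpM2r ?invr_ge0.
have bn : (1 + 2 * b ^+ 2) ^+ n <= 2.
  apply: (@le_trans _ _ (expR (2 * b ^+ 2) ^+ n)).
    by rewrite lerXn2r ?nnegrE ?expR_ge0 ?expR_ge1Dx// addr_ge0// mulr_ge0// sqr_ge0.
  rewrite -expRM_natl b2 (_ : n%:R * _ = 2 * lower_scale d ^+ 2); last first.
    by field; rewrite gt_eqF.
  apply: (@le_trans _ _ (expR 2^-1)).
    by rewrite ler_expR; nra.
  have := expR_ge1Dx (- 2^-1 : R); rewrite expRN => H.
  rewrite -[leLHS]invrK -[leRHS]invrK lef_pV2 ?posrE ?invr_gt0 ?expR_gt0//.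
  by apply: le_trans H; lra.
apply: le_ereal_inf_tmp => _ [fhat mf <-].
have /choice[P Pd] : forall e : {ffun {ffun 'I_d -> 'I_m} -> bool},
    exists P : probability (euclid R d) R, has_density P (mod_density b (sgn e)).
  by move=> e; apply: (exists_mod_law d0 b0 bgain); exact: sgn_le1.
have := sum_risk_lower_bound d0 b0 bgain mf Pd bn.
set sup := ereal_sup _; set kw := normal2_min ^+ d ^+ 2 * pi ^+ d.
have risk_sup e : (risk (@L2_loss R d) fhat (P e) (mod_density b (sgn e)) <= sup)%E.
  apply: ereal_sup_ubound; exists (P e), (mod_density b (sgn e)); split => //.
  by apply: (mod_density_mixture d0 b0 bgain); exact: sgn_le1.
have kw0 : 0 <= kw by rewrite mulr_ge0 ?sqr_ge0// exprn_ge0// pi_ge0.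
have sup0 : (0 <= sup)%E.
  apply: le_trans (risk_sup [ffun=> false]); apply: integral_ge0 => X _.
  by apply: integral_ge0 => x _; rewrite lee_fin sqr_ge0.
move=> /le_trans /(_ (lee_sum _ (fun e _ => risk_sup e))).
case: sup sup0 {risk_sup} => [r _|_ _|//]; last by rewrite leey.
(* The worst risk is at least the average over the sign vectors. *)
rewrite sumEFin sumr_const lee_fin card_prod natrM -[leRHS]mulr_natl.
set NE : R := #|{: {ffun {ffun 'I_d -> 'I_m} -> bool}}|%:R.
have NE0 : 0 < NE by rewrite ltr0n; apply/card_gt0P; exists [ffun=> false].
rewrite -(mulrA NE) (mulrCA kw) (ler_pM2l NE0) card_ffun !card_ord natrX => H.
rewrite lee_fin; apply: le_trans H.
have -> : lower_const d * (ln n%:R `^ (d%:R / 2) / n%:R) = kw * (y ^+ d * (b ^+ 2 / 2)).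
  have -> : y = Num.sqrt (ln n%:R) / Num.sqrt (8 * d%:R).
    by rewrite -sqrtrV ?mulr_ge0// -sqrtrM.
  rewrite powR_half// /lower_const -/kw b2 (exprMn d) exprVn.
  by field; rewrite !gt_eqF// exprn_gt0// sqrtr_gt0 mulr_gt0.
by rewrite ler_wpM2l// ler_wpM2r ?divr_ge0 ?sqr_ge0// lerXn2r ?nnegrE.
Qed.

End rates.

Theorem theorem2p1 (R : realType) (d : nat) (hd : (1 <= d)%N) :
  exists c C : R, [/\ 0 < c, 0 < C &
    forall n : nat, (2 <= n)%N ->
      ((c * (ln n%:R `^ (d%:R / 2) / n%:R))%:E
         <= minimax_risk (gaussian_mixtures R d) L2_loss n)%E /\
      (minimax_risk (gaussian_mixtures R d) L2_loss n
         <= (C * (ln n%:R `^ (d%:R / 2) / n%:R))%:E)%E].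
Proof.
exists (lower_const d), (1 + d%:R * 38 ^+ d * (8 * 2 ^+ d)); split.
- exact: lower_const_gt0.
- by rewrite ltr_pwDl// !mulr_ge0 ?exprn_ge0.
- by move=> n n2; split; [exact: minimax_lower|exact: minimax_upper].
Qed.
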